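(* Let $a\in\mathbb Z$ be an integer and let $I$ be a finite sequence of integers. Then $$G_{a,I}=G_a\cdot G_I+\sum_{q\ge1,\ t\ge0}(-1)^q\binom{q-1+t}{t}\,G_{a+q+t}\cdot G_{I/\!\!/(1^q)} ,$$ where $(a,I)$ denotes the sequence $I$ with $a$ prepended and $(1^q)$ is the partition with $q$ parts equal to $1$.
   Context: The identity is one of formal power series in $\mathbb Z[[x_i,y_i]]_{i\ge1}$; the (infinite) sum on the right converges there. **Stable Grothendieck polynomials.** For $w\in S_n$ the double Grothendieck polynomial $\mathfrak G_w(x;y)$ is defined by $\mathfrak G_{w_0}=\prod_{i+j\le n}(x_i+y_j-x_iy_j)$ for the longest permutation $w_0=n\,(n-1)\cdots1$, and $\mathfrak G_w=\pi_i(\mathfrak G_{ws_i})$ whenever $s_i=(i,i+1)\in S_n$ and $\ell(ws_i)=\ell(w)+1$, where $\pi_i(f)=\frac{(1-x_{i+1})f(x_1,x_2,\dots)-(1-x_i)f(\dots,x_{i+1},x_i,\dots)}{x_i-x_{i+1}}$; this is independent of choices and of $n$. Let $1^m\times w\in S_{m+n}$ be the identity on $\{1,\dots,m\}$ and $j\mapsto w(j-m)+m$ for $j>m$; put $G_w(x;y)=\lim_{m\to\infty}\mathfrak G_{1^m\times w}\in\mathbb Z[[x_i,y_i]]_{i\ge1}$ (coefficientwise stable limit). For a partition $\lambda$ and $p\ge\ell(\lambda)$ let $w_\lambda$ be the permutation with $w_\lambda(i)=i+\lambda_{p+1-i}$ for $1\le i\le p$ and $w_\lambda(i)<w_\lambda(i+1)$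 for $i\ne p$; put $G_\lambda=G_{w_\lambda}$ (independent of $p$). The $G_\lambda$ form a $\mathbb Z$-basis of a subring $\Gamma\subset\mathbb Z[[x_i,y_i]]$. **Sequences of integers.** For $i\ge0$, $k\in\mathbb Z$ let $h_k(x_1,\dots,x_n/1^i)$ be the coefficient of $t^k$ in $(1-t)^i/\prod_{j=1}^n(1-x_jt)$. For a finite integer sequence $I=(I_1,\dots,I_\ell)$ (with $I_j=0$ for $j>\ell$) and $n\ge\ell$ put $\mathcal G_I(x_1,\dots,x_n)=\det\big(h_{I_i+j-1}(x_1,\dots,x_n/1^{i-1})\big)_{1\le i,j\le n}$. For $n\ge\ell$ with $n\ge i-I_i$ for $1\le i\le\ell$ there is a unique finite expansion $\mathcal G_I=\sum_\lambda\delta_{I,\lambda}\mathcal G_\lambda$ over partitions $\lambda$ of length $\le n$, with $\delta_{I,\lambda}\in\mathbb{Z}$ independent of $n$. Put $G_I=\sum_\lambda\delta_{I,\lambda}G_\lambda\in\Gamma$. For an integer $k$, $G_k$ means $G_{(k)}$; in particular $G_k=1$ for $k\le0$. **Coproduct constants and the operation $/\!\!/$.** $d^\nu_{\lambda\mu}\in\mathbb Z$ are the coefficients with $G_\nu(x,x';y,y')=\sum_{\lambda,\mu}d^\nu_{\lambda\mu}G_\lambda(x;y)G_\mu(x';y')$ for disjoint sets of variables $x,x',y,y'$. For an integer sequence $I$ and a partition $\lambda$, $G_{I/\!\!/\lambda}=\sum_{\nu,\mu}\delta_{I,\nu}\,d^\nu_{\lambda\mu}\,G_\mu\in\Gamma$.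 *)

(* Defs.v *)
From HB Require Import structures.
From mathcomp Require Import all_boot all_order all_algebra all_fingroup finmap.
From mathcomp Require Import mpoly.
From mathcomp Require Import boolp classical_sets functions cardinality fsbigop.

Set Implicit Arguments.
Unset Strict Implicit.
Unset Printing Implicit Defensive.

Import GRing.Theory Num.Theory.

Local Open Scope classical_set_scope.
Local Open Scope ring_scope.

(* ** The ring Z[[x_i, y_i]]                                                  *)
(* [inl i] is the variable x_{i+1} and [inr i] is y_{i+1}.  A monomial is a   *)
(* finitely supported exponent function, a series its coefficient function.  *)

Definition mon : Type := {fsfun (nat + nat) -> nat with 0%N}.

Definition series : Type := mon -> int.

Definition sadd (F G : series) : series := fun m => F m + G m.

Definition sscale (c : int) (F : series) : series := fun m => c * F m.

(* The Cauchy product.  The pointwise product that function types inherit    *)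
(* from [int] is not the multiplication of series.                           *)
Definition smul (F G : series) : series := fun m =>
  \sum_(p \in [set p : mon * mon | forall v, (p.1 v + p.2 v)%N = m v])
    F p.1 * G p.2.

(* Convergence is coefficientwise: each monomial gets a nonzero contribution *)
(* from finitely many terms.  On a non-summable family [ssum] is junk, since *)
(* a sum with infinite support is 0 in fsbigop.                              *)
Definition summable (T : choiceType) (A : set T) (F : T -> series) : Prop :=
  forall m, finite_set [set i | A i /\ F i m <> 0].

Definition ssum (T : choiceType) (A : set T) (F : T -> series) : series :=
  fun m => \sum_(i \in A) F i m.

(* ** Partitions *)

Definition is_part (s : seq nat) : bool := sorted geq s && (0%N \notin s).

Record intpart := IntPart { parts :> seq nat; _ : is_part parts }.

HB.instance Definition _ := [isSub for parts].
HB.instance Definition _ := [Choice of intpart by <:].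

Lemma is_part_ones (q : nat) : is_part (nseq q 1%N).
Proof.
apply/andP; split; last by rewrite mem_nseq andbF.
by elim: q => // -[|q] //= ->.
Qed.

Definition ones (q : nat) : intpart := IntPart (is_part_ones q).

(* ** Double Grothendieck polynomials *)

Section DoubleGrothendieck.
Variable n : nat.

Definition xv (i : 'I_n) : {mpoly int[n + n]} := 'X_(lshift n i).
Definition yv (i : 'I_n) : {mpoly int[n + n]} := 'X_(rshift n i).

Definition w0 : 'S_n := perm (@rev_ord_inj n).

Definition perm_len (w : 'S_n) : nat :=
  #|[set p : 'I_n * 'I_n | (p.1 < p.2)%N && (w p.2 < w p.1)%N]%SET|.

(* [g = pi_i f] with the denominator cleared; [j] stands for i + 1. *)
Definition is_pi (i j : 'I_n) (f g : {mpoly int[n + n]}) : Prop :=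
  (xv i - xv j) * g =
  (1 - xv j) * f - (1 - xv i) * msym (tperm (lshift n i) (lshift n j)) f.

(* Permutations compose from left to right in MathComp, so [tperm i j * w]   *)
(* is w s_i.                                                                 *)
Inductive is_dgroth : 'S_n -> {mpoly int[n + n]} -> Prop :=
| dgroth_w0 :
    is_dgroth w0
      (\prod_(i < n) \prod_(j < n | (i.+1 + j.+1 <= n)%N)
         (xv i + yv j - xv i * yv j))
| dgroth_pi (w : 'S_n) (i j : 'I_n) (f g : {mpoly int[n + n]}) :
    j = i.+1 :> nat ->
    perm_len (tperm i j * w)%g = (perm_len w).+1 ->
    is_dgroth (tperm i j * w)%g f ->
    is_pi i j f g ->
    is_dgroth w g.

Definition dgroth (w : 'S_n) : {mpoly int[n + n]} :=
  xget 0 [set f | is_dgroth w f].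

End DoubleGrothendieck.

(* ** Stable Grothendieck series *)

Definition shift_fun (m n : nat) (w : 'S_n) (i : 'I_(m + n)) : 'I_(m + n) :=
  match fintype.split i with
  | inl j => lshift n j
  | inr k => rshift m (w k)
  end.

Lemma shift_fun_inj (m n : nat) (w : 'S_n) : injective (@shift_fun m n w).
Proof.
move=> i j; rewrite /shift_fun.
case: (split_ordP i) => a ->; case: (split_ordP j) => b -> /eqP.
- by rewrite eq_lshift => /eqP ->.
- by rewrite eq_lrshift.
- by rewrite eq_rlshift.
- by rewrite eq_rshift => /eqP /perm_inj ->.
Qed.

(* 1^m x w *)
Definition shift_perm (m n : nat) (w : 'S_n) : 'S_(m + n) :=
  perm (@shift_fun_inj m n w).

(* Exponents of variables with index larger than N are dropped, which is     *)
(* harmless in the limit below, where N grows and the monomial is fixed.     *)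
Definition mon_trunc (N : nat) (m : mon) : 'X_{1..N + N} :=
  [multinom match fintype.split i with
            | inl j => m (inl (val j))
            | inr j => m (inr (val j))
            end | i < N + N].

Definition stable_groth (n : nat) (w : 'S_n) : series := fun m =>
  xget 0 [set c : int | exists k0, forall k, (k0 <= k)%N ->
            (dgroth (shift_perm k w))@_(mon_trunc (k + n) m) = c].

(* The defining conditions of w_la for p = l(la), in S_n with n = p + la_1.  *)
Definition is_grassmannian (la : intpart)
    (w : 'S_(size la + head 0%N la)) : Prop :=
  (forall i : 'I_(size la + head 0%N la), (i < size la)%N ->
     w i = (i + nth 0 la (size la - i.+1))%N :> nat) /\
  (forall i j : 'I_(size la + head 0%N la), j = i.+1 :> nat ->
     i.+1 <> size la -> (w i < w j)%N).

Definition Gpart (la : intpart) : series :=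
  stable_groth (xget 1%g [set w | is_grassmannian (la := la) w]).

(* ** Sequences of integers *)

(* h_k(x_1,...,x_n / 1^i), the coefficient of t^k in                         *)
(* (1 - t)^i / prod_j (1 - x_j t).  The geometric series 1 / (1 - x_j t) are *)
(* cut after t^k, which does not change this coefficient.                    *)
Definition hsuper (n i : nat) (k : int) : {mpoly int[n]} :=
  match k with
  | Posz d =>
      ((1 - 'X) ^+ i *
       \prod_(j < n) \sum_(a < d.+1) ('X_j ^+ a : {mpoly int[n]})%:P * 'X^a
        : {poly {mpoly int[n]}})`_d
  | Negz _ => 0
  end.

(* Indices are shifted by one: the matrix indices and [nth] start at 0. *)
Definition Gdet (n : nat) (s : seq int) : {mpoly int[n]} :=
  \det (\matrix_(i < n, j < n) hsuper n i (nth 0 s i + j%:Z)).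

Definition seq_of_part (la : intpart) : seq int := [seq k%:Z | k <- la].

Definition is_expansion (s : seq int) (delta : intpart -> int) : Prop :=
  finite_set [set la | delta la <> 0] /\
  forall n : nat, (size s <= n)%N ->
    (forall i : nat, (i < size s)%N -> i.+1%:Z - nth 0 s i <= n%:Z) ->
    (forall la, delta la <> 0 -> (size la <= n)%N) /\
    Gdet n s = \sum_(la \in [set: intpart])
                 delta la *: Gdet n (seq_of_part la).

Definition delta (s : seq int) : intpart -> int :=
  xget (fun=> 0) [set f | is_expansion s f].

Definition Gseq (s : seq int) : series :=
  ssum [set: intpart] (fun la => sscale (delta s la) (Gpart la)).

Definition Gint (k : int) : series := Gseq [:: k].

(* ** Coproduct constants *)

(* [M] is the product of [m], in the variables x, y, and of [m'], in the     *)
(* variables x', y', when the disjoint union of the two sets of variables is *)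
(* listed as x_1, x'_1, x_2, x'_2, ... and y_1, y'_1, y_2, y'_2, ...  The    *)
(* order of the listing is immaterial because stable Grothendieck series are *)
(* symmetric in the x's and in the y's.                                      *)
Definition is_interleaving (M m m' : mon) : Prop :=
  forall i : nat,
    [/\ M (inl i.*2) = m (inl i), M (inl i.*2.+1) = m' (inl i),
        M (inr i.*2) = m (inr i) & M (inr i.*2.+1) = m' (inr i)].

(* G_nu(x,x';y,y') = sum_{la,mu} d la mu G_la(x;y) G_mu(x';y'), compared     *)
(* coefficient by coefficient.                                               *)
Definition is_coproduct (nu : intpart) (d : intpart -> intpart -> int) : Prop :=
  forall M m m' : mon, is_interleaving M m m' ->
    let term (p : intpart * intpart) : int :=
      d p.1 p.2 * (Gpart p.1 m * Gpart p.2 m') in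
    finite_set [set p | term p <> 0] /\
    Gpart nu M = \sum_(p \in [set: intpart * intpart]) term p.

Definition coproduct (nu : intpart) : intpart -> intpart -> int :=
  xget (fun _ _ => 0) [set d | is_coproduct nu d].

(* G_{I // la} *)
Definition Gskew (s : seq int) (la : intpart) : series :=
  ssum [set: intpart * intpart] (fun p =>
    sscale (delta s p.1 * coproduct p.1 la p.2) (Gpart p.2)).

(* Main.v *)
(* The generating series P(z) = prod_i (1 + y_i z) / (1 - z x_i / (1 - x_i))  *)
(* governs everything: G_I is the determinant of the coefficients [z^(j-i)]   *)
(* (1 + z)^(-I_i) P(z), expanded at z = oo.  Expand the determinant of        *)
(* G_{a,I} along its first row.  The entry [z^q] (1 + z)^(-a) P(z) is sum_t   *)
(* binom(q-1+t, t) G_{a+q+t}, by Pascal's rule, and its complementary minor   *)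
(* is G_{I // (1^q)}: this is the coefficient of y_0^q after a further        *)
(* variable y_0 has been added to G_I, because y_0 multiplies P(z) by 1 + y_0 *)
(* z and because the coefficient of y_0^q in G_la is 1 if la = (1^q) and 0    *)
(* otherwise.                                                                 *)
(*                                                                            *)
(* For a partition, the determinant is found by antisymmetrizing: a weighted  *)
(* antisymmetrizer in x_1, ..., x_N is blind to the operators pi_i, hence     *)
(* does not distinguish the Grothendieck polynomial of a Grassmannian         *)
(* permutation from that of the dominant one obtained by sorting its first N  *)
(* values, and the latter is an explicit product.  For other sequences, the   *)
(* finite determinants and the series satisfy the same straightening          *)
(* relations.  The coproduct constants exist because the coefficient of a     *)
(* fixed monomial in x, y of G_nu(x,x';y,y') is a finite combination of G_mu  *)
(* with mu in a fixed box, on which leading monomials provide dual            *)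
(* functionals.                                                               *)

Require Import Defs.
From HB Require Import structures.
From mathcomp Require Import all_boot all_order all_algebra all_fingroup finmap.
From mathcomp Require Import mpoly.
From mathcomp Require Import boolp classical_sets functions cardinality fsbigop.
From mathcomp Require Import zify ring.

Set Implicit Arguments.
Unset Strict Implicit.
Unset Printing Implicit Defensive.

Import GRing.Theory Num.Theory.

Local Open Scope classical_set_scope.
Local Open Scope ring_scope.

(** * Power series in the variables x_i, y_i *)

(** The outline above rests on these lemmas. [GseqE] writes every $G_I$ as the determinant [Fser]
    with entries [cc a k], the coefficient of $z^k$ in $(1+z)^{-a}P(z)$. [Fser_cons] expands it
    along the first row, [lc_binomial] turns the entry of column $q\ge1$ into the inner sum over
    $t$, and [Gskew_ones] identifies the complementary minors with $G_{I/\!\!/(1^q)}$.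

    The passage from partitions to arbitrary sequences is straightening: two relations rewrite any
    sequence as a combination of partitions, with coefficients that depend on the sequence only
    ([straighten]). The determinants $\mathcal G_I$ satisfy them ([straightens_Gdet]) and the
    $\mathcal G_\lambda$ are independent ([Gdet_free]), so these coefficients are the
    $\delta_{I,\lambda}$. Hence $\delta$ expands every functional subject to the same relations
    ([delta_sum]), among them the coefficients of [Fser] and of its minors, and it is enough to
    treat partitions.

    For a partition, [grassmannian_dgroth] gives the Grothendieck polynomial times a Vandermonde
    determinant as a determinant of explicit products. The series determinant leads to the same
    products after multiplication by the matrix [Emx], which strips all $x$-variables but one from
    each column ([det_flagged]). Applying this to the identity permutation as well identifies the
    common factor ([io_groth]), and the limit is [GpartE].

    Since $P$ is multiplicative on disjoint unions of variables ([Pinf_ilv]), fixing a monomial in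
    one set of variables leaves a combination of determinants with lowered entries ([slice]). So all
    slices of $G_\nu(x,x';y,y')$ lie in one finite span, and dual functionals produce the coproduct
    constants ([coproduct_exists]). Comparing coefficients of $y_0^q$ ([Fser_ypow], [Gpart_ypow])
    gives [Gskew_ones]. *)

Lemma monP (a b : mon) : (forall v, a v = b v) -> a = b.
Proof. by move=> ab; apply/fsfunP. Qed.

Definition mon0 : mon := [fsfun].

Lemma mon0E v : mon0 v = 0%N.
Proof. by rewrite fsfun0E. Qed.

Definition madd (a b : mon) : mon :=
  [fsfun v in (finsupp a `|` finsupp b)%fset => (a v + b v)%N].

Lemma maddE a b v : madd a b v = (a v + b v)%N.
Proof.
rewrite fsfun_fun; case: ifPn => //; rewrite inE negb_or => /andP[va vb].
by rewrite !fsfun_dflt.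
Qed.

Lemma maddC a b : madd a b = madd b a.
Proof. by apply: monP => v; rewrite !maddE addnC. Qed.

Lemma maddA a b c : madd a (madd b c) = madd (madd a b) c.
Proof. by apply: monP => v; rewrite !maddE addnA. Qed.

Lemma madd0 a : madd a mon0 = a.
Proof. by apply: monP => v; rewrite maddE mon0E addn0. Qed.

Lemma mon0add a : madd mon0 a = a.
Proof. by rewrite maddC madd0. Qed.

Lemma maddI a : injective (madd a).
Proof.
move=> b c /(congr1 (fun x : mon => x : nat + nat -> nat)) e.
apply: monP => v; have := congr1 (@^~ v) e.
by rewrite /= !maddE => /addnI.
Qed.

Lemma madd_eq0 a b : madd a b = mon0 -> a = mon0 /\ b = mon0.
Proof.
move=> e; split; apply: monP => v; have := congr1 (fun x : mon => x v) e;
  by rewrite maddE mon0E => /eqP; rewrite addn_eq0 => /andP[/eqP ? /eqP ?].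
Qed.

(** Both factors divide [m], so each is given by a function on the support of [m] with values at
    most the largest exponent [B]. *)
Lemma finite_decs (m : mon) :
  finite_set [set p : mon * mon | forall v, (p.1 v + p.2 v)%N = m v].
Proof.
pose B := \max_(v <- finsupp m) m v.
pose ex (g : {ffun finsupp m -> 'I_B.+1}) : mon :=
  [fsfun v : finsupp m => val (g v)].
pose h := fun g : {ffun finsupp m -> 'I_B.+1} * {ffun finsupp m -> 'I_B.+1} =>
  (ex g.1, ex g.2).
have exP (a : mon) : (forall v, (a v <= m v)%N) -> exists g, ex g = a.
  move=> am; exists [ffun v => inord (a (val v))]; apply: monP => v.
  rewrite fsfun_ffun; case: insubP => [u uv <-|vm] /=.
    rewrite /= ffunE inordK // ltnS (leq_trans (am _)) //.
    by rewrite /B (big_rem (val u)) ?leq_maxl // (valP u).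
  by apply/esym/eqP; rewrite -leqn0 (leq_trans (am v)) // fsfun_dflt.
apply: (@sub_finite_set _ _ (h @` setT)); last first.
  by apply: finite_image; exact: finite_finset.
move=> [a b] /= ab.
have [g1 e1] := exP a (fun v => ltac:(by rewrite -(ab v) leq_addr)).
have [g2 e2] := exP b (fun v => ltac:(by rewrite -(ab v) leq_addl)).
by exists (g1, g2); rewrite // /h e1 e2.
Qed.

Definition decs (m : mon) : seq (mon * mon) :=
  fset_set [set p : mon * mon | forall v, (p.1 v + p.2 v)%N = m v].

Lemma decs_uniq m : uniq (decs m).
Proof. exact: fset_uniq. Qed.

Lemma mem_decs m p : (p \in decs m) = (madd p.1 p.2 == m).
Proof.
rewrite /decs in_fset_set; last exact: finite_decs.
apply/idP/eqP; rewrite inE /=.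
  by move=> pm; apply: monP => v; rewrite maddE.
by move=> <- v; rewrite maddE.
Qed.

(** Besides $\mathbb Z$, the coefficients will be polynomials in $z$, for $P(z)$, and series in a
    second set of variables, for the coproduct. *)
Definition ps (R : Type) : Type := mon -> R.

HB.instance Definition _ (R : nzRingType) := gen_eqMixin (ps R).
HB.instance Definition _ (R : nzRingType) := gen_choiceMixin (ps R).

Fact ps_key : unit. Proof. exact: tt. Qed.

Section PsZmod.
Variable R : comNzRingType.
Implicit Types F G H : ps R.

(* The operations are locked so that unification does not unfold series. *)
Definition padd : ps R -> ps R -> ps R := locked_with ps_key (fun F G m => F m + G m).
Definition popp : ps R -> ps R := locked_with ps_key (fun F m => - F m).
Definition pzero : ps R := locked_with ps_key (fun=> 0).

Lemma padd_coef F G m : padd F G m = F m + G m. Proof. by rewrite /padd unlock. Qed.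
Lemma popp_coef F m : popp F m = - F m. Proof. by rewrite /popp unlock. Qed.
Lemma pzero_coef m : pzero m = 0. Proof. by rewrite /pzero unlock. Qed.
Definition pcoef := (padd_coef, popp_coef, pzero_coef).

Lemma paddA : associative padd.
Proof. by move=> F G H; apply/funext => m; rewrite !pcoef addrA. Qed.
Lemma paddC : commutative padd.
Proof. by move=> F G; apply/funext => m; rewrite !pcoef addrC. Qed.
Lemma padd0 : left_id pzero padd.
Proof. by move=> F; apply/funext => m; rewrite !pcoef add0r. Qed.
Lemma paddN : left_inverse pzero popp padd.
Proof. by move=> F; apply/funext => m; rewrite !pcoef addNr. Qed.

HB.instance Definition _ := GRing.isZmodule.Build (ps R) paddA paddC padd0 paddN.

Lemma paddE F G m : (F + G) m = F m + G m. Proof. exact: padd_coef. Qed.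
Lemma poppE F m : (- F) m = - F m. Proof. exact: popp_coef. Qed.
Lemma pzeroE m : (0 : ps R) m = 0. Proof. exact: pzero_coef. Qed.

Lemma psumE (I : Type) (r : seq I) (P : pred I) (F : I -> ps R) m :
  (\sum_(i <- r | P i) F i) m = \sum_(i <- r | P i) F i m.
Proof. by elim/big_rec2: _ => [|i x y _ <-]; rewrite ?pzeroE ?paddE. Qed.

Definition pmul : ps R -> ps R -> ps R :=
  locked_with ps_key (fun F G m => \sum_(p <- decs m) F p.1 * G p.2).
Definition pone : ps R := locked_with ps_key (fun m => (m == mon0)%:R).

Lemma pmul_coef F G m : pmul F G m = \sum_(p <- decs m) F p.1 * G p.2.
Proof. by rewrite /pmul unlock. Qed.
Lemma pone_coef m : pone m = (m == mon0)%:R. Proof. by rewrite /pone unlock. Qed.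

Lemma pmulC : commutative pmul.
Proof.
move=> F G; apply/funext => m; rewrite !pmul_coef.
rewrite [RHS](eq_bigr (fun p => F p.2 * G p.1)) => [|p _]; last exact: mulrC.
rewrite -[RHS](big_map (fun p => (p.2, p.1)) predT (fun p => F p.1 * G p.2)).
apply/perm_big/uniq_perm; rewrite ?decs_uniq // ?map_inj_uniq ?decs_uniq //.
  by move=> [? ?] [? ?] [-> ->].
move=> [a b]; rewrite mem_decs; apply/eqP/mapP => [e|[[c d] cd [-> ->]]].
  by exists (b, a) => //; rewrite mem_decs /= maddC e.
by move: cd; rewrite mem_decs /= maddC => /eqP.
Qed.

Lemma pmulA : associative pmul.
Proof.
move=> F G H; apply/funext => m; rewrite !pmul_coef.
under eq_bigr do rewrite pmul_coef mulr_sumr.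
under [RHS]eq_bigr do rewrite pmul_coef mulr_suml.
(* Both sides run over the factorizations of [m] into three monomials, grouped by the first factor
   in [T1] and by the last one in [T2]. *)
pose T1 := [seq (p.1, q) | p <- decs m, q <- decs p.2].
pose T2 := [seq (q.1, (q.2, p.2)) | p <- decs m, q <- decs p.1].
transitivity (\sum_(t <- T1) F t.1 * (G t.2.1 * H t.2.2)).
  by rewrite /T1 big_allpairs_dep.
transitivity (\sum_(t <- T2) F t.1 * (G t.2.1 * H t.2.2)); last first.
  rewrite /T2 big_allpairs_dep.
  by apply: eq_bigr => p _; apply: eq_bigr => q _; rewrite mulrA.
apply/perm_big/uniq_perm.
- apply: allpairs_uniq_dep; try by move=> *; exact: decs_uniq.
  move=> [[a1 a2] [b1 b2]] [[c1 c2] [d1 d2]].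
  move=> /allpairsPdep [[x1 x2] [[y1 y2] [+ + e]]]; case: e => -> -> -> ->.
  rewrite !mem_decs /= => _ /eqP <-.
  move=> /allpairsPdep [[z1 z2] [[w1 w2] [+ + e]]]; case: e => -> -> -> ->.
  by rewrite !mem_decs /= => _ /eqP <- [-> -> ->].
- apply: allpairs_uniq_dep; try by move=> *; exact: decs_uniq.
  move=> [[a1 a2] [b1 b2]] [[c1 c2] [d1 d2]].
  move=> /allpairsPdep [[x1 x2] [[y1 y2] [+ + e]]]; case: e => -> -> -> ->.
  rewrite !mem_decs /= => _ /eqP <-.
  move=> /allpairsPdep [[z1 z2] [[w1 w2] [+ + e]]]; case: e => -> -> -> ->.
  by rewrite !mem_decs /= => _ /eqP <- [-> -> ->].
move=> [a [b c]]; apply/allpairsPdep/allpairsPdep.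
  move=> [[x y] [[z w] [+ + e]]]; case: e => -> -> ->.
  rewrite !mem_decs /= => /eqP <- /eqP <-.
  by exists (madd x z, w), (x, z); rewrite !mem_decs /= -maddA !eqxx.
move=> [[x y] [[z w] [+ + e]]]; case: e => -> -> ->.
rewrite !mem_decs /= => /eqP <- /eqP <-.
by exists (z, madd w y), (w, y); rewrite !mem_decs /= maddA !eqxx.
Qed.

Lemma pmul1 : left_id pone pmul.
Proof.
move=> F; apply/funext => m; rewrite pmul_coef.
rewrite (bigD1_seq (mon0, m)) ?decs_uniq ?mem_decs //=; last first.
  by rewrite mon0add.
rewrite pone_coef eqxx mul1r big_seq_cond big1 ?addr0 // => [[a b]] /=.
rewrite mem_decs /= pone_coef => /andP[/eqP e ne].
case: eqP => [a0|]; last by rewrite mul0r.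
by case/negP: ne; apply/eqP; rewrite -e a0 mon0add.
Qed.

Lemma pmulDl : left_distributive pmul padd.
Proof.
move=> F G H; apply/funext => m; rewrite padd_coef !pmul_coef -big_split /=.
by apply: eq_bigr => p _; rewrite padd_coef mulrDl.
Qed.

Lemma pone_neq0 : pone != pzero.
Proof.
apply/eqP => /(congr1 (fun F : ps R => F mon0)) /eqP.
by rewrite pone_coef pzero_coef eqxx oner_eq0.
Qed.

HB.instance Definition _ :=
  GRing.Zmodule_isComNzRing.Build (ps R) pmulA pmulC pmul1 pmulDl pone_neq0.

Lemma pmulE F G m : (F * G) m = \sum_(p <- decs m) F p.1 * G p.2.
Proof. exact: pmul_coef. Qed.

Lemma poneE m : (1 : ps R) m = (m == mon0)%:R. Proof. exact: pone_coef. Qed.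

Definition mono : mon -> ps R := locked_with ps_key (fun a m => (m == a)%:R).

Lemma mono_coef a m : mono a m = (m == a)%:R. Proof. by rewrite /mono unlock. Qed.

Lemma mono0 : mono mon0 = 1.
Proof. by apply/funext => m; rewrite poneE mono_coef. Qed.

Lemma mono_mulE a F m : (mono a * F) (madd a m) = F m.
Proof.
rewrite pmulE (bigD1_seq (a, m)) ?decs_uniq ?mem_decs //= mono_coef eqxx mul1r.
rewrite big_seq_cond big1 ?addr0 // => [[b c]] /=.
rewrite mem_decs /= mono_coef => /andP[/eqP e ne].
case: eqP => [ba|]; last by rewrite mul0r.
by case/negP: ne; move: e; rewrite ba => /maddI ->.
Qed.

Lemma mono_mulN a F m : (forall n, m <> madd a n) -> (mono a * F) m = 0.
Proof.
move=> nm; rewrite pmulE big_seq big1 // => [[b c]].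
rewrite mem_decs mono_coef /= => /eqP e; case: eqP => [ba|]; last by rewrite mul0r.
by case: (nm c); rewrite -e ba.
Qed.

Lemma monoM a b : mono a * mono b = mono (madd a b).
Proof.
apply/funext => m; have [[n ->]|h] := pselect (exists n, m = madd a n).
  by rewrite mono_mulE !mono_coef (inj_eq (@maddI _)).
rewrite mono_mulN => [|n e]; last by apply: h; exists n.
by rewrite mono_coef; case: eqP => // e; case: h; exists b.
Qed.

Definition psC : R -> ps R := locked_with ps_key (fun r m => if m == mon0 then r else 0).

Lemma psC_coef r m : psC r m = if m == mon0 then r else 0.
Proof. by rewrite /psC unlock. Qed.

Lemma psC_mulE r F m : (psC r * F) m = r * F m.
Proof.
rewrite pmulE (bigD1_seq (mon0, m)) ?decs_uniq ?mem_decs //=; last first.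
  by rewrite mon0add.
rewrite psC_coef eqxx big_seq_cond big1 ?addr0 // => [[a b]] /=.
rewrite mem_decs /= psC_coef => /andP[/eqP e ne].
case: eqP => [a0|]; last by rewrite mul0r.
by case/negP: ne; rewrite -e a0 mon0add.
Qed.

Lemma psC_is_zmod_morphism : zmod_morphism psC.
Proof.
move=> a b; apply/funext => m; rewrite paddE poppE !psC_coef.
by case: ifP => //; rewrite subr0.
Qed.

Lemma psC_is_monoid_morphism : monoid_morphism psC.
Proof.
split=> [|a b]; apply/funext => m.
  by rewrite poneE psC_coef; case: eqP.
by rewrite psC_mulE !psC_coef; case: eqP => //; rewrite mulr0.
Qed.

HB.instance Definition _ := GRing.isZmodMorphism.Build R (ps R) psC
  psC_is_zmod_morphism.
HB.instance Definition _ := GRing.isMonoidMorphism.Build R (ps R) psC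
  psC_is_monoid_morphism.

Definition ps_eval0 F : R := F mon0.

Lemma ps_eval0_is_zmod_morphism : zmod_morphism ps_eval0.
Proof. by move=> F G; rewrite /ps_eval0 paddE poppE. Qed.

Lemma decs0 : decs mon0 = [:: (mon0, mon0)].
Proof.
apply/perm_small_eq => //; apply: uniq_perm; rewrite ?decs_uniq // => -[a b].
rewrite mem_decs inE; apply/eqP/eqP => /= [/madd_eq0[-> ->] //|[-> ->]].
by rewrite madd0.
Qed.

Lemma ps_eval0_is_monoid_morphism : monoid_morphism ps_eval0.
Proof.
split=> [|F G]; rewrite /ps_eval0 ?poneE ?eqxx //.
by rewrite pmulE decs0 big_seq1.
Qed.

HB.instance Definition _ := GRing.isZmodMorphism.Build (ps R) R ps_eval0
  ps_eval0_is_zmod_morphism.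
HB.instance Definition _ := GRing.isMonoidMorphism.Build (ps R) R ps_eval0
  ps_eval0_is_monoid_morphism.

(* Congruence modulo the series all of whose monomials do not divide [m]. *)
Definition agree (m : mon) F G : Prop := forall p, madd p.1 p.2 = m -> F p.1 = G p.1.

Lemma agreeE m F G : agree m F G -> F m = G m.
Proof. by move=> /(_ (m, mon0)); apply; rewrite /= madd0. Qed.

Lemma agree_refl m F : agree m F F. Proof. by []. Qed.

Lemma agreeD m F F' G G' : agree m F F' -> agree m G G' -> agree m (F + G) (F' + G').
Proof. by move=> hF hG p e; rewrite !paddE hF // hG. Qed.

Lemma agreeM m F F' G G' : agree m F F' -> agree m G G' -> agree m (F * G) (F' * G').
Proof.
move=> hF hG [a b] /= e; rewrite !pmulE.
rewrite big_seq [RHS]big_seq; apply: eq_bigr => [[x y]].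
rewrite mem_decs /= => /eqP xy.
rewrite (hF (x, madd y b)); last by rewrite /= maddA xy.
by rewrite (hG (y, madd x b)) //= maddA (maddC y) xy.
Qed.

Lemma agree_det m n (A B : 'M[ps R]_n) :
  (forall i j, agree m (A i j) (B i j)) -> agree m (\det A) (\det B).
Proof.
move=> AB; rewrite /determinant.
apply: (big_ind2 (agree m)) => // [*|s _]; first exact: agreeD.
apply: agreeM => //; apply: (big_ind2 (agree m)) => // *; exact: agreeM.
Qed.

End PsZmod.

Lemma smulE (F G : ps int) : smul F G = F * G.
Proof.
apply/funext => m; rewrite pmulE /smul /decs fsbig_finite //; exact: finite_decs.
Qed.

(** * Straightening *)

(** The bound on [n] under which $\mathcal G_I$ is expanded. Straightening preserves it ([adm_swap],
    [adm_rcons]), so one [n] serves a whole reduction. *)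
Definition adm (n : nat) (s : seq int) : Prop :=
  (size s <= n)%N /\
  forall i : nat, (i < size s)%N -> i.+1%:Z - nth 0 s i <= n%:Z.

Lemma adm_swap n (s1 s2 : seq int) (a b c d : int) : a <= c -> a + 1 <= d ->
  adm n (s1 ++ a :: b :: s2) -> adm n (s1 ++ c :: d :: s2).
Proof.
move=> ac ad [sn h]; split; first by move: sn; rewrite !size_cat.
move=> i; rewrite size_cat /= => isz.
have hi : i.+1%:Z - nth 0 (s1 ++ a :: b :: s2) i <= n by apply: h; rewrite size_cat.
move: hi; rewrite !nth_cat; case: ifP => // /negbT; rewrite -leqNgt => s1i.
have h1 : (size s1).+1%:Z - nth 0 (s1 ++ a :: b :: s2) (size s1) <= n.
  by apply: h; rewrite size_cat /=; lia.
move: h1; rewrite nth_cat ltnn subnn /= => h1.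
case e : (i - size s1)%N => [|[|k]] //=; lia.
Qed.

Lemma adm_rcons n (s : seq int) (p : int) : adm n (rcons s p) -> adm n s.
Proof.
move=> [sn h]; rewrite size_rcons in sn; split; first by lia.
move=> i isz; have := h i; rewrite size_rcons nth_rcons isz; apply; lia.
Qed.

(** The first relation rewrites an ascent, the second drops a trailing nonpositive entry. Values are
    integers: polynomials and series enter through one coefficient at a time. *)
Definition straightens (n : nat) (Phi : seq int -> int) : Prop :=
  (forall (s1 s2 : seq int) (p q : int), p <= q -> adm n (s1 ++ (p - 1) :: q :: s2) ->
    Phi (s1 ++ (p - 1) :: q :: s2) =
    Phi (s1 ++ p :: q :: s2) - Phi (s1 ++ (q - 1) :: p :: s2)
      + Phi (s1 ++ q :: p :: s2)) /\
  (forall (s : seq int) (p : int), p <= 0 -> adm n (rcons s p) -> Phi (rcons s p) = Phi s).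

(** Termination measure. The deficits [M - x] weigh more towards the left, so [wt] drops when an
    entry grows and when a larger entry moves to the left. *)
Fixpoint wt (M : int) (s : seq int) : int :=
  if s is x :: s' then (size s).+1%:Z * (M - x) + wt M s' else 0.

Lemma wt_cat M (s1 t t' : seq int) : size t = size t' ->
  wt M (s1 ++ t) - wt M (s1 ++ t') = wt M t - wt M t'.
Proof.
move=> e; elim: s1 => //= x s1 <-; rewrite !size_cat e; ring.
Qed.

Lemma wt_ge0 M s : all (fun x => x <= M) s -> 0 <= wt M s.
Proof.
by elim: s => //= x s IH /andP[xM /IH]; nia.
Qed.

Lemma ascent_or_sorted (s : seq int) :
  sorted (fun x y => y <= x) s \/
  exists (s1 s2 : seq int) (p q : int), p <= q /\ s = s1 ++ (p - 1) :: q :: s2.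
Proof.
elim: s => [|x [|y s] IH]; [by left | by left | ].
have [yx|xy] := boolP (y <= x); last first.
  by right; exists [::], s, (x + 1), y; rewrite addrK; split => //; lia.
case: IH => [h|[s1 [s2 [p [q [pq e]]]]]]; first by left; rewrite /= yx.
by right; exists (x :: s1), s2, p, q; rewrite e.
Qed.

Lemma sorted_last_pos (s : seq int) (x : int) :
  sorted (fun x y => y <= x) (rcons s x) -> 0 < x -> all (fun y => 0 < y) (rcons s x).
Proof.
elim: s => [|y s IH] /=; first by move=> _ ->.
move=> h x0; have /IH -/(_ x0) a : sorted (fun x y => y <= x) (rcons s x).
  exact: path_sorted h.
rewrite a andbT; case: s h a {IH} => [|z s] /= /andP[h _]; first by move=> _; lia.
by case/andP => + _; lia.
Qed.

(** One list [L] serves all [n] and all [Phi]; this is what carries an expansion of the polynomials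
    $\mathcal G_I$ over to series. *)
Definition expands (M : nat) (s : seq int) (L : seq (int * intpart)) : Prop :=
  (forall c, c \in L -> (size c.2 <= size s)%N /\ all (fun k => (k <= M)%N) c.2) /\
  forall n Phi, straightens n Phi -> adm n s ->
    Phi s = \sum_(c <- L) c.1 * Phi (seq_of_part c.2).

Lemma straighten_pos (M : nat) s : all (fun x => x <= M%:Z) s ->
  sorted (fun x y => y <= x) s -> all (fun y => 0 < y) s ->
  exists L, expands M s L.
Proof.
move=> sM ss s0.
have pl : is_part [seq `|x|%N | x <- s].
  apply/andP; split.
    elim: s {sM} ss s0 => // x [|y s] IH //= /andP[yx h] /and3P[x0 y0 a0].
    apply/andP; split; first by rewrite /geq /=; lia.
    by apply: IH; rewrite //= y0.
  by apply/negP => /mapP[x xs]; have := allP s0 _ xs; lia.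
have e : seq_of_part (IntPart pl) = s.
  rewrite /seq_of_part /= -map_comp map_id_in // => x xs /=.
  by have := allP s0 _ xs; lia.
exists [:: (1, IntPart pl)]; split=> [c|n Phi _ _]; last first.
  by rewrite big_seq1 mul1r e.
rewrite inE => /eqP -> /=; rewrite size_map; split=> //.
by rewrite all_map; apply/allP => x xs /=; have := allP sM _ xs; have := allP s0 _ xs; lia.
Qed.

(** Outer induction on the length, for the dropped entries, and inner induction on [wt], for the
    ascents. *)
Lemma straighten (M : nat) s : all (fun x => x <= M%:Z) s ->
  exists L, expands M s L.
Proof.
have [l] := ubnP (size s); elim: l s => // l IHl s; rewrite ltnS => sl sM.
have [k] : exists k : nat, wt M s < k%:Z by exists (`|wt M s|.+1)%N; lia.
elim: k s sl sM => [|k IHk] s sl sM wk; first by have := wt_ge0 sM; lia.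
have [ss|[s1 [s2 [p [q [pq es]]]]]] := ascent_or_sorted s; last first.
  have IH (c d : int) : p - 1 <= c -> c <= q -> d <= q -> p <= d ->
      wt M (c :: d :: s2) < wt M (p - 1 :: q :: s2) ->
      exists L, expands M (s1 ++ c :: d :: s2) L.
    move=> pc cq dq pd w; apply: IHk.
    - by move: sl; rewrite es !size_cat.
    - move: sM; rewrite es !all_cat /= => /and4P[-> _ qM ->]; apply/and3P; split=> //; lia.
    - move: wk; rewrite es.
      have := @wt_cat M s1 (c :: d :: s2) (p - 1 :: q :: s2) erefl; lia.
  have size_e (c d : int) : size (s1 ++ c :: d :: s2) = size s.
    by rewrite es !size_cat.
  (* For $p=q$ the term with $(q-1,p)$ is the left side itself: the relation says that twice the
     value at $(p-1,p)$ is twice the value at $(p,p)$, and 2 is cancelled. *)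
  have [pq'|qp] := eqVneq p q.
    rewrite -{}pq' in es IH pq.
    have [|||||L [h1 h2]] := IH p p; try (rewrite /=; lia).
    exists L; split=> [c /h1|n Phi st ad]; first by rewrite size_e.
    rewrite -(h2 n) //; last by rewrite es in ad; apply: adm_swap ad; lia.
    have := st.1 s1 s2 p p pq; rewrite -es => /(_ ad); lia.
  have pq1 : p < q by lia.
  have [|||||L1 [h1 e1]] := IH p q; try (rewrite /=; nia).
  have [|||||L2 [h2 e2]] := IH (q - 1) p; try (rewrite /=; nia).
  have [|||||L3 [h3 e3]] := IH q p; try (rewrite /=; nia).
  exists (L1 ++ [seq (- c.1, c.2) | c <- L2] ++ L3); split=> [c|n Phi st ad].
    rewrite !mem_cat => /or3P[/h1|/mapP[c' /h2 + ->]|/h3]; by rewrite size_e.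
  have ad' := ad; rewrite es in ad'; rewrite [in LHS]es st.1 //.
  rewrite (e1 n) ?(e2 n) ?(e3 n) //; try by apply: adm_swap ad'; lia.
  rewrite !big_cat big_map /= addrA; congr (_ + _ + _).
  by rewrite -sumrN; apply: eq_bigr => c _; rewrite mulNr.
case/lastP: s sl sM ss {wk} => [|s x] sl sM ss; first exact: straighten_pos.
have [x0|x0] := lerP x 0; last by apply: straighten_pos; rewrite ?sorted_last_pos.
have [||L [h1 h2]] := IHl s.
- by move: sl; rewrite size_rcons.
- by move: sM; rewrite all_rcons => /andP[].
exists L; split=> [c /h1 [a b]|n Phi st ad].
  by rewrite size_rcons; split=> //; apply: ltnW.
by rewrite st.2 // (h2 n) //; apply: adm_rcons ad.
Qed.

Lemma adm_exists s : exists n, adm n s.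
Proof.
elim/last_ind: s => [|s x [n [h1 h2]]]; first by exists 0%N; split.
exists (n + size s + `|x| + 1)%N; split; first by rewrite size_rcons; lia.
move=> i; rewrite size_rcons nth_rcons; case: (ltngtP i (size s)) => [/h2|//|->] ?; lia.
Qed.

Lemma nth_seq_of_part (la : intpart) i : nth 0 (seq_of_part la) i = (nth 0%N la i)%:Z.
Proof.
have [h|h] := ltnP i (size la); first by rewrite (nth_map 0%N).
by rewrite !nth_default ?size_map.
Qed.

Lemma adm_part n (la : intpart) : (size la <= n)%N -> adm n (seq_of_part la).
Proof.
move=> h; split; rewrite size_map // => i il; rewrite nth_seq_of_part; lia.
Qed.

(** * Straightening relations for determinants with recursive rows *)

Section RowDet.
Variable K : comNzRingType.
Implicit Types R : nat -> nat -> K.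

Definition rdet (n : nat) R : K := \det (\matrix_(i < n, j < n) R i j).

Lemma eq_rdet n R R' :
  (forall i j, (i < n)%N -> (j < n)%N -> R i j = R' i j) -> rdet n R = rdet n R'.
Proof. by move=> e; congr (\det _); apply/matrixP => i j; rewrite !mxE e. Qed.

Definition upd R (i0 : nat) (v : nat -> K) : nat -> nat -> K :=
  fun i => if i == i0 then v else R i.

Lemma rdet_linear n R i0 u v w (a b : K) : (i0 < n)%N ->
  (forall j, w j = a * u j + b * v j) ->
  rdet n (upd R i0 w) = a * rdet n (upd R i0 u) + b * rdet n (upd R i0 v).
Proof.
move=> i0n e; apply: (@determinant_multilinear _ _ _ _ _ (Ordinal i0n)).
- by apply/rowP => j; rewrite !mxE /upd eqxx e.
- apply/matrixP => i j; rewrite !mxE /upd /=; have := neq_lift (Ordinal i0n) i.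
  by rewrite -val_eqE eq_sym /= => /negPf ->.
- apply/matrixP => i j; rewrite !mxE /upd /=; have := neq_lift (Ordinal i0n) i.
  by rewrite -val_eqE eq_sym /= => /negPf ->.
Qed.

Lemma rdet_eqrows n R i k : (i < n)%N -> (k < n)%N -> i != k ->
  (forall j, R i j = R k j) -> rdet n R = 0.
Proof.
move=> hi hk ik e.
apply: (@determinant_alternate _ _ _ (Ordinal hi) (Ordinal hk)) => // j.
by rewrite !mxE e.
Qed.

(** Polarization: the determinant vanishes when both rows are $u+v$. *)
Lemma rdet_swap n R i k u v : (i < n)%N -> (k < n)%N -> i != k ->
  rdet n (upd (upd R i u) k v) = - rdet n (upd (upd R i v) k u).
Proof.
move=> hi hk ik.
pose T x y := rdet n (upd (upd R i x) k y).
have updC x y : upd (upd R i x) k y = upd (upd R k y) i x.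
  apply/funext => l; rewrite /upd; case: eqP => [->|//].
  by rewrite eq_sym (negPf ik).
have Tr w y : T (w : nat -> K) (fun j => 1 * u j + 1 * y j) = T w u + T w y.
  by rewrite /T (@rdet_linear _ _ _ u y _ 1 1) // !mul1r.
have Tl x w : T (fun j => 1 * u j + 1 * x j) w = T u w + T x w.
  by rewrite /T !(updC _ w) (@rdet_linear _ _ _ u x _ 1 1) // !mul1r.
have T0 x : T x x = 0.
  apply: (@rdet_eqrows _ _ i k) => // j; rewrite /upd eqxx (negPf ik).
  by rewrite eqxx.
have := T0 (fun j => 1 * u j + 1 * v j).
by rewrite Tl !Tr !T0 add0r addr0 => /eqP; rewrite addr_eq0 => /eqP.
Qed.

(* [r i a] is the row carried by the entry [a] in position [i].  The recursion *)
(* [r i (p - 1) - r i p = eps * r (i + 1) p] is all that straightening needs.  *)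
Variables (r : nat -> int -> nat -> K) (eps : K).
Hypothesis rP : forall i p j, r i (p - 1) j = r i p j + eps * r i.+1 p j.

Definition sdet n (s : seq int) : K := rdet n (fun i => r i (nth 0 s i)).

(** Splitting the rows of [p - 1] and [q - 1] by [rP] leaves two correction terms, which carry
    [r i.+1 p] and [r i.+1 q] in opposite orders and cancel. *)
Lemma sdet_swap n (s1 s2 : seq int) (p q : int) : ((size s1).+1 < n)%N ->
  sdet n (s1 ++ (p - 1) :: q :: s2) =
  sdet n (s1 ++ p :: q :: s2) - sdet n (s1 ++ (q - 1) :: p :: s2)
    + sdet n (s1 ++ q :: p :: s2).
Proof.
move=> sn; set i := size s1.
pose R k := r k (nth 0 (s1 ++ 0 :: 0 :: s2) k).
pose T u v := rdet n (upd (upd R i u) i.+1 v).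
have sT x y : sdet n (s1 ++ x :: y :: s2) = T (r i x) (r i.+1 y).
  apply: eq_rdet => k j _ _; rewrite /upd /R !nth_cat -/i.
  case: (ltngtP k i) => [ki|ki|->].
  - by rewrite !ifF //; apply/eqP; lia.
  - case: eqP => [->|ne]; first by rewrite subSnn.
    by case e : (k - i)%N => [|[|l]] //; lia.
  - by rewrite ltn_eqF // subnn.
have Tl x w : T (r i (x - 1)) w = T (r i x) w + eps * T (r i.+1 x) w.
  have updC u : upd (upd R i u) i.+1 w = upd (upd R i.+1 w) i u.
    apply/funext => l; rewrite /upd; case: eqP => [->|//].
    by rewrite gtn_eqF.
  rewrite /T !updC (@rdet_linear _ _ _ (r i x) (r i.+1 x) _ 1 eps) ?mul1r //.
    by apply: ltnW.
  by move=> j; rewrite rP mul1r.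
have := @rdet_swap n R i i.+1 (r i.+1 p) (r i.+1 q); rewrite -!/(T _ _) => sw.
rewrite !sT !Tl sw ?neq_ltn ?ltnSn ?(ltnW sn) //.
by ring.
Qed.

(** Raising the entry of row [i] to 0 produces corrections in which row [i] is some [r k (- m)] with
    $k>i$. By the recursion these reduce to determinants in which row [i] repeats a lower row
    [r k 0], so they vanish; the bound on [n] keeps the repeated row inside the matrix. *)
Lemma sdet_drop n (s : seq int) (p : int) : p <= 0 -> (size s < n)%N ->
  (size s).+1%:Z - p <= n%:Z ->
  sdet n (rcons s p) = sdet n s.
Proof.
set i := size s => p0 sn.
pose R k := r k (nth 0 s k).
pose T u := rdet n (upd R i u).
have sT x : sdet n (rcons s x) = T (r i x).
  apply: eq_rdet => k j _ _; rewrite /upd /R nth_rcons -/i.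
  case: (ltngtP k i) => [ki|ki|-> //] //.
  by rewrite nth_default // ltnW.
have Tl l x : T (r l (x - 1)) = T (r l x) + eps * T (r l.+1 x).
  rewrite /T (@rdet_linear _ _ _ (r l x) (r l.+1 x) _ 1 eps) ?mul1r //.
  by move=> j; rewrite rP mul1r.
have T0 (m : nat) k : (i < k)%N -> (k + m < n)%N -> T (r k (- m%:Z)) = 0.
  elim: m k => [|m IH] k ik kn.
    apply: (@rdet_eqrows _ _ i k) => //; rewrite ?neq_ltn ?ik //; first by lia.
    by move=> j; rewrite /upd eqxx (gtn_eqF ik) /R nth_default // ltnW.
  have -> : - (m.+1%:Z) = - m%:Z - 1 by lia.
  by rewrite Tl !IH ?mulr0 ?addr0 //; lia.
have -> : sdet n s = T (r i 0).
  by apply: eq_rdet => k j _ _; rewrite /upd /R; case: eqP => // ->; rewrite nth_default.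
rewrite sT; have -> : p = - `|p|%N%:Z by lia.
elim: `|p|%N => [|m IH] h; first by rewrite oppr0.
have e : - (m.+1%:Z) = - m%:Z - 1 by lia.
by rewrite e Tl IH ?T0 ?mulr0 ?addr0 //; lia.
Qed.

End RowDet.

(** * Bialternants and the constants delta *)

Section Delta.
Variable K : comNzRingType.

(** On the generating function $\sum_k C(k)t^k$ this is multiplication by $1-xt$; [ecoef] below
    gives the coefficients of a product of such factors. *)
Definition bdiff (x : K) (C : int -> K) : int -> K := fun k => C k - x * C (k - 1).

Fixpoint ecoef (xs : seq K) (s : nat) : K :=
  if xs is x :: xs' then
    ecoef xs' s - (if s is s'.+1 then x * ecoef xs' s' else 0)
  else (s == 0%N)%:R.

Lemma foldr_bdiff (xs : seq K) (C : int -> K) k B : (size xs < B)%N ->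
  foldr bdiff C xs k = \sum_(s < B) ecoef xs s * C (k - s%:Z).
Proof.
elim: xs k B => [|x xs IH] k B.
  case: B => // B _; rewrite big_ord_recl /= mul1r subr0 big1 ?addr0 //.
  by move=> i _; rewrite mul0r.
case: B => // B; rewrite ltnS => sB; rewrite /= {1}/bdiff.
rewrite (IH k B.+1) ?(IH (k - 1) B) // ?mulr_sumr; last exact: ltnW.
under [RHS]eq_bigr do rewrite mulrBl.
rewrite sumrB; congr (_ - _); rewrite [RHS]big_ord_recl /= mul0r add0r.
apply: eq_bigr => i _; rewrite /= -mulrA.
by congr (_ * (_ * C _)); rewrite /bump /=; lia.
Qed.

Definition others N (X : 'I_N -> K) (i : 'I_N) : seq K :=
  [seq X l | l <- enum 'I_N & l != i].

Lemma size_others N (X : 'I_N -> K) i : size (others X i) = N.-1.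
Proof.
rewrite size_map size_filter (eq_count (_ : _ =1 predC (pred1 i))) //.
have := count_predC (pred1 i) (enum 'I_N).
rewrite (count_uniq_mem _ (enum_uniq _)) mem_enum size_enum_ord /=; lia.
Qed.

(* Right multiplication by this matrix removes from the generating function   *)
(* of row entries all the variables but the i-th one, in column i. *)
Definition Emx N (X : 'I_N -> K) : 'M[K]_N :=
  \matrix_(r, i) ecoef (others X i) (N.-1 - r).

(** Used twice: it turns $\mathcal G_I$ into a bialternant and the series determinants into
    numerators of Grothendieck polynomials. *)
Lemma det_Emx N (X : 'I_N -> K) (C : nat -> int -> K) :
  \det (\matrix_(j < N, r < N) C j r%:Z) * \det (Emx X) =
  \det (\matrix_(j < N, i < N) foldr bdiff (C j) (others X i) N.-1%:Z).
Proof.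
rewrite -det_mulmx; congr (\det _); apply/matrixP => j i; rewrite !mxE.
have N0 : (0 < N)%N by apply: leq_trans (ltn_ord j).
rewrite (@foldr_bdiff _ _ _ N); last by rewrite size_others prednK.
rewrite (reindex_inj rev_ord_inj) /=; apply: eq_bigr => r _.
rewrite !mxE mulrC; congr (ecoef _ _ * C _ _); have := ltn_ord r => /=; lia.
Qed.

End Delta.

(** * The bialternant formula for $\mathcal G_I$ *)

Section TruncatedH.
Variable K : comNzRingType.

Definition geom (D : nat) (x : K) : {poly K} := \sum_(a < D.+1) (x ^+ a)%:P * 'X^a.

Lemma geomE D x : (1 - x%:P * 'X) * geom D x = 1 - (x%:P * 'X) ^+ D.+1.
Proof.
rewrite -[in RHS](expr1n _ D.+1) subrXX; congr (_ * _).
by apply: eq_bigr => i _; rewrite expr1n mul1r exprMn -polyC_exp.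
Qed.

Lemma coef_geomM D x (A : {poly K}) d : (d <= D)%N ->
  ((1 - x%:P * 'X) * geom D x * A)`_d = A`_d.
Proof.
move=> dD; rewrite geomE mulrBl mul1r coefB exprMn -mulrA -polyC_exp coefCM.
by rewrite coefXnM ltnS dD mulr0 subr0.
Qed.

Lemma coef_geom D x d : (d <= D)%N -> (geom D x)`_d = x ^+ d.
Proof.
move=> dD; rewrite coef_sum (bigD1 (Ordinal (dD : (d < D.+1)%N))) //=.
rewrite coefCM coefXn eqxx mulr1 big1 ?addr0 // => i ne.
rewrite coefCM coefXn; case: eqP => [e|]; last by rewrite mulr0.
by case/eqP: ne; apply: val_inj.
Qed.

(** The truncation order [D] is separate from [k], so that the coefficients of all degrees up to [D]
    come from a single polynomial, whereas [hsuper] truncates at [k] itself. *)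
Definition hcoef (D i : nat) (xs : seq K) (k : int) : K :=
  if k is Posz d then ((1 - 'X) ^+ i * \prod_(x <- xs) geom D x)`_d else 0.

Lemma hcoef_perm D i xs ys : perm_eq xs ys -> hcoef D i xs = hcoef D i ys.
Proof. by move=> e; apply/funext => -[d|d] //=; rewrite (perm_big _ e). Qed.

Lemma bdiff_hcoef D i x xs (k : int) : k <= D%:Z ->
  bdiff x (hcoef D i (x :: xs)) k = hcoef D i xs k.
Proof.
case: k => [d|d] kD; last by rewrite /bdiff /= mulr0 subr0.
have e : (1 - x%:P * 'X) * geom D x * ((1 - 'X) ^+ i * \prod_(j <- xs) geom D j) =
  (1 - 'X) ^+ i * \prod_(j <- x :: xs) geom D j
   - x%:P * ('X * ((1 - 'X) ^+ i * \prod_(j <- x :: xs) geom D j)).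
  by rewrite big_cons; ring.
rewrite [RHS]/= -(@coef_geomM D x _ d) // e coefB coefCM coefXM /bdiff.
congr (_ - _ * _); case: d {kD} => [|d] //=.
by rewrite subn1.
Qed.

Lemma foldr_bdiff_hcoef D i xs ys (k : int) : k <= D%:Z ->
  foldr (@bdiff K) (hcoef D i (xs ++ ys)) xs k = hcoef D i ys k.
Proof.
elim: xs ys k => // x xs IH ys k kD.
have -> : hcoef D i ((x :: xs) ++ ys) = hcoef D i (xs ++ x :: ys).
  by apply: hcoef_perm; rewrite -[x :: ys]cat1s perm_sym perm_catCA /=.
rewrite /= {1}/bdiff !IH; try lia.
by rewrite -/(bdiff _ _ _) bdiff_hcoef.
Qed.

Lemma hcoefS D i xs (k : int) :
  hcoef D i.+1 xs k = hcoef D i xs k - hcoef D i xs (k - 1).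
Proof.
case: k => [d|d] /=; last by rewrite subr0.
rewrite exprS -mulrA mulrBl mul1r coefB coefXM; congr (_ - _).
by case: d => [|d] //=; rewrite subn1.
Qed.

(** Each factor $1-t$ replaces $y^d$ by $y^d-y^{d-1}=y^{d-1}(y-1)$; the condition $i\le d$ keeps the
    exponents nonnegative. *)
Lemma hcoef1 D i y d : (i <= d)%N -> (d <= D)%N ->
  hcoef D i [:: y] d%:Z = y ^+ (d - i) * (y - 1) ^+ i.
Proof.
elim: i d => [|i IH] d id dD.
  by rewrite /= expr0 mul1r big_seq1 coef_geom // mulr1 subn0.
rewrite hcoefS IH ?(ltnW id) //; have -> : d%:Z - 1 = d.-1%:Z by lia.
rewrite IH; [|lia|lia].
have -> : (d - i = (d - i.+1).+1)%N by lia.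
have -> : (d.-1 - i = d - i.+1)%N by lia.
by rewrite !exprS; ring.
Qed.

Lemma hcoef_trunc D D' i xs (k : int) : k <= D%:Z -> k <= D'%:Z ->
  hcoef D i xs k = hcoef D' i xs k.
Proof.
case: k => [d|//] kD kD'; rewrite /hcoef.
have eqM (p p' q q' : {poly K}) : (forall e, (e <= d)%N -> p`_e = p'`_e) ->
    (forall e, (e <= d)%N -> q`_e = q'`_e) ->
    forall e, (e <= d)%N -> (p * q)`_e = (p' * q')`_e.
  move=> hp hq e ed; rewrite !coefM; apply: eq_bigr => j _.
  by rewrite hp ?hq //; have := ltn_ord j; lia.
suff /(_ d (leqnn d)) : forall e, (e <= d)%N ->
    (\prod_(x <- xs) geom D x)`_e = (\prod_(x <- xs) geom D' x)`_e.
  by move=> _; apply: (eqM) => //; elim: xs => [|x xs IH] e ed; rewrite ?big_nil //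
    ?big_cons; apply: eqM ed => // f fd; rewrite !coef_geom //; lia.
elim: xs => [|x xs IH] e ed; rewrite ?big_nil // ?big_cons.
by apply: eqM ed => // f fd; rewrite !coef_geom //; lia.
Qed.

End TruncatedH.

Section GdetTheory.
Variable n : nat.
Let Kn := {mpoly int[n]}.
Let xs : seq Kn := [seq 'X_i | i <- enum 'I_n].

Lemma hsuperE D i (k : int) : k <= D%:Z -> hsuper n i k = hcoef D i xs k.
Proof.
case: k => [d|d] kD //; rewrite (@hcoef_trunc _ D d) // /hsuper /hcoef.
by rewrite /xs big_map big_enum.
Qed.

Lemma hsuperS i (k : int) : hsuper n i.+1 k = hsuper n i k - hsuper n i (k - 1).
Proof. by rewrite !(@hsuperE `|k|%N) ?hcoefS //; lia. Qed.

Definition grow (i : nat) (a : int) (j : nat) : Kn := hsuper n i (a + j%:Z).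

Lemma growP i (p : int) j : grow i (p - 1) j = grow i p j + (- 1) * grow i.+1 p j.
Proof.
rewrite /grow hsuperS mulN1r opprB addrCA subrr addr0; congr hsuper; lia.
Qed.

Lemma GdetE s : Gdet n s = sdet grow n s.
Proof. by []. Qed.

Lemma straightens_Gdet m : straightens n (fun s => (Gdet n s)@_m).
Proof.
split=> [s1 s2 p q _ [sn _]|s p p0 [sn h]].
  rewrite !GdetE (sdet_swap growP) ?mcoeffD ?mcoeffN //.
  by move: sn; rewrite size_cat /=; lia.
rewrite size_rcons in sn h.
rewrite !GdetE (sdet_drop growP) //.
by have := h (size s) (ltnSn _); rewrite nth_rcons ltnn eqxx.
Qed.

Definition altdet (a : nat -> nat) : Kn :=
  \det (\matrix_(j < n, i < n) ('X_i ^+ a j * ('X_i - 1) ^+ j)).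

(** In column [i] only $x_i$ survives, and the entries are given by [hcoef1]. Admissibility says
    that the exponents $I_j+n-1-j$ (with $j$ from 0) are nonnegative, so [absz] does not change
    them. *)
Lemma Gdet_alt s : adm n s ->
  Gdet n s * \det (Emx (fun i : 'I_n => 'X_i : Kn)) =
  altdet (fun j => absz (nth 0 s j + (n.-1%:Z - j%:Z))).
Proof.
move=> [sn h].
pose C (j : nat) (k : int) : Kn := hsuper n j (nth 0 s j + k).
rewrite (@det_Emx _ n _ C); congr (\det _); apply/matrixP => j i; rewrite !mxE.
have hj : j%:Z + 1 - nth 0 s j <= n%:Z.
  have [js|js] := ltnP j (size s); first by have := h j js; lia.
  by rewrite nth_default //; have := ltn_ord j; lia.
set D := absz (nth 0 s j + n.-1%:Z).
have bd C1 C2 (b : int) ys k : (forall k, k <= b -> C1 k = C2 k) -> k <= b ->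
    foldr (@bdiff Kn) C1 ys k = foldr (@bdiff Kn) C2 ys k.
  move=> e; elim: ys k => [|y ys IH] k kb /=; first exact: e.
  by rewrite /bdiff !IH //; lia.
have sh (c : int) C1 ys k : foldr (@bdiff Kn) (fun k => C1 (c + k)) ys k =
    foldr (@bdiff Kn) C1 ys (c + k).
  by elim: ys k => //= y ys IH k; rewrite /bdiff !IH addrA.
have jn := ltn_ord j.
rewrite /C sh (bd _ (hcoef D j (others (fun i => 'X_i : Kn) i ++ [:: 'X_i])) D%:Z);
  [|move=> k kD|lia]; last first.
  rewrite (@hsuperE D) //; rewrite (@hcoef_perm _ D j xs (others (fun i => 'X_i : Kn) i ++ [:: 'X_i])) //.
  rewrite perm_sym cats1 perm_rcons /others -(map_cons (fun i => 'X_i)).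
  apply: perm_map; apply: uniq_perm; rewrite ?enum_uniq //=.
    by rewrite mem_filter eqxx /= filter_uniq // enum_uniq.
  by move=> l; rewrite inE mem_filter !mem_enum andbT; case: eqP.
rewrite foldr_bdiff_hcoef; last by lia.
have -> : nth 0 s j + n.-1%:Z = D%:Z by lia.
rewrite hcoef1 //; last by lia.
by congr ('X_i ^+ _ * _); lia.
Qed.

End GdetTheory.

(** * Lowest terms of alternants and independence of the $\mathcal G_\lambda$ *)

Lemma mcoeff_prod_univariate n (p : 'I_n -> {poly int}) (b : 'X_{1..n}) :
  (\prod_(i < n) (map_poly (@mpolyC n int) (p i)).['X_i])@_b = \prod_(i < n) (p i)`_(b i).
Proof.
pose B := (\max_(i < n) maxn (size (p i)) (b i).+1)%N.
have Bp i : (size (p i) <= B)%N.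
  by rewrite (leq_trans (leq_maxl _ (b i).+1)) // (leq_bigmax i).
have Bb i : (b i < B)%N.
  by rewrite (leq_trans (leq_maxr (size (p i)) _)) // (leq_bigmax i).
transitivity ((\prod_(i < n) \sum_(k < B) ((p i)`_k *: 'X_i ^+ k : {mpoly int[n]}))@_b).
  congr (mcoeff _ _); apply: eq_bigr => i _.
  rewrite (@horner_coef_wide _ B) ?size_map_polyC ?(leq_trans (size_poly _ _)) //.
  by apply: eq_bigr => k _; rewrite coef_map /= mul_mpolyC.
rewrite bigA_distr_bigA /= raddf_sum /=.
pose f0 : {ffun 'I_n -> 'I_B} := [ffun i => Ordinal (Bb i)].
have E (f : {ffun 'I_n -> 'I_B}) :
   (\prod_(i < n) ((p i)`_(f i) *: 'X_i ^+ f i : {mpoly int[n]}))@_b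
    = (\prod_(i < n) (p i)`_(f i)) * (f == f0)%:R.
  rewrite scaler_prod mcoeffZ; congr (_ * _).
  have -> : \prod_(i < n) 'X_i ^+ f i = 'X_[[multinom (f i : nat) | i < n]] :> {mpoly int[n]}.
    rewrite [RHS]mpolyXE_id; apply: eq_bigr => i _; by rewrite mnmE.
  rewrite mcoeffX; congr (nat_of_bool _)%:R; apply/eqP/eqP => [e|->].
    by apply/ffunP => i; apply: val_inj; rewrite ffunE /= -e mnmE.
  by apply/mnmP => i; rewrite mnmE ffunE.
rewrite (bigD1 f0) //= E eqxx mulr1 [X in _ + X]big1 ?addr0 => [|f /negPf ne].
  by apply: eq_bigr => i _; rewrite ffunE.
by rewrite E ne mulr0.
Qed.

Definition strict_dec (n : nat) (a : nat -> nat) : Prop :=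
  forall i k : nat, (i < k)%N -> (k < n)%N -> (a k < a i)%N.

Lemma increasing_perm1 n (s : 'S_n) :
  (forall i k : 'I_n, (i < k)%N -> (s i < s k)%N) -> s = 1%g.
Proof.
move=> inc.
have ge (m : nat) : forall i : 'I_n, i = m :> nat -> (m <= s i)%N.
  elim: m => // m IH i im.
  have mn : (m < n)%N by have := ltn_ord i; lia.
  by have := inc (Ordinal mn) i; have := IH (Ordinal mn) erefl; rewrite /= im; lia.
have le (i : 'I_n) : (i <= s i)%N by apply: ge.
apply/permP => i; rewrite perm1; apply: val_inj.
have e : (\sum_(i < n) s i = \sum_(i < n) i)%N.
  by rewrite [RHS](reindex_inj (@perm_inj _ s)).
have := leqif_sum (fun (i : 'I_n) (_ : true) => leqif_eq (le i)).
by case=> _; rewrite e eqxx => /esym/forallP/(_ i) /= /eqP.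
Qed.

Section AltCoef.
Variables (n : nat) (a b : nat -> nat).
Hypotheses (da : strict_dec n a) (db : strict_dec n b).
Hypothesis ab : (\sum_(i < n) b i <= \sum_(i < n) a i)%N.

(** The lowest term in row [j] is $(-1)^jx_i^{a_j}$, so a permutation [s] contributes to $x^b$ only
    if $a_j\le b_{s(j)}$ for all [j]. The degree hypothesis forces equality, and then monotonicity
    forces [s] to be the identity. *)
Lemma altdet_coef :
  (altdet n a)@_[multinom b i | i < n] =
  if [forall i : 'I_n, a i == b i] then \prod_(i < n) (-1) ^+ i else 0.
Proof.
pose q (j : nat) : {poly int} := 'X^(a j) * ('X - 1) ^+ j.
have qE (j : nat) (i : 'I_n) : 'X_i ^+ a j * ('X_i - 1) ^+ j =
    (map_poly (@mpolyC n int) (q j)).['X_i] :> {mpoly int[n]}.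
  rewrite /q rmorphM !rmorphXn rmorphB /= map_polyX rmorph1.
  by rewrite hornerM !horner_exp hornerD hornerN !hornerX hornerC.
have term (s : 'S_n) :
    (\prod_(j < n) ('X_(s j) ^+ a j * ('X_(s j) - 1) ^+ j : {mpoly int[n]}))
      @_[multinom b i | i < n] = \prod_(j < n) (q j)`_(b (s j)).
  rewrite (reindex_inj (@perm_inj _ s^-1%g)) /=.
  under eq_bigr do rewrite permKV qE.
  rewrite (mcoeff_prod_univariate (fun i => q (s^-1%g i))).
  rewrite [RHS](reindex_inj (@perm_inj _ s^-1%g)) /=.
  by apply: eq_bigr => i _; rewrite mnmE permKV.
have z (s : 'S_n) : \prod_(j < n) (q j)`_(b (s j)) != 0 ->
    s = 1%g /\ forall i : 'I_n, a i = b i.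
  move=> nz.
  have le (j : 'I_n) : (a j <= b (s j))%N.
    rewrite leqNgt; apply: contra nz => lt.
    by rewrite (bigD1 j) //= /q coefXnM lt mul0r.
  have e : (\sum_(j < n) b (s j) = \sum_(j < n) b j)%N.
    by rewrite [RHS](reindex_inj (@perm_inj _ s)).
  have ea (j : 'I_n) : a j = b (s j).
    have := leqif_sum (fun (i : 'I_n) (_ : true) => leqif_eq (le i)).
    case=> h1; rewrite e in h1 *.
    have -> : (\sum_(i < n) a i)%N == (\sum_(i < n) b i)%N by rewrite eqn_leq h1.
    by move=> /esym/forallP/(_ j) /= /eqP.
  have s1 : s = 1%g.
    apply: increasing_perm1 => i k ik.
    have := da ik (ltn_ord k); rewrite !ea => h.
    case: (ltngtP (s i) (s k)) => // h'; first by have := db h' (ltn_ord _); lia.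
    by move: h; rewrite h' ltnn.
  by split=> // i; rewrite ea s1 perm1.
rewrite /altdet /determinant raddf_sum /=.
under eq_bigr => s _.
  under eq_bigr do rewrite mxE.
  have -> : (-1) ^+ s * \prod_(j < n) ('X_(s j) ^+ a j * ('X_(s j) - 1) ^+ j) =
     ((-1) ^+ s : int) *: \prod_(j < n) ('X_(s j) ^+ a j * ('X_(s j) - 1) ^+ j)
     :> {mpoly int[n]}.
    by rewrite -mul_mpolyC rmorphXn rmorphN1.
  rewrite mcoeffZ term; over.
rewrite (bigD1 1%g) //= odd_perm1 expr0 mul1r [X in _ + X]big1 ?addr0 => [|s ns]; last first.
  have [->|/z[e _]] := eqVneq (\prod_(j < n) (q j)`_(b (s j))) 0.
    by rewrite mulr0.
  by rewrite e eqxx in ns.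
have q0 (j : nat) : (q j)`_(a j) = (-1) ^+ j.
  rewrite /q coefXnM ltnn subnn -horner_coef0 horner_exp hornerD hornerN.
  by rewrite hornerX hornerC sub0r.
case: ifPn => [/forallP h|/forallP h].
  by apply: eq_bigr => i _; rewrite perm1 -(eqP (h i)) q0.
have [//|/z[_ e]] := eqVneq (\prod_(j < n) (q j)`_(b ((1%g : 'S_n) j))) 0.
by case: h => i; rewrite e.
Qed.

End AltCoef.

Definition part_weight (la : intpart) : nat := sumn la.

Lemma parts_dec (la : intpart) i k : (i <= k)%N -> (nth 0%N la k <= nth 0%N la i)%N.
Proof.
case: la => s /= /andP[ss _] ik.
have [ks|ks] := ltnP k (size s); last by rewrite nth_default.
have tr : transitive geq by move=> x y z; rewrite /geq /=; lia.
by apply: (sorted_leq_nth tr leqnn 0%N ss) => //; rewrite inE // (leq_ltn_trans ik).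
Qed.

Lemma parts_pos (la : intpart) i : (i < size la)%N -> (0 < nth 0%N la i)%N.
Proof.
case: la => s /= /andP[_ s0] h; rewrite lt0n; apply: contraNneq s0 => <-.
exact: mem_nth.
Qed.

Lemma intpart_eq (n : nat) (la mu : intpart) : (size la <= n)%N -> (size mu <= n)%N ->
  (forall i, (i < n)%N -> nth 0%N la i = nth 0%N mu i) -> la = mu.
Proof.
have half (l m : intpart) : (size l <= n)%N -> (size m <= n)%N ->
    (forall i, (i < n)%N -> nth 0%N l i = nth 0%N m i) -> (size l <= size m)%N.
  move=> ln mn e; rewrite leqNgt; apply/negP => h.
  have := parts_pos h; rewrite e; first by rewrite nth_default.
  exact: leq_trans ln.
move=> ln mn e; apply: val_inj => /=; apply: (@eq_from_nth _ 0%N) => [|i il].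
  by apply/eqP; rewrite eqn_leq !half // => i /e.
by apply: e; apply: leq_trans ln.
Qed.

(** The entries of $\lambda+\rho$ with $\rho=(n-1,\dots,1,0)$. *)
Definition shifted (n : nat) (la : intpart) (j : nat) : nat :=
  (nth 0 la j + (n.-1 - j))%N.

Lemma shifted_dec n la : strict_dec n (shifted n la).
Proof. by move=> i k ik kn; rewrite /shifted; have := parts_dec la (ltnW ik); lia. Qed.

Lemma sum_shifted n (la : intpart) : (size la <= n)%N ->
  (\sum_(i < n) shifted n la i = part_weight la + \sum_(i < n) (n.-1 - i))%N.
Proof.
move=> ln; rewrite big_split /=; congr addn.
rewrite /part_weight sumnE (big_nth 0%N) big_mkord.
rewrite (big_ord_widen _ (fun i => nth 0%N la i) ln).
rewrite [RHS]big_mkcond; apply: eq_bigr => i _.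
by case: ltnP => // h; rewrite nth_default.
Qed.

Lemma altdet_shifted_coef n (la mu : intpart) :
  (size la <= n)%N -> (size mu <= n)%N -> (part_weight mu <= part_weight la)%N ->
  (altdet n (shifted n la))@_[multinom shifted n mu i | i < n] =
  if la == mu then \prod_(i < n) (-1) ^+ i else 0.
Proof.
move=> ln mn ml; rewrite altdet_coef ?sum_shifted ?leq_add2r //;
  try exact: shifted_dec.
congr (if _ then _ else _); apply/forallP/eqP => [h|-> i //].
apply: (@intpart_eq n) => // i ii; have := h (Ordinal ii).
by rewrite /shifted eqn_add2r => /eqP.
Qed.

Lemma prod_sign_neq0 n : \prod_(i < n) (-1) ^+ i != 0 :> int.
Proof. by apply/prodf_neq0 => i _; rewrite signr_eq0. Qed.

Lemma Gdet_part_alt n (la : intpart) : (size la <= n)%N ->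
  Gdet n (seq_of_part la) * \det (Emx (fun i : 'I_n => 'X_i : {mpoly int[n]})) =
  altdet n (shifted n la).
Proof.
move=> ln; rewrite Gdet_alt; last exact: adm_part.
congr (\det _); apply/matrixP => j i; rewrite !mxE; congr (_ ^+ _ * _).
by rewrite nth_seq_of_part /shifted; have := ltn_ord j; lia.
Qed.

(** After multiplication by [\det (Emx _)], the coefficient of $x^{\lambda+\rho}$ involves, besides
    $\lambda$, only partitions of smaller weight; hence the induction on the weight. *)
Lemma Gdet_free n (A : seq intpart) (g : intpart -> int) : uniq A ->
  (forall la, la \in A -> g la != 0 -> (size la <= n)%N) ->
  \sum_(la <- A) g la *: Gdet n (seq_of_part la) = 0 ->
  forall la, la \in A -> g la = 0.
Proof.
move=> uA sA S0.
suff H k : forall la, la \in A -> (part_weight la <= k)%N -> g la = 0.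
  by move=> la lA; apply: H lA (leqnn _).
elim: k {-2}k (leqnn k) => [|K IH] k kK la lA lk.
  all: have [//|g0] := eqVneq (g la) 0.
  all: have ln := sA _ lA g0.
  all: have := congr1 (fun f => (f * \det (Emx (fun i : 'I_n => 'X_i : {mpoly int[n]})))
                     @_[multinom shifted n la i | i < n]) S0.
  all: rewrite mul0r mcoeff0 mulr_suml raddf_sum /= (bigD1_seq la) //=.
  all: rewrite -scalerAl mcoeffZ Gdet_part_alt // altdet_shifted_coef // eqxx.
  all: rewrite [X in _ + X]big_seq_cond [X in _ + X]big1 ?addr0 => [/eqP|mu /andP[mA ne]];
    first by rewrite mulf_eq0 (negPf (prod_sign_neq0 n)) orbF => /eqP.
  all: rewrite -scalerAl mcoeffZ.
  all: have [->|g1] := eqVneq (g mu) 0; first by rewrite mul0r.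
  all: have mn := sA _ mA g1.
  - rewrite Gdet_part_alt // altdet_shifted_coef ?(negPf ne) ?mulr0 //; lia.
  have [ml|lm] := ltnP (part_weight mu) (part_weight la).
    by rewrite (IH (part_weight mu) _ mu) ?mul0r //; lia.
  by rewrite Gdet_part_alt // altdet_shifted_coef ?(negPf ne) ?mulr0.
Qed.

(** * The constants delta as results of straightening *)

Definition list_coef (L : seq (int * intpart)) (la : intpart) : int :=
  \sum_(c <- L | c.2 == la) c.1.

Lemma list_coef_supp L la : list_coef L la <> 0 -> exists2 c, c \in L & c.2 = la.
Proof.
move=> h; have [/hasP[c cL /eqP e]|/hasPn no] := boolP (has (fun c => c.2 == la) L).
  by exists c.
by case: h; rewrite /list_coef big_seq_cond big1 // => c /andP[/no /negPf ->].
Qed.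

Lemma finite_list_coef L : finite_set [set la | list_coef L la <> 0].
Proof.
apply: (@sub_finite_set _ _ [set` [seq c.2 | c <- L]]); last exact: finite_seq.
by move=> la /= /list_coef_supp[c cL <-]; apply: map_f.
Qed.

Lemma fsum_list_coef (V : lmodType int) L (f : intpart -> V) :
  \sum_(la \in [set: intpart]) list_coef L la *: f la = \sum_(c <- L) c.1 *: f c.2.
Proof.
pose A := [fset c.2 | c in L]%fset.
rewrite (@fsbigTE _ _ _ _ A) => [|la lA]; last first.
  have [->|/eqP/list_coef_supp[c cL e]] := eqVneq (list_coef L la) 0.
    by rewrite scale0r.
  by case/negP: lA; apply/imfsetP; exists c.
rewrite /list_coef; under eq_bigr do rewrite scaler_suml.
rewrite (exchange_big_dep predT) //= big_seq [RHS]big_seq; apply: eq_bigr => c cL.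
rewrite (big_rem c.2) /=; last by apply/imfsetP; exists c.
rewrite eqxx big_seq_cond big1 ?addr0 // => la /andP[+ /eqP e].
by rewrite -e mem_rem_uniq ?fset_uniq // inE eqxx.
Qed.

Lemma expansion_unique s d1 d2 : is_expansion s d1 -> is_expansion s d2 -> d1 = d2.
Proof.
move=> [f1 h1] [f2 h2]; have [n [sn ad]] := adm_exists s.
have [k1 e1] := h1 n sn ad; have [k2 e2] := h2 n sn ad.
pose A := (fset_set [set la | d1 la <> 0] `|` fset_set [set la | d2 la <> 0])%fset.
have A1 la : la \notin A -> d1 la = 0.
  rewrite inE negb_or !in_fset_set // => /andP[/negP h _].
  by apply: contrapT => h'; apply: h; rewrite inE.
have A2 la : la \notin A -> d2 la = 0.
  rewrite inE negb_or !in_fset_set // => /andP[_ /negP h].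
  by apply: contrapT => h'; apply: h; rewrite inE.
have S0 : \sum_(la <- A) (d1 la - d2 la) *: Gdet n (seq_of_part la) = 0.
  under eq_bigr do rewrite scalerBl.
  rewrite sumrB; apply/eqP; rewrite subr_eq0; apply/eqP.
  rewrite -(@fsbigTE _ _ _ _ A (fun la => d1 la *: Gdet n (seq_of_part la))).
    rewrite -(@fsbigTE _ _ _ _ A (fun la => d2 la *: Gdet n (seq_of_part la))).
      by rewrite -e1 -e2.
    by move=> la /A2 ->; rewrite scale0r.
  by move=> la /A1 ->; rewrite scale0r.
apply/funext => la; have [lA|lA] := boolP (la \in A); last by rewrite A1 ?A2.
apply/eqP; rewrite -subr_eq0; apply/eqP.
apply: (@Gdet_free n A (fun la => d1 la - d2 la)) => // [|mu _ h]; first exact: fset_uniq.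
have [/k1 //|/contrapT z1] := pselect (d1 mu <> 0).
by apply: k2 => z2; move: h; rewrite z1 z2 subrr eqxx.
Qed.

Lemma expands_expansion M s L : expands M s L -> is_expansion s (list_coef L).
Proof.
move=> [h1 h2]; split; first exact: finite_list_coef.
move=> n sn ad; split.
  by move=> la /list_coef_supp[c /h1[cs _] <-]; apply: leq_trans cs sn.
rewrite fsum_list_coef; apply/mpolyP => m.
rewrite (h2 n _ (@straightens_Gdet n m)) // raddf_sum /=.
by apply: eq_bigr => c _; rewrite mcoeffZ.
Qed.

Lemma delta_list (M : nat) s : all (fun x => x <= M%:Z) s ->
  exists2 L, expands M s L & delta s = list_coef L.
Proof.
move=> sM; have [L hL] := straighten sM; exists L => //.
have ex := expands_expansion hL.
by apply: xget_unique => // d' hd; apply: expansion_unique ex.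
Qed.

Lemma seq_bounded (s : seq int) : exists M : nat, all (fun x => x <= M%:Z) s.
Proof.
elim: s => [|x s [M h]]; first by exists 0%N.
exists (M + `|x|)%N; apply/andP; split; first by lia.
by apply: sub_all h => y; lia.
Qed.

Definition straightens_all (Phi : seq int -> int) : Prop := forall n, straightens n Phi.

Lemma delta_finite s : finite_set [set la | delta s la <> 0].
Proof.
have [M sM] := seq_bounded s; have [L _ ->] := delta_list sM.
exact: finite_list_coef.
Qed.

(** The constants are defined through polynomial determinants, but they record a straightening,
    which is valid for every functional subject to the two relations. *)
Lemma delta_sum s Phi : straightens_all Phi ->
  Phi s = \sum_(la \in [set: intpart]) delta s la * Phi (seq_of_part la).
Proof.
move=> st; have [M sM] := seq_bounded s; have [L [_ hL] ->] := delta_list sM.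
have [n ad] := adm_exists s; rewrite (hL n) //.
exact: esym (@fsum_list_coef int^o L (fun la => Phi (seq_of_part la))).
Qed.

(** * Double Grothendieck polynomials *)

Lemma msym_var (R : comNzRingType) n (s : 'S_n) i :
  msym s ('X_i : {mpoly R[n]}) = 'X_(s i).
Proof.
rewrite msymX; congr 'X_[_]; apply/mnmP => k; rewrite mnmE !mnm1E.
by congr nat_of_bool; rewrite -(inj_eq (@perm_inj _ s)) permKV.
Qed.

Section PermLen.
Variable n : nat.
Implicit Types (w : 'S_n) (i j : 'I_n).

(** The inversions of $ws_i$ are [(i, j)] and those of [w] with both positions moved by $s_i$. *)
Lemma perm_len_swap w i j : j = i.+1 :> nat -> (w i < w j)%N ->
  perm_len (tperm i j * w)%g = (perm_len w).+1.
Proof.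
move=> ji wij; rewrite /perm_len.
pose h (p : 'I_n * 'I_n) := (tperm i j p.1, tperm i j p.2).
have hI : injective h.
  by move=> [a b] [c d] [/perm_inj -> /perm_inj ->].
pose S := [set p : 'I_n * 'I_n | (p.1 < p.2)%N && (w p.2 < w p.1)%N]%SET.
have -> : [set p : 'I_n * 'I_n |
    (p.1 < p.2)%N && ((tperm i j * w)%g p.2 < (tperm i j * w)%g p.1)%N]%SET =
    (i, j) |: h @^-1: S.
  apply/setP => [[a b]]; rewrite !inE !permM /h /= -pair_eqE /=.
  have [v vE] : exists v : 'I_n -> nat, forall k, w k = v k :> nat.
    by exists (fun k => nat_of_ord (w k)).
  rewrite !vE in wij *.
  by case: tpermP => [->|->|/eqP + /eqP +]; case: tpermP => [->|->|/eqP + /eqP +];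
    rewrite ?eqxx; try rewrite -!(inj_eq val_inj); rewrite /=; lia.
by rewrite cardsU1 card_preimset // !inE /h /= tpermL tpermR ji ltnNge leqnSn.
Qed.

Lemma perm_len_ascent w i j : j = i.+1 :> nat ->
  perm_len (tperm i j * w)%g = (perm_len w).+1 -> (w i < w j)%N.
Proof.
move=> ji e; case: (ltngtP (w i) (w j)) => // [wji|/val_inj/perm_inj h].
  have := @perm_len_swap (tperm i j * w)%g i j ji.
  by rewrite !permM tpermL tpermR mulgA tperm2 mul1g => /(_ wji); lia.
by move: ji; rewrite h; lia.
Qed.

Lemma perm_len_max w : (perm_len w <= n * n)%N.
Proof. by rewrite /perm_len (leq_trans (max_card _)) // card_prod card_ord. Qed.

Lemma adjacent_mono (w : 'I_n -> 'I_n) (lo hi : nat) :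
  (forall i j, j = i.+1 :> nat -> (lo <= i)%N -> (j < hi)%N -> (w i < w j)%N) ->
  forall i k : 'I_n, (lo <= i)%N -> (i < k)%N -> (k < hi)%N -> (w i < w k)%N.
Proof.
move=> adj i k li ik kh; have [d] := ubnP (k - i)%N.
elim: d k ik kh => // d IH k ik kh kd.
have [e|ne] := eqVneq (k : nat) i.+1; first exact: adj.
have k1 : (k.-1 < n)%N by have := ltn_ord k; lia.
have k1i : (i < k.-1)%N by lia.
apply: (@ltn_trans (w (Ordinal k1))); first by apply: IH => //=; lia.
by apply: adj => /=; lia.
Qed.

Lemma w0E i : w0 n i = rev_ord i. Proof. by rewrite permE. Qed.

Lemma no_ascent_w0 w :
  (forall i j, j = i.+1 :> nat -> (w j < w i)%N) -> w = w0 n.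
Proof.
move=> desc.
have : (w * w0 n)%g = 1%g.
  apply: increasing_perm1 => i k ik.
  apply: (@adjacent_mono (w * w0 n)%g 0 n) => // {ik k}i j ji _ _.
  by rewrite !permM !w0E /=; have := desc _ _ ji; have := ltn_ord (w i); lia.
have w00 : (w0 n * w0 n)%g = 1%g.
  by apply/permP => i; rewrite permM !w0E rev_ordK perm1.
by move=> e; rewrite -[w]mulg1 -w00 mulgA e mul1g.
Qed.

Lemma ascent_exists w : w <> w0 n ->
  exists i j, j = i.+1 :> nat /\ (w i < w j)%N.
Proof.
move=> nw; apply: contrapT => no; apply: nw; apply: no_ascent_w0 => i j ji.
case: (ltngtP (w j) (w i)) => // [h|/val_inj/perm_inj h].
  by case: no; exists i, j.
by move: ji; rewrite h; lia.
Qed.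

End PermLen.

(** * Double Grothendieck polynomials are well defined *)

Section DgrothWellDefined.
Variable n : nat.
Notation P := {mpoly int[n + n]}.
Implicit Types (w : 'S_n) (i j : 'I_n) (f g h : P).

Definition sw i j f : P := msym (tperm (lshift n i) (lshift n j)) f.

Lemma swM i j f g : sw i j (f * g) = sw i j f * sw i j g.
Proof. exact: msymM. Qed.
Lemma swB i j f g : sw i j (f - g) = sw i j f - sw i j g.
Proof. exact: msymB. Qed.
Lemma sw1 i j : sw i j 1 = 1.
Proof. exact: msym1. Qed.
Lemma swK i j f : sw i j (sw i j f) = f.
Proof. by rewrite /sw -msymMm tperm2 msym1m. Qed.

Lemma sw_xv i j k : sw i j (xv k) = xv (tperm i j k).
Proof.
rewrite /sw /xv msym_var; congr 'X_(_); apply/esym/inj_tperm; exact: lshift_inj.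
Qed.

Lemma sw_yv i j k : sw i j (yv k) = yv k.
Proof. by rewrite /sw /yv msym_var tpermD // eq_lrshift. Qed.

Lemma xv_neq i j : i != j -> xv i - xv j != 0.
Proof.
move=> ij; apply/eqP => /(congr1 (mcoeff U_(lshift n i))).
rewrite mcoeffB !mcoeffXU mcoeff0 eqxx eq_lshift eq_sym (negPf ij).
by [].
Qed.

(** The point is that $f-s_if$ is divisible by $x_i-x_j$, which is clear for variables and passes to
    products and sums. *)
Lemma is_pi_exists i j f : exists g, is_pi i j f g.
Proof.
suff [g e] : exists g, f - sw i j f = (xv i - xv j) * g.
  exists ((1 - xv j) * g + sw i j f); rewrite /is_pi -/(sw i j f).
  have -> : (1 - xv j) * f - (1 - xv i) * sw i j f =
    (1 - xv j) * (f - sw i j f) + (xv i - xv j) * sw i j f by ring.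
  by rewrite e; ring.
elim/mpolyind: f => [|c m f _ _ [g e]].
  by exists 0; rewrite /sw msym0 subrr mulr0.
suff [g' e'] : exists g, 'X_[m] - sw i j 'X_[m] = (xv i - xv j) * g.
  exists (c *: g' + g); rewrite /sw msymD msymZ opprD addrACA -/(sw _ _ _) e.
  by rewrite -scalerBr -/(sw _ _ _) e' mulrDr scalerAr.
rewrite mpolyXE_id; elim/big_ind: _ => [|f1 f2 [g1 e1] [g2 e2]|k _].
- by exists 0; rewrite sw1 subrr mulr0.
- exists (g1 * f2 + sw i j f1 * g2).
  rewrite swM; have -> : f1 * f2 - sw i j f1 * sw i j f2 =
    (f1 - sw i j f1) * f2 + sw i j f1 * (f2 - sw i j f2) by ring.
  by rewrite e1 e2; ring.
elim: (m k) => [|l [gl el]]; first by exists 0; rewrite expr0 sw1 subrr mulr0.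
have [g' e'] : exists g', 'X_k - sw i j 'X_k = (xv i - xv j) * g'.
  rewrite /sw msym_var; case: tpermP => [->|->|_ _].
  - by exists 1; rewrite mulr1.
  - by exists (-1); rewrite mulrN1 opprB.
  - by exists 0; rewrite subrr mulr0.
exists (g' * 'X_k ^+ l + sw i j 'X_k * gl).
rewrite exprS swM; have -> : 'X_k * 'X_k ^+ l - sw i j 'X_k * sw i j ('X_k ^+ l) =
  ('X_k - sw i j 'X_k) * 'X_k ^+ l + sw i j 'X_k * ('X_k ^+ l - sw i j ('X_k ^+ l)) by ring.
by rewrite el e'; ring.
Qed.

Lemma is_pi_unique i j f g g' : i != j -> is_pi i j f g -> is_pi i j f g' -> g = g'.
Proof.
move=> ij h; rewrite /is_pi -h => /esym h'.
exact: (mulfI (xv_neq ij)).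
Qed.

(** Both $x_i-x_j$ and the right side of the equation defining $\pi_if$ change sign under the
    swap. *)
Lemma is_pi_sym i j f g : i != j -> is_pi i j f g -> sw i j g = g.
Proof.
move=> ij h; apply: (mulfI (xv_neq ij)); move: (h) => /(congr1 (sw i j)).
rewrite swM !swB !swM !swB sw1 !sw_xv tpermL tpermR -/(sw i j f) swK => e.
by rewrite [RHS]h -opprB mulNr e opprB.
Qed.

Lemma is_dgroth_inv w f : is_dgroth w f ->
  (w = w0 n /\ f = \prod_(i < n) \prod_(j < n | (i.+1 + j.+1 <= n)%N)
      (xv i + yv j - xv i * yv j)) \/
  exists i j f', [/\ j = i.+1 :> nat, (w i < w j)%N,
    is_dgroth (tperm i j * w)%g f' & is_pi i j f' f].
Proof.
case=> [|v i j f' g ji e h pi]; first by left.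
by right; exists i, j, f'; split=> //; apply: perm_len_ascent.
Qed.

Lemma dgroth_step w i j f g : j = i.+1 :> nat -> (w i < w j)%N ->
  is_dgroth (tperm i j * w)%g f -> is_pi i j f g -> is_dgroth w g.
Proof. by move=> ji wij; apply: dgroth_pi => //; apply: perm_len_swap. Qed.

Lemma len_ind (Q : 'S_n -> Prop) :
  (forall w, (forall v, (perm_len w < perm_len v)%N -> Q v) -> Q w) -> forall w, Q w.
Proof.
move=> IH w; have [k] := ubnP (n * n - perm_len w)%N.
elim: k w => // k IHk w wk; apply: IH => v wv; apply: IHk.
by have := perm_len_max v; lia.
Qed.

Lemma dgroth_exists w : exists f, is_dgroth w f.
Proof.
elim/len_ind: w => w IH; have [->|/ascent_exists[i [j [ji wij]]]] := pselect (w = w0 n).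
  by eexists; exact: dgroth_w0.
have [|f hf] := IH (tperm i j * w)%g; first by rewrite perm_len_swap.
have [g hg] := is_pi_exists i j f.
by exists g; apply: dgroth_step hf hg.
Qed.

Lemma sw_braid a b c f : a != b -> b != c -> a != c ->
  sw a b (sw b c (sw a b f)) = sw b c (sw a b (sw b c f)).
Proof.
move=> ab bc ac; rewrite /sw -!msymMm; congr msym.
have tJ (x y : 'I_(n + n)) u : (tperm x y * (u * tperm x y))%g = (u ^ tperm x y)%g.
  by rewrite conjgE tpermV.
rewrite !tJ !tpermJ !tpermL !tpermR.
by rewrite !tpermD ?eq_lshift // eq_sym.
Qed.

Lemma pi_comm i j k l h f1 f g1 g :
  i != j -> k != l -> i != k -> i != l -> j != k -> j != l ->
  is_pi k l h f1 -> is_pi i j f1 f -> is_pi i j h g1 -> is_pi k l g1 g -> f = g.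
Proof.
move=> ij kl ik il jk jl p1 p2 q1 q2.
apply: (mulfI (xv_neq kl)); apply: (mulfI (xv_neq ij)).
have swC u : sw i j (sw k l u) = sw k l (sw i j u).
  rewrite /sw -!msymMm; congr msym.
  by rewrite [LHS]conjgC tpermJ !tpermD ?eq_lshift // eq_sym.
have tk : tperm i j k = k by rewrite tpermD.
have tl : tperm i j l = l by rewrite tpermD.
have ti : tperm k l i = i by rewrite tpermD // eq_sym.
have tj : tperm k l j = j by rewrite tpermD // eq_sym.
rewrite /is_pi -!/(sw _ _ _) in p1 p2 q1 q2.
have e1 := congr1 (sw i j) p1; have e2 := congr1 (sw k l) q1.
rewrite !(swM, swB, sw1, sw_xv) tk tl swC in e1.
rewrite !(swM, swB, sw1, sw_xv) ti tj in e2.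
revert p1 p2 q1 q2 e1 e2.
generalize (sw k l (sw i j h)).
generalize (sw i j h) (sw k l h) (sw i j f1) (sw k l g1).
generalize (xv i) (xv j) (xv k) (xv l) => xi xj xk xl sih skh sf1 sg1 shh p1 p2 q1 q2 e1 e2.
apply/eqP; rewrite -subr_eq0; apply/eqP.
(* The difference is an explicit combination of the defining equations and of their images under the
   swaps. *)
transitivity
 ((xk - xl) * ((xi - xj) * f - ((1 - xj) * f1 - (1 - xi) * sf1))
 + (1 - xj) * ((xk - xl) * f1 - ((1 - xl) * h - (1 - xk) * skh))
 - (1 - xi) * ((xk - xl) * sf1 - ((1 - xl) * sih - (1 - xk) * shh))
 - ((xi - xj) * ((xk - xl) * g - ((1 - xl) * g1 - (1 - xk) * sg1))
 + (1 - xl) * ((xi - xj) * g1 - ((1 - xj) * h - (1 - xi) * sih))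
 - (1 - xk) * ((xi - xj) * sg1 - ((1 - xj) * skh - (1 - xi) * shh)))).
  by ring.
by rewrite p1 p2 q1 q2 e1 e2 !subrr !mulr0 !addr0 ?subrr.
Qed.

Lemma pi_braid a b c h f2 f1 f g2 g1 g : a != b -> b != c -> a != c ->
  is_pi a b h f2 -> is_pi b c f2 f1 -> is_pi a b f1 f ->
  is_pi b c h g2 -> is_pi a b g2 g1 -> is_pi b c g1 g -> f = g.
Proof.
move=> ab bc ac p1 p2 p3 q1 q2 q3.
have sf2 := is_pi_sym ab p1; have sg2 := is_pi_sym bc q1.
have br := @sw_braid a b c h ab bc ac.
have s1a : tperm a b c = c by rewrite tpermD.
have s2a : tperm b c a = a by rewrite tpermD // eq_sym.
rewrite /is_pi -!/(sw _ _ _) in p1 p2 p3 q1 q2 q3.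
have r1 := congr1 (sw b c) p1; have r2 := congr1 (sw a b) p2.
have r3 := congr1 (fun u => sw a b (sw b c u)) p1.
have t1 := congr1 (sw a b) q1; have t2 := congr1 (sw b c) q2.
have t3 := congr1 (fun u => sw b c (sw a b u)) q1.
rewrite /= !(swM, swB, sw1, sw_xv, tpermL, tpermR, s1a, s2a, sf2, sg2)
  in r1 r2 r3 t1 t2 t3.
rewrite br in r3.
apply: (mulfI (xv_neq ab)); apply: (mulfI (xv_neq bc)); apply: (mulfI (xv_neq ac)).
revert p1 p2 p3 q1 q2 q3 r1 r2 r3 t1 t2 t3.
generalize (sw b c (sw a b (sw b c h))) (sw a b (sw b c f2)) (sw b c (sw a b g2)).
generalize (sw a b (sw b c h)) (sw b c (sw a b h)).
generalize (sw a b h) (sw b c h) (sw b c f2) (sw a b f1) (sw a b g2) (sw b c g1).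
generalize (xv a) (xv b) (xv c) => x y z uh vh vf2 uf1 ug2 vg1 uvh vuh wh uvf2 vug2.
move=> p1 p2 p3 q1 q2 q3 r1 r2 r3 t1 t2 t3.
apply/eqP; rewrite -subr_eq0; apply/eqP.
have lc (k l r : P) : l = r -> k * (l - r) = 0 by move=> ->; rewrite subrr mulr0.
(* Multiplied by $(x-y)(x-z)(y-z)$, both sides become the same signed combination of the six
   permuted copies of [h]; this combination of the equations and of their swapped images eliminates
   the intermediate polynomials. *)
transitivity (
  (x - z) * (y - z) * ((x - y) * f - ((1 - y) * f1 - (1 - x) * uf1))
  + (x - z) * (1 - y) * ((y - z) * f1 - ((1 - z) * f2 - (1 - y) * vf2))
  - (1 - x) * (y - z) * ((x - z) * uf1 - ((1 - z) * f2 - (1 - x) * uvf2))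
  + (1 - z) ^+ 2 * ((x - y) * f2 - ((1 - y) * h - (1 - x) * uh))
  - (1 - y) ^+ 2 * ((x - z) * vf2 - ((1 - z) * vh - (1 - x) * vuh))
  + (1 - x) ^+ 2 * ((y - z) * uvf2 - ((1 - z) * uvh - (1 - y) * wh))
  - ((x - y) * (x - z) * ((y - z) * g - ((1 - z) * g1 - (1 - y) * vg1))
  + (1 - z) * (x - z) * ((x - y) * g1 - ((1 - y) * g2 - (1 - x) * ug2))
  - (1 - y) * (x - y) * ((x - z) * vg1 - ((1 - z) * g2 - (1 - x) * vug2))
  + (1 - y) * (1 - z) * ((y - z) * g2 - ((1 - z) * h - (1 - y) * vh))
  - (1 - z) * (1 - x) * ((x - z) * ug2 - ((1 - z) * uh - (1 - x) * uvh))
  + (1 - x) * (1 - y) * ((x - y) * vug2 - ((1 - y) * vuh - (1 - x) * wh)))).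
  by ring.
rewrite (lc _ _ _ p1) (lc _ _ _ p2) (lc _ _ _ p3) (lc _ _ _ q1) (lc _ _ _ q2) (lc _ _ _ q3).
by rewrite (lc _ _ _ r1) (lc _ _ _ r2) (lc _ _ _ r3) (lc _ _ _ t1) (lc _ _ _ t2) (lc _ _ _ t3) ?addr0 ?subrr.
Qed.

(** Both ascents are continued up to the common permutation in which [a], [b], [c] are reversed.
    Starting from one polynomial [h] there, the induction hypothesis identifies [f'] and [g'] with
    polynomials obtained from [h]. *)
Lemma dgroth_unique_braid w (a b c : 'I_n) f g : b = a.+1 :> nat -> c = b.+1 :> nat ->
  (w a < w b)%N -> (w b < w c)%N ->
  (forall v, (perm_len w < perm_len v)%N ->
     forall f g, is_dgroth v f -> is_dgroth v g -> f = g) ->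
  forall f' g', is_dgroth (tperm a b * w)%g f' -> is_pi a b f' f ->
  is_dgroth (tperm b c * w)%g g' -> is_pi b c g' g -> f = g.
Proof.
move=> ba cb wab wbc IH f' g' hf pf hg pg.
have ab : a != b by rewrite -val_eqE /=; lia.
have bc : b != c by rewrite -val_eqE /=; lia.
have ac : a != c by rewrite -val_eqE /=; lia.
have tc : tperm a b c = c by rewrite tpermD.
have ta : tperm b c a = a by rewrite tpermD // eq_sym.
pose w1 := (tperm a b * w)%g; pose w2 := (tperm b c * w)%g.
have l1 : perm_len w1 = (perm_len w).+1 by apply: perm_len_swap.
have l2 : perm_len w2 = (perm_len w).+1 by apply: perm_len_swap.
have a1 : (w1 b < w1 c)%N by rewrite !permM tpermR tc; apply: ltn_trans wbc.
have a2 : (w2 a < w2 b)%N by rewrite !permM tpermL ta; apply: ltn_trans wbc.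
pose w12 := (tperm b c * w1)%g; pose w21 := (tperm a b * w2)%g.
have l12 : perm_len w12 = (perm_len w).+2 by rewrite -l1; apply: perm_len_swap.
have l21 : perm_len w21 = (perm_len w).+2 by rewrite -l2; apply: perm_len_swap.
have a12 : (w12 a < w12 b)%N by rewrite !permM ta tpermL tpermL tc.
have a21 : (w21 b < w21 c)%N by rewrite !permM tc tpermR tpermR ta.
have e : (tperm a b * w12)%g = (tperm b c * w21)%g.
  have tJ (x y : 'I_n) u : (tperm x y * (u * tperm x y))%g = (u ^ tperm x y)%g.
    by rewrite conjgE tpermV.
  rewrite /w12 /w21 /w1 /w2 !mulgA; congr (_ * w)%g.
  by rewrite -!mulgA !tJ !tpermJ !tpermL !tpermR tc ta.
have [h hh] := dgroth_exists (tperm a b * w12)%g.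
have [f2 p1] := is_pi_exists a b h; have d2 := dgroth_step ba a12 hh p1.
have [f1 p2] := is_pi_exists b c f2; have d1 := dgroth_step cb a1 d2 p2.
rewrite e in hh.
have [g2 q1] := is_pi_exists b c h; have d2' := dgroth_step cb a21 hh q1.
have [g1 q2] := is_pi_exists a b g2; have d1' := dgroth_step ba a2 d2' q2.
have ef : f' = f1 by apply: IH hf d1; rewrite -/w1 l1.
have eg : g' = g1 by apply: IH hg d1'; rewrite -/w2 l2.
rewrite {}ef in pf; rewrite {}eg in pg.
exact: pi_braid p1 p2 pf q1 q2 pg.
Qed.

(** Local confluence: the ascents used by two derivations coincide, are adjacent or are far apart,
    and the last two cases are settled by the braid and commutation relations of the $\pi_i$. *)
Lemma dgroth_unique w f g : is_dgroth w f -> is_dgroth w g -> f = g.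
Proof.
elim/len_ind: w f g => w IH f g df dg.
case: (is_dgroth_inv df) (is_dgroth_inv dg)
  => [[ew ef]|[i [j [f' [ji wij hf pf]]]]] [[ew' eg]|[k [l [g' [lk wkl hg pg]]]]].
- by rewrite ef eg.
- by move: wkl; rewrite ew !w0E /=; have := ltn_ord l; lia.
- by move: wij; rewrite ew' !w0E /=; have := ltn_ord j; lia.
have nij : i != j by rewrite -val_eqE /=; lia.
have nkl : k != l by rewrite -val_eqE /=; lia.
have [ik|ik] := eqVneq (i : nat) k.
  have eik : i = k by apply: val_inj.
  have ejl : j = l by apply: val_inj; rewrite /= ji lk ik.
  subst k l; move: pf; rewrite (IH _ _ f' g' hf hg) ?perm_len_swap // => pf.
  exact: is_pi_unique pf pg.
have [jk|jk] := eqVneq (j : nat) k.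
  have ejk : j = k by apply: val_inj.
  by subst k; apply: (dgroth_unique_braid ji lk wij wkl IH hf pf hg pg).
have [il|il] := eqVneq (i : nat) l.
  have eil : i = l by apply: val_inj.
  by subst l; apply/esym; apply: (dgroth_unique_braid lk ji wkl wij IH hg pg hf pf).
have ikn : i != k by rewrite -val_eqE.
have jkn : j != k by rewrite -val_eqE.
have iln : i != l by rewrite -val_eqE.
have jln : j != l by rewrite -val_eqE /=; lia.
have tk : tperm i j k = k by rewrite tpermD.
have tl : tperm i j l = l by rewrite tpermD.
have ti : tperm k l i = i by rewrite tpermD // eq_sym.
have tj : tperm k l j = j by rewrite tpermD // eq_sym.
have l1 := perm_len_swap ji wij; have l2 := perm_len_swap lk wkl.
have a1 : ((tperm i j * w)%g k < (tperm i j * w)%g l)%N by rewrite !permM tk tl.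
have a2 : ((tperm k l * w)%g i < (tperm k l * w)%g j)%N by rewrite !permM ti tj.
have [h hh] := dgroth_exists (tperm k l * (tperm i j * w))%g.
have [f1 p1] := is_pi_exists k l h; have d1 := dgroth_step lk a1 hh p1.
have e : (tperm k l * (tperm i j * w) = tperm i j * (tperm k l * w))%g.
  rewrite !mulgA; congr (_ * w)%g.
  by rewrite conjgC tpermJ tk tl.
rewrite e in hh.
have [g1 q1] := is_pi_exists i j h; have d2 := dgroth_step ji a2 hh q1.
have ef : f' = f1 by apply: IH hf d1; rewrite l1.
have eg : g' = g1 by apply: IH hg d2; rewrite l2.
rewrite {}ef in pf; rewrite {}eg in pg.
exact: pi_comm nij nkl ikn iln jkn jln p1 pf q1 pg.
Qed.

Lemma dgrothP w f : is_dgroth w f -> dgroth w = f.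
Proof. by move=> df; apply: xget_unique => // g dg; apply: dgroth_unique dg df. Qed.

End DgrothWellDefined.

(** * Dominant permutations *)

Section Dominant.
Variable n : nat.
Notation P := {mpoly int[n + n]}.
Implicit Types (v w : 'S_n).

Definition xy (i j : 'I_n) : P := xv i + yv j - xv i * yv j.

Lemma sw_xy a b i j : sw a b (xy i j) = xy (tperm a b i) j.
Proof.
by rewrite /xy /sw msymB msymD msymM -!/(sw _ _ _) !sw_xv !sw_yv.
Qed.

Definition avoids132 v : Prop :=
  forall a b c : 'I_n, (a < b)%N -> (b < c)%N -> ~~ ((v a < v c)%N && (v c < v b)%N).

(** The Rothe diagram of [v]. *)
Definition diag v (i j : 'I_n) : bool := (j < v i)%N && (i < v^-1%g j)%N.

Definition diag_row v (i : 'I_n) : P := \prod_(j < n | diag v i j) xy i j.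

Lemma diag_w0 : is_dgroth (w0 n) (\prod_(i < n) diag_row (w0 n) i).
Proof.
suff -> : \prod_(i < n) diag_row (w0 n) i =
    \prod_(i < n) \prod_(j < n | (i.+1 + j.+1 <= n)%N) (xv i + yv j - xv i * yv j).
  exact: dgroth_w0.
apply: eq_bigr => i _; apply: eq_bigl => j; rewrite /diag.
have e : ((w0 n)^-1%g j = rev_ord j :> nat)%N.
  have -> : (w0 n)^-1%g j = rev_ord j by apply: (@perm_inj _ (w0 n)); rewrite permKV w0E rev_ordK.
  by [].
by rewrite e w0E /=; lia.
Qed.

Lemma first_ascent v : v <> w0 n -> exists i j : 'I_n,
  [/\ j = i.+1 :> nat, (v i < v j)%N & forall a : 'I_n, (a < i)%N -> (v i < v a)%N].
Proof.
move=> nv.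
pose Q (k : nat) := [exists i : 'I_n, [exists j : 'I_n,
  [&& i == k :> nat, j == k.+1 :> nat & (v i < v j)%N]]].
have ex : exists k, Q k.
  have [i [j [ji vij]]] := ascent_exists nv; exists i.
  by apply/existsP; exists i; apply/existsP; exists j; rewrite ji !eqxx.
case: (ex_minnP ex) => k /existsP[i /existsP[j /and3P[/eqP ik /eqP jk vij]]] kmin.
exists i, j; split=> //; first by rewrite jk ik.
move=> a ai.
have H : ((v * w0 n)%g a < (v * w0 n)%g i)%N.
  apply: (@adjacent_mono n (v * w0 n)%g 0 i.+1) => // b c cb _ ci.
  have : (v c < v b)%N.
    case: (ltngtP (v c) (v b)) => // [h|/val_inj/perm_inj h].
      have : (k <= b)%N.
        by apply: kmin; apply/existsP; exists b; apply/existsP; exists c; rewrite cb !eqxx.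
      by move: ik cb ci; lia.
    by move: cb; rewrite h; lia.
  by rewrite !permM !w0E /=; have := ltn_ord (v b); lia.
by move: H; rewrite !permM !w0E /=; have := ltn_ord (v a); have := ltn_ord (v i); lia.
Qed.

(** At the first ascent [i], the swap adds the single box [(i, v i)] to the diagram and keeps 132
    avoided. The product over the other boxes is symmetric in $x_i$ and $x_j$, and $\pi_i$ sends the
    factor of the additional box to 1. *)
Lemma dominant_dgroth v : avoids132 v -> is_dgroth v (\prod_(i < n) diag_row v i).
Proof.
elim/len_ind: v => v IH av.
have [->|/first_ascent[i [j [ji vij fa]]]] := pselect (v = w0 n); first exact: diag_w0.
have nij : i != j by rewrite -val_eqE /=; lia.
pose t := tperm i j; pose u := (t * v)%g.
have ui : u i = v j by rewrite permM tpermL.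
have uj : u j = v i by rewrite permM tpermR.
have ul l : l != i -> l != j -> u l = v l.
  by move=> li lj; rewrite permM tpermD // eq_sym.
have uV c : u^-1%g c = t (v^-1%g c) by rewrite invMg permM tpermV.
have tE k : t k = (if k == i :> nat then j else if k == j :> nat then i else k).
  rewrite /t; case: tpermP => [->|->|/eqP/negPf ki /eqP/negPf kj].
  - by rewrite eqxx.
  - by rewrite eqxx ji eqn_leq ltnn.
  - by rewrite -[_ == i :> nat]/(k == i) ki -[_ == j :> nat]/(k == j) kj.
have tmono (x y : 'I_n) : (x < y)%N -> ~ (x = i :> nat /\ y = j :> nat) -> (t x < t y)%N.
  move=> xy nxy; rewrite !tE.
  by case: (eqVneq (x : nat) i) => xi; case: (eqVneq (x : nat) j) => xj;
    case: (eqVneq (y : nat) i) => yi; case: (eqVneq (y : nat) j) => yj; lia.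
have ut k : v (t k) = u k by rewrite permM.
have au : avoids132 u.
  move=> a b c ab bc; apply/negP => /andP[ac cb].
  have [[/val_inj ai /val_inj bj]|nab] := pselect (a = i :> nat /\ b = j :> nat).
    by move: ac cb; rewrite ai bj ui uj => /ltn_trans h /h; rewrite ltnNge (ltnW vij).
  have [[/val_inj bi /val_inj cj]|nbc] := pselect (b = i :> nat /\ c = j :> nat).
    move: ac; rewrite cj uj ul; [|by rewrite -val_eqE /=; move: ab; rewrite bi; lia
      |by rewrite -val_eqE /=; move: ab; rewrite bi; lia].
    by rewrite ltnNge ltnW // fa // -bi.
  have := av _ _ _ (tmono _ _ ab nab) (tmono _ _ bc nbc).
  by rewrite !ut ac cb.
have hu := IH u _ au; rewrite perm_len_swap // in hu; have {hu} hu := hu (ltnSn _).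
apply: (dgroth_step ji vij hu).
pose R (c : 'I_n) := (c < v i)%N && (j < v^-1%g c)%N.
pose Q a := \prod_(c < n | R c) xy a c.
have posP (c k : 'I_n) : (v^-1%g c == k :> nat) = (c == v k :> nat).
  rewrite -[LHS]/(v^-1%g c == k) -[RHS]/(c == v k).
  by rewrite -(inj_eq (@perm_inj _ v)) permKV.
(* A value [c] to the right of position [j] and between [v i] and [v j] would complete a pattern
   132. *)
have avc (c : 'I_n) : (j < v^-1%g c)%N -> (c < v j)%N -> (c < v i)%N.
  move=> jc cj; have := av i j _ _ jc; rewrite permKV ji ltnSn => /(_ isT).
  rewrite negb_and cj orbF -leqNgt leq_eqVlt => /orP[/eqP/val_inj e|//].
  by move: jc; rewrite e permK ji; lia.
have [f fE] : exists f : 'I_n -> nat, forall k, v k = f k :> nat.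
  by exists (fun k => nat_of_ord (v k)).
have fij := vij; rewrite !fE in fij.
have rui : diag_row u i = xy i (v i) * Q i.
  rewrite /diag_row (bigD1 (v i)) /=; last first.
    by rewrite /diag ui vij uV permK tpermL ji ltnSn.
  congr (_ * _); apply: eq_bigl => c; rewrite /diag ui uV /R tE.
  have := posP c i; have := posP c j; have := avc c.
  rewrite -[c != v i]/(c != v i :> nat) !fE; move: (v^-1%g c) fij ji => k.
  by case: (eqVneq (k : nat) i) => ki; case: (eqVneq (k : nat) j) => kj;
    lia.
have ruj : diag_row u j = Q j.
  apply: eq_bigl => c; rewrite /diag uj uV /R tE.
  move: (v^-1%g c) ji => k.
  by case: (eqVneq (k : nat) i) => ki; case: (eqVneq (k : nat) j) => kj; lia.
have rvi : diag_row v i = Q i.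
  apply: eq_bigl => c; rewrite /diag /R.
  have := posP c i; have := posP c j; rewrite !fE; move: (v^-1%g c) fij ji => k.
  by lia.
have rvj : diag_row v j = Q j.
  apply: eq_bigl => c; rewrite /diag /R.
  have := avc c; rewrite !fE; move: (v^-1%g c) fij ji => k.
  by lia.
have rl l : l != i -> l != j -> diag_row u l = diag_row v l.
  move=> li lj; apply: eq_bigl => c; rewrite /diag ul // uV tE.
  have {}li : (l : nat) != i by []; have {}lj : (l : nat) != j by [].
  congr (_ && _); move: (v^-1%g c) ji => k.
  by case: (eqVneq (k : nat) i) => ki; case: (eqVneq (k : nat) j) => kj; lia.
pose rest := \prod_(l < n | (l != i) && (l != j)) diag_row v l.
have ev : \prod_(l < n) diag_row v l = Q i * (Q j * rest).
  by rewrite (bigD1 i) //= (bigD1 j) 1?eq_sym //= rvi rvj.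
have eu : \prod_(l < n) diag_row u l = xy i (v i) * (Q i * (Q j * rest)).
  rewrite (bigD1 i) //= (bigD1 j) 1?eq_sym //= rui ruj -mulrA.
  by do 3!congr (_ * _); apply: eq_bigr => l /andP[li lj]; apply: rl.
have sQ a : sw i j (Q a) = Q (t a).
  rewrite /Q /sw rmorph_prod; apply: eq_bigr => c _; exact: sw_xy.
have srest : sw i j rest = rest.
  rewrite /rest /sw rmorph_prod; apply: eq_bigr => l /andP[li lj].
  rewrite /diag_row rmorph_prod; apply: eq_bigr => c _.
  by rewrite -[LHS]/(sw i j (xy l c)) sw_xy tpermD // eq_sym.
rewrite eu ev /is_pi -/(sw _ _ _) !swM sw_xy !sQ srest /t tpermL tpermR /xy.
by generalize (Q i) (Q j) rest (xv i) (xv j) (yv (v i)) => *; ring.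
Qed.

End Dominant.

(** * Antisymmetrization over the first x-variables *)

Section ExtendPerm.
Variables (T T' : finType) (io : T -> T').
Hypothesis ioI : injective io.

Definition ext_fun (s : {perm T}) (k : T') : T' :=
  if [pick b | io b == k] is Some b then io (s b) else k.

Lemma ext_fun_io s b : ext_fun s (io b) = io (s b).
Proof.
rewrite /ext_fun; case: pickP => [c /eqP/ioI -> //|/(_ b)].
by rewrite eqxx.
Qed.

Lemma ext_fun_out s k : (forall b, io b != k) -> ext_fun s k = k.
Proof.
by move=> h; rewrite /ext_fun; case: pickP => // c; rewrite (negPf (h c)).
Qed.

Lemma ext_funP k : (exists b, k = io b) \/ forall b, io b != k.
Proof.
have [/existsP[b /eqP <-]|/existsPn h] := boolP [exists b, io b == k].
  by left; exists b.
by right.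
Qed.

Lemma ext_fun_inj s : injective (ext_fun s).
Proof.
move=> k l; have [[b ->]|h] := ext_funP k; have [[c ->]|h'] := ext_funP l.
- by rewrite !ext_fun_io => /ioI /perm_inj ->.
- by rewrite ext_fun_io ext_fun_out // => e; case/eqP: (h' (s b)).
- by rewrite ext_fun_io ext_fun_out // => e; case/eqP: (h (s c)).
- by rewrite !ext_fun_out.
Qed.

Definition ext_perm s : {perm T'} := perm (@ext_fun_inj s).

Lemma ext_permE s b : ext_perm s (io b) = io (s b).
Proof. by rewrite permE ext_fun_io. Qed.

Lemma ext_perm_out s k : (forall b, io b != k) -> ext_perm s k = k.
Proof. by move=> h; rewrite permE ext_fun_out. Qed.

Lemma ext_permM s r : ext_perm (s * r)%g = (ext_perm s * ext_perm r)%g.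
Proof.
apply/permP => k; rewrite permM; have [[b ->]|h] := ext_funP k.
  by rewrite !ext_permE permM.
by rewrite !ext_perm_out.
Qed.

Lemma ext_perm1 : ext_perm 1 = 1%g.
Proof.
apply/permP => k; rewrite perm1; have [[b ->]|h] := ext_funP k.
  by rewrite ext_permE perm1.
by rewrite ext_perm_out.
Qed.

Lemma ext_tperm a b : ext_perm (tperm a b) = tperm (io a) (io b).
Proof.
apply/permP => k; have [[c ->]|h] := ext_funP k.
  by rewrite ext_permE inj_tperm.
by rewrite ext_perm_out // tpermD.
Qed.

End ExtendPerm.

Lemma antitone_rev (N : nat) (f : nat -> nat) :
  (forall i k, (i < k)%N -> (k < N)%N -> (f k < f i)%N) ->
  (forall i, (i < N)%N -> (f i < N)%N) ->
  forall i, (i < N)%N -> f i = (N - i.+1)%N.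
Proof.
move=> dec bd.
have up i : (i < N)%N -> (f i + i < N)%N.
  elim: i => [|i IH] h; first by rewrite addn0 bd.
  by have := IH (ltnW h); have := dec _ _ (ltnSn i) h; lia.
have dn d : forall i, (i < N)%N -> (N - i.+1)%N = d -> (d <= f i)%N.
  elim: d => // d IH i iN e.
  have h : (i.+1 < N)%N by lia.
  by have := IH i.+1 h; have := dec _ _ (ltnSn i) h; lia.
by move=> i iN; have := up i iN; have := dn _ i iN erefl; lia.
Qed.

Lemma msym_exp m (s : 'S_m) (f : {mpoly int[m]}) k : msym s (f ^+ k) = msym s f ^+ k.
Proof. exact: rmorphXn. Qed.

Lemma msym_prod m (s : 'S_m) (I : Type) (r : seq I) (Q : pred I) (F : I -> {mpoly int[m]}) :
  msym s (\prod_(i <- r | Q i) F i) = \prod_(i <- r | Q i) msym s (F i).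
Proof. exact: rmorph_prod. Qed.

Section Antisymmetrizer.
Variables (n N : nat) (Nn : (N <= n)%N).
Notation P := {mpoly int[n + n]}.
Implicit Types (v w : 'S_n) (f g : P) (s : 'S_N).

Definition wid (i : 'I_N) : 'I_n := widen_ord Nn i.
Definition xpos (i : 'I_N) : 'I_(n + n) := lshift n (wid i).

Lemma wid_inj : injective wid.
Proof. by move=> i j /(congr1 val) /= /val_inj. Qed.

Lemma xpos_inj : injective xpos.
Proof. by move=> i j /lshift_inj/wid_inj. Qed.

Definition xact s f : P := msym (ext_perm xpos_inj s) f.

Lemma xactM s f g : xact s (f * g) = xact s f * xact s g.
Proof. exact: msymM. Qed.

Lemma xact_comp s r f : xact (s * r)%g f = xact r (xact s f).
Proof. by rewrite /xact ext_permM msymMm. Qed.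

Lemma xact_tperm (i j : 'I_N) f : xact (tperm i j) f = sw (wid i) (wid j) f.
Proof. by rewrite /xact ext_tperm. Qed.

Lemma xact_xv s i : xact s (xv (wid i)) = xv (wid (s i)).
Proof. by rewrite /xact /xv msym_var -/(xpos i) ext_permE. Qed.

Lemma xact_yv s i : xact s (yv i) = yv i.
Proof.
by rewrite /xact /yv msym_var ext_perm_out // => b; rewrite /xpos eq_lrshift.
Qed.

Definition Alt f : P := \sum_(s : 'S_N) (-1) ^+ s * xact s f.

Lemma AltD f g : Alt (f + g) = Alt f + Alt g.
Proof.
by rewrite -big_split; apply: eq_bigr => s _; rewrite /xact msymD mulrDr.
Qed.

Lemma AltN f : Alt (- f) = - Alt f.
Proof. by rewrite -sumrN; apply: eq_bigr => s _; rewrite /xact msymN mulrN. Qed.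

Lemma Alt_sw i j f : i != j -> Alt (sw (wid i) (wid j) f) = - Alt f.
Proof.
move=> ij; rewrite -sumrN [RHS](reindex_inj (mulgI (tperm i j))) /=.
apply: eq_bigr => s _; rewrite odd_mul_tperm ij signr_addb expr1.
by rewrite -xact_tperm -xact_comp mulN1r mulNr opprK.
Qed.

Definition weight : P := \prod_(i < N) (1 - xv (wid i)) ^+ i.

Lemma double_inj f g : f + f = g + g -> f = g.
Proof.
move=> e; apply/mpolyP => m; have := congr1 (mcoeff m) e.
by rewrite !mcoeffD; lia.
Qed.

(* The weight is chosen so that weight = (1 - x_{i+1}) * (divided difference of *)
(* weight), which makes the antisymmetrizer blind to the operators pi_i. *)
Lemma Alt_pi (i j : 'I_N) f g : j = i.+1 :> nat -> is_pi (wid i) (wid j) f g ->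
  Alt (weight * g) = Alt (weight * f).
Proof.
move=> ji pi; have ij : i != j by rewrite -val_eqE /=; lia.
have wij : wid i != wid j by rewrite (inj_eq wid_inj).
have sg := is_pi_sym wij pi.
pose W0 := ((1 - xv (wid i)) * (1 - xv (wid j))) ^+ i *
  \prod_(k < N | (k != i) && (k != j)) (1 - xv (wid k)) ^+ k.
have eW : weight = (1 - xv (wid j)) * W0.
  rewrite /weight (bigD1 i) //= (bigD1 j) 1?eq_sym //= /W0 ji exprS exprMn.
  by ring.
have sW : sw (wid i) (wid j) W0 = W0.
  rewrite /W0 swM /sw msym_exp msym_prod -!/(sw _ _ _) swM !swB sw1.
  rewrite !sw_xv tpermL tpermR [_ * (1 - xv (wid i))]mulrC; congr (_ * _).
  apply: eq_bigr => k /andP[ki kj].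
  by rewrite msym_exp -/(sw _ _ _) swB sw1 sw_xv tpermD // (inj_eq wid_inj) eq_sym.
move: W0 eW sW => W0 eW sW.
have s1 : sw (wid i) (wid j) (1 - xv (wid j)) = 1 - xv (wid i).
  by rewrite swB sw1 sw_xv tpermR.
(* As [g] and [W0] are symmetric, [Alt (weight * g)] can be written with $1-x_j$ or, with the
   opposite sign, with $1-x_i$. The sum of the two forms contains $x_i-x_j$, so that the defining
   equation of [g] applies. *)
apply: double_inj.
transitivity (Alt (W0 * ((xv (wid i) - xv (wid j)) * g))).
  have e : Alt (weight * g) = - Alt ((1 - xv (wid i)) * W0 * g).
    by rewrite -(@Alt_sw i j) // !swM -s1 swK sg sW eW.
  by rewrite [in X in _ + X]e eW -AltN -AltD; congr Alt; ring.
rewrite pi mulrBr AltD AltN -/(sw _ _ f).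
have -> : W0 * ((1 - xv (wid i)) * sw (wid i) (wid j) f) =
    sw (wid i) (wid j) (W0 * ((1 - xv (wid j)) * f)) by rewrite !swM s1 sW.
by rewrite Alt_sw // opprK eW; congr (Alt _ + Alt _); ring.
Qed.

Definition decreasing_on w : Prop :=
  forall i k : 'I_n, (i < k)%N -> (k < N)%N -> (w k < w i)%N.

(** Each ascent among the first [N] positions is removed by a swap, which [Alt_pi] does not
    notice. *)
Lemma sort_dgroth w : exists v, [/\ decreasing_on v,
  forall k : 'I_n, (N <= k)%N -> v k = w k &
  Alt (weight * dgroth v) = Alt (weight * dgroth w)].
Proof.
elim/len_ind: w => w IH.
have [dec|nd] := pselect (decreasing_on w); first by exists w.
have [i [j [ji jN wij]]] : exists i j : 'I_n,
    [/\ j = i.+1 :> nat, (j < N)%N & (w i < w j)%N].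
  apply: contrapT => no; apply: nd => i k ik kN.
  have H : ((w * w0 n)%g i < (w * w0 n)%g k)%N.
    apply: (@adjacent_mono n (w * w0 n)%g 0 N) => // b c cb _ cN.
    have : (w c < w b)%N.
      case: (ltngtP (w c) (w b)) => // [h|/val_inj/perm_inj h].
        by case: no; exists b, c.
      by move: cb; rewrite h; lia.
    by rewrite !permM !w0E /=; have := ltn_ord (w b); lia.
  by move: H; rewrite !permM !w0E /=; have := ltn_ord (w i); have := ltn_ord (w k); lia.
have [|v [dv ev av]] := IH (tperm i j * w)%g; first by rewrite perm_len_swap.
exists v; split=> // [k Nk|].
  rewrite ev // permM tpermD // -val_eqE /=; lia.
have [f hf] := dgroth_exists (tperm i j * w)%g.
have [g hg] := is_pi_exists i j f.
rewrite av (dgrothP hf) (dgrothP (dgroth_step ji wij hf hg)).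
have iN : (i < N)%N by lia.
have ei : i = wid (Ordinal iN) by apply: val_inj.
have ej : j = wid (Ordinal jN) by apply: val_inj.
by apply/esym/(@Alt_pi (Ordinal iN) (Ordinal jN)); rewrite // -ei -ej.
Qed.

Definition increasing_in (lo hi : nat) w : Prop :=
  forall i k : 'I_n, (lo <= i)%N -> (i < k)%N -> (k < hi)%N -> (w i < w k)%N.

Lemma sorted_values w v : increasing_in 0 N w -> decreasing_on v ->
  (forall k : 'I_n, (N <= k)%N -> v k = w k) ->
  forall (k l : 'I_n), (k < N)%N -> l = (N - k.+1)%N :> nat -> v k = w l.
Proof.
move=> iw dv e k l kN lk.
pose s := (v * w^-1)%g.
have ws i : w (s i) = v i by rewrite permM permKV.
have s_out (i : 'I_n) : (N <= i)%N -> s i = i by move=> h; apply: (@perm_inj _ w); rewrite ws e.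
have s_in (i : 'I_n) : (i < N)%N -> (s i < N)%N.
  move=> iN; rewrite ltnNge; apply/negP => h.
  by have /perm_inj h' := s_out _ h; move: h; rewrite h' leqNgt iN.
have s_dec (i j : 'I_n) : (i < j)%N -> (j < N)%N -> (s j < s i)%N.
  move=> ij jN; have := dv _ _ ij jN; rewrite -!ws.
  case: (ltngtP (s j) (s i)) => // [h|/val_inj ->]; last by rewrite ltnn.
  by have := iw _ _ (leq0n _) h (s_in _ jN); lia.
pose f (i : nat) : nat := if insub i is Some i' then s (i' : 'I_n) else 0%N.
have fE (i : 'I_n) : f i = s i by rewrite /f valK.
have ord_of i : (i < N)%N -> exists i' : 'I_n, i' = i :> nat.
  by move=> iN; exists (Ordinal (leq_trans iN Nn)).
have := @antitone_rev N f _ _ k kN; rewrite fE => H.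
rewrite -ws; congr (w _); apply: val_inj; rewrite /= lk; apply: H.
  move=> i j ij jN; have [i' e1] := ord_of i (ltn_trans ij jN).
  have [j' e2] := ord_of j jN; rewrite -e1 -e2 !fE; apply: s_dec; by rewrite ?e1 ?e2.
by move=> i iN; have [i' e1] := ord_of i iN; rewrite -e1 fE s_in // e1.
Qed.

Lemma sorted_avoids132 w v : increasing_in N n w -> decreasing_on v ->
  (forall k : 'I_n, (N <= k)%N -> v k = w k) -> avoids132 v.
Proof.
move=> iw dv e a b c ab bc; apply/negP => /andP[ac cb].
have [bN|Nb] := ltnP b N; first by have := dv _ _ ab bN; lia.
have := iw b c Nb bc (ltn_ord c); have Nc := leq_trans Nb (ltnW bc).
by rewrite -(e _ Nb) -(e _ Nc) => /ltn_trans/(_ cb); rewrite ltnn.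
Qed.

Lemma xact_all f : (forall i j : 'I_N, j = i.+1 :> nat -> xact (tperm i j) f = f) ->
  forall s, xact s f = f.
Proof.
move=> h.
have H s : xact (s * (w0 N)^-1)%g f = f.
  elim/len_ind: s => s IH.
  have [->|/ascent_exists[i [j [ji sij]]]] := pselect (s = w0 N).
    by rewrite mulgV /xact ext_perm1 msym1m.
  have := IH (tperm i j * s)%g; rewrite perm_len_swap // => /(_ (ltnSn _)) e.
  by rewrite -mulgA xact_comp h in e.
by move=> s; have := H (s * w0 N)%g; rewrite -mulgA mulgV mulg1.
Qed.

(** Every ascent of [w] exhibits its polynomial as a value of $\pi_i$, which is symmetric. *)
Lemma xact_dgroth w s : increasing_in 0 N w -> xact s (dgroth w) = dgroth w.
Proof.
move=> iw; apply: xact_all => i j ji.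
have wij : (w (wid i) < w (wid j))%N by apply: iw => //=; rewrite ji.
have [f hf] := dgroth_exists (tperm (wid i) (wid j) * w)%g.
have [g hg] := is_pi_exists (wid i) (wid j) f.
rewrite xact_tperm (dgrothP (dgroth_step _ wij hf hg)) //.
apply: is_pi_sym hg; rewrite (inj_eq wid_inj) -val_eqE /=; lia.
Qed.

Definition numer (mu : nat -> nat) : 'M[P]_N :=
  \matrix_(j < N, i < N) ((1 - xv (wid i)) ^+ j *
    \prod_(l < n | (l < mu j)%N) xy (wid i) l).

Lemma Alt_numer (mu : nat -> nat) :
  Alt (weight * \prod_(i < N) \prod_(l < n | (l < mu i)%N) xy (wid i) l) =
  \det (numer mu).
Proof.
rewrite /weight -big_split /=; apply: eq_bigr => s _; congr (_ * _).
rewrite /xact msym_prod; apply: eq_bigr => i _; rewrite mxE.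
rewrite msymM msym_exp msym_prod msymB msym1 -/(xact s _) xact_xv.
congr (_ * _); apply: eq_bigr => l _.
by rewrite /xy msymB msymD msymM -!/(xact s _) xact_xv xact_yv.
Qed.

Lemma Alt_weight : Alt weight = \det (\matrix_(j < N, i < N) (1 - xv (wid i)) ^+ j).
Proof.
apply: eq_bigr => s _; congr (_ * _).
rewrite /xact msym_prod; apply: eq_bigr => i _; rewrite mxE.
by rewrite msym_exp msymB msym1 -/(xact s _) xact_xv.
Qed.

(** [Alt (weight * dgroth w)] is computed in two ways. The symmetric factor [dgroth w] can be taken
    out; or else the first [N] values are sorted, and the resulting permutation is dominant with
    rows of lengths [mu 0], [mu 1], and so on. *)
Lemma grassmannian_dgroth w (mu : nat -> nat) :
  increasing_in 0 N w -> increasing_in N n w ->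
  (forall k l : 'I_n, (k < N)%N -> l = (N - k.+1)%N :> nat -> w l = mu k :> nat) ->
  dgroth w * \det (\matrix_(j < N, i < N) (1 - xv (wid i)) ^+ j) = \det (numer mu).
Proof.
move=> i1 i2 hmu; rewrite -Alt_weight -Alt_numer.
have [v [dv ev av]] := sort_dgroth w.
have dom := dominant_dgroth (sorted_avoids132 i2 dv ev).
transitivity (Alt (weight * dgroth w)).
  rewrite mulr_sumr; apply: eq_bigr => s _.
  by rewrite xactM xact_dgroth // mulrCA [dgroth w * _]mulrC.
rewrite -av (dgrothP dom); congr Alt; congr (_ * _).
have rowout (i : 'I_n) : (N <= i)%N -> diag_row v i = 1.
  move=> Ni; rewrite /diag_row big_pred0 // => j; rewrite /diag.
  apply/negP => /andP[h1 h2]; have := i2 i _ Ni h2 (ltn_ord _).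
  rewrite -(ev _ Ni) -(ev _ (leq_trans Ni (ltnW h2))) permKV => h.
  by move: (ltn_trans h h1); rewrite ltnn.
have rowin (i : 'I_n) : (i < N)%N ->
    diag_row v i = \prod_(l < n | (l < mu i)%N) xy i l.
  move=> iN; apply: eq_bigl => l; rewrite /diag.
  have lt : (N - i.+1 < n)%N by lia.
  rewrite (sorted_values i1 dv ev iN (l := Ordinal lt)) // (hmu i) //.
  case: ltnP => //= lm; rewrite ltnNge; apply/negP => h.
  have vi : v i = mu i :> nat.
    by rewrite (sorted_values i1 dv ev iN (l := Ordinal lt)) // (hmu i).
  move: h; rewrite leq_eqVlt => /orP[/eqP/val_inj e|h].
    by move: lm; rewrite -vi -e permKV ltnn.
  by have := dv _ _ h iN; rewrite permKV vi; lia.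
rewrite (bigID (fun i : 'I_n => (i < N)%N)) /= [X in _ * X]big1 ?mulr1; last first.
  by move=> i; rewrite -leqNgt => /rowout.
rewrite (big_ord_narrow Nn) /=.
by apply: eq_bigr => i _; rewrite rowin /= ?ltn_ord.
Qed.

End Antisymmetrizer.

(** * Grassmannian permutations *)

Section Grassmannian.
Variable la : intpart.
Notation p := (size la).
Notation nn := (size la + head 0%N la)%N.

Lemma part_le_head i : (nth 0%N la i <= head 0%N la)%N.
Proof. by rewrite -nth0; apply: parts_dec. Qed.

Lemma grassmannian_exists : exists w : 'S_nn, is_grassmannian w.
Proof.
(* One-line notation of $w_\lambda$: the prescribed values [A], followed by all other values in
   increasing order. *)
pose A := [seq (i + nth 0%N la (p - i.+1))%N | i <- iota 0 p].
pose B : seq nat := [seq x <- iota 0 nn | x \notin A].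
have nthA i : (i < p)%N -> nth 0%N A i = (i + nth 0%N la (p - i.+1))%N.
  by move=> ip; rewrite (nth_map 0%N) ?size_iota // nth_iota // add0n.
have sA : size A = p by rewrite size_map size_iota.
have sortA : sorted ltn A.
  apply/(sortedP 0%N) => i; rewrite sA => ip; rewrite !nthA ?(ltnW ip) //.
  by have := @parts_dec la (p - i.+2) (p - i.+1); rewrite /ltn /=; lia.
have An x : x \in A -> (x < nn)%N.
  by case/mapP => i; rewrite mem_iota => ? ->; have := part_le_head (p - i.+1); lia.
have perm_s : perm_eq (A ++ B) (iota 0 nn).
  apply: perm_trans (permEl (perm_filterC (mem A) (iota 0 nn))).
  rewrite perm_cat2r.
  apply: uniq_perm; rewrite ?filter_uniq ?iota_uniq //.
    exact: sorted_uniq ltn_trans ltnn _ sortA.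
  move=> x; rewrite mem_filter mem_iota /= add0n.
  by case xA : (x \in A) => //=; rewrite An.
have sz : size (A ++ B) = nn by rewrite (perm_size perm_s) size_iota.
have us : uniq (A ++ B) by rewrite (perm_uniq perm_s) iota_uniq.
have lt_s (i : 'I_nn) : (nth 0%N (A ++ B) i < nn)%N.
  have : nth 0%N (A ++ B) i \in A ++ B by rewrite mem_nth // sz.
  by rewrite (perm_mem perm_s) mem_iota.
have inj : injective (fun i : 'I_nn => Ordinal (lt_s i)).
  move=> i j /(congr1 val) /= /eqP; rewrite nth_uniq ?sz //.
  by move=> /eqP/val_inj.
exists (perm inj); split.
  by move=> i ip; rewrite permE /= nth_cat sA ip nthA.
move=> i j ji ip; rewrite !permE /= !nth_cat sA.
case: (ltnP i p) => hi.
  have -> : (j < p)%N by lia.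
  by rewrite !nthA //; [have := @parts_dec la (p - j.+1) (p - i.+1) | ]; lia.
have -> : (j < p)%N = false by lia.
have szB : (size B = nn - p)%N by have := sz; rewrite size_cat sA; lia.
have sB : sorted ltn B by apply: sorted_filter (iota_ltn_sorted _ _); exact: ltn_trans.
by apply: (sorted_ltn_nth ltn_trans 0%N sB); rewrite ?inE ?szB; have := ltn_ord j; lia.
Qed.

Variables (k : nat) (w : 'S_nn).
Hypothesis gw : is_grassmannian w.
Notation sw := (shift_perm k w).

Lemma shift_perm_lo (i : 'I_(k + nn)) : (i < k)%N -> sw i = i.
Proof.
move=> ik; rewrite permE /shift_fun; case: split_ordP => j ij //.
by move: ik; rewrite ij /= ltnNge leq_addr.
Qed.

Lemma shift_perm_hi (i : 'I_nn) : sw (rshift k i) = rshift k (w i).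
Proof.
rewrite permE /shift_fun; case: split_ordP => j /eqP.
  by rewrite eq_rlshift.
by rewrite eq_rshift => /eqP ->.
Qed.

Lemma ord_hi (i : 'I_(k + nn)) : (k <= i)%N -> exists i', i = rshift k i'.
Proof.
move=> ki; case: (split_ordP i) => j ij; last by exists j.
by move: ki; rewrite ij /= leqNgt ltn_ord.
Qed.

Lemma shift_perm_first (l : 'I_(k + nn)) : (l < k + p)%N ->
  sw l = (l + nth 0%N la (k + p - l.+1))%N :> nat.
Proof.
move=> lp; have [lk|kl] := ltnP l k.
  by rewrite shift_perm_lo // nth_default ?addn0 //; lia.
have [i ei] := ord_hi kl; rewrite ei in lp *; rewrite shift_perm_hi /=.
have ip : (i < p)%N by move: lp => /=; lia.
rewrite (gw.1 i ip) addnA; congr (_ + nth _ _ _)%N; lia.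
Qed.

Lemma shift_perm_increasing_first : increasing_in 0 (k + p) sw.
Proof.
move=> i j _ ij jp; rewrite !shift_perm_first //; last by lia.
by have := @parts_dec la (k + p - j.+1) (k + p - i.+1); lia.
Qed.

Lemma shift_perm_increasing_last : increasing_in (k + p) (k + nn) sw.
Proof.
apply: adjacent_mono => i j ji pi jn.
have ki : (k <= i)%N by lia.
have kj : (k <= j)%N by lia.
have [i' ei] := ord_hi ki; have [j' ej] := ord_hi kj.
rewrite ei ej !shift_perm_hi /= ltn_add2l.
by apply: gw.2; rewrite ei ej /= in ji pi; lia.
Qed.

Lemma groth_grassmannian (h : (k + p <= k + nn)%N) :
  dgroth sw * \det (\matrix_(j < k + p, i < k + p) (1 - xv (wid h i)) ^+ j) =
  \det (numer h (shifted (k + p) la)).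
Proof.
apply: grassmannian_dgroth.
- exact: shift_perm_increasing_first.
- exact: shift_perm_increasing_last.
move=> a l ap e; rewrite shift_perm_first; last by lia.
rewrite /shifted e addnC; congr (_ + _)%N; last by lia.
by congr nth; lia.
Qed.

End Grassmannian.

Lemma groth_one (n : nat) : dgroth (1%g : 'S_n) = 1.
Proof.
have a : avoids132 (1%g : 'S_n).
  by move=> a b c ab bc; rewrite !perm1; apply/negP => /andP[_]; lia.
rewrite (dgrothP (dominant_dgroth a)) big1 // => i _; rewrite /diag_row big_pred0 // => j.
by rewrite /diag invg1 !perm1; lia.
Qed.

(** * The generating series P(z) *)

(* [ecf a d] is the coefficient of z^d in the expansion of (1 + z)^(-a) at     *)
(* z = oo. *)
Definition ecf (a d : int) : int :=
  match a with
  | Posz 0 => (d == 0)%:R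
  | Posz n.+1 => if - d - n.+1%:Z is Posz b then (-1) ^+ b * ('C(n + b, b))%:Z else 0
  | Negz n => if d is Posz k then ('C(n.+1, k))%:Z else 0
  end.

Lemma ecf_rec a d : ecf (a - 1) d = ecf a d + ecf a (d - 1).
Proof.
case: a => [[|[|n]]|n].
- have -> : 0%:Z - 1 = Negz 0 by [].
  by case: d => [[|[|k]]|k].
- have -> : 1%:Z - 1 = 0 by [].
  have [->|d0] := eqVneq d 0; first by [].
  have [dn|dp] := ltrP d 0; last first.
    rewrite /ecf (negPf d0); have [b -> ] : exists b, - d - 1 = Negz b.
      by exists (`|d|%N); lia.
    have [b' ->] : exists b, - (d - 1) - 1 = Negz b.
      by exists (`|d|%N.-1); lia.
    by [].
  rewrite /ecf (negPf d0); have [b ->] : exists b : nat, d = - b.+1%:Z.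
    by exists (`|d|%N.-1); lia.
  have -> : - - b.+1%:Z - 1 = b%:Z by lia.
  have -> : - (- b.+1%:Z - 1) - 1 = b.+1%:Z by lia.
  by rewrite !add0n !binn exprS !mulr1 mulN1r subrr.
- have -> : n.+2%:Z - 1 = n.+1%:Z by lia.
  rewrite /ecf; have -> : - (d - 1) - n.+2%:Z = - d - n.+1%:Z by lia.
  case e : (- d - n.+1%:Z) => [[|b]|b].
  + have -> : - d - n.+2%:Z = Negz 0 by lia.
    by rewrite !bin0.
  + have -> : - d - n.+2%:Z = b by lia.
    have bE : 'C(n.+1 + b.+1, b.+1) = ('C(n + b.+1, b.+1) + 'C(n.+1 + b, b))%N.
      by rewrite addSn binS addnS addSn.
    by rewrite bE PoszD exprS; ring.
  + by have -> : - d - n.+2%:Z = Negz b.+1 by lia.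
have -> : Negz n - 1 = Negz n.+1 by lia.
case: d => [[|k]|k]; first by rewrite /= !bin0.
  have -> : k.+1%:Z - 1 = k by lia.
  by rewrite /ecf binS PoszD.
by have -> : Negz k - 1 = Negz k.+1 by lia.
Qed.

Lemma ecf_gt a d : - a < d -> ecf a d = 0.
Proof.
case: a => [[|n]|n] /= h.
- by case: eqP => // e; move: h; rewrite e.
- have [b ->] : exists b, - d - n.+1%:Z = Negz b by exists (`|(d + n)%R|%N); lia.
  by [].
- case: d h => // k h; rewrite bin_small //; lia.
Qed.

Lemma ecf_top a : ecf a (- a) = 1.
Proof.
case: a => [[|n]|n]; [by [] | | by rewrite /= binn].
rewrite /ecf; have -> : - - n.+1%:Z - n.+1%:Z = Posz 0 by lia.
by rewrite bin0.
Qed.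

Lemma ecf_nonpos a d : a <= 0 -> d <= 0 -> ecf a d = (d == 0)%:R.
Proof.
case: a => [[|n]|n] // _; case: d => [[|k]|k] //= _.
Qed.

Section LaurentCoefficient.
Implicit Types (q : {poly int}) (a k : int).

(** The coefficient of $z^k$ in $(1+z)^{-a}q(z)$, expanded at $z=\infty$. *)
Definition lc a k q : int := \sum_(i < size q) q`_i * ecf a (k - i%:Z).

Lemma lc_wide B a k q : (size q <= B)%N -> lc a k q = \sum_(i < B) q`_i * ecf a (k - i%:Z).
Proof.
move=> h; rewrite /lc (big_ord_widen _ (fun i => q`_i * ecf a (k - i%:Z)) h) big_mkcond.
by apply: eq_bigr => i _; case: ltnP => // h'; rewrite nth_default // mul0r.
Qed.

Lemma lc_is_zmod_morphism a k : zmod_morphism (lc a k).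
Proof.
move=> p q; pose B := maxn (size p) (size q).
have hpq : (size (p - q)%R <= B)%N.
  by apply: leq_trans (size_polyD _ _) _; rewrite size_polyN.
rewrite (lc_wide _ _ hpq) (@lc_wide B _ _ p) ?leq_maxl // (@lc_wide B _ _ q) ?leq_maxr //.
by rewrite -sumrB; apply: eq_bigr => i _; rewrite coefB mulrBl.
Qed.

HB.instance Definition _ a k := GRing.isZmodMorphism.Build {poly int} int (lc a k)
  (lc_is_zmod_morphism a k).

Lemma lcC a k (c : int) q : lc a k (c%:P * q) = c * lc a k q.
Proof.
rewrite (@lc_wide (size q)); last by rewrite mul_polyC size_scale_leq.
by rewrite mulr_sumr; apply: eq_bigr => i _; rewrite coefCM mulrA.
Qed.

Lemma lcX a k q : lc a k ('X * q) = lc a (k - 1) q.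
Proof.
rewrite (@lc_wide (size q).+1); last first.
  by rewrite (leq_trans (size_polyMleq _ _)) // size_polyX.
rewrite big_ord_recl coefXM mul0r add0r; apply: eq_bigr => i _.
by rewrite coefXM /= /bump /=; congr (_ * ecf _ _); lia.
Qed.

Lemma lc_rec a k q : lc (a - 1) k q = lc a k q + lc a (k - 1) q.
Proof.
rewrite /lc -big_split; apply: eq_bigr => i _ /=; rewrite -mulrDr ecf_rec.
by congr (_ * (_ + ecf _ _)); lia.
Qed.

Lemma lc_u a k q : lc a k ((1 + 'X) * q) = lc (a - 1) k q.
Proof. by rewrite mulrDl mul1r raddfD /= lcX lc_rec. Qed.

(** The expansion of $(1+z)^{-a}q$ at infinity starts in degree $\deg q-a$. This bound makes the
    sums over $t$ finite. *)
Lemma lc_gt a k q : (size q)%:Z - a <= k -> lc a k q = 0.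
Proof.
by move=> h; rewrite /lc big1 // => i _; rewrite ecf_gt ?mulr0 //; have := ltn_ord i; lia.
Qed.

Lemma lc_nonpos a k q : a <= 0 -> k <= 0 -> lc a k q = q`_0 * (k == 0)%:R.
Proof.
move=> a0 k0; rewrite (@lc_wide (size q).+1) // big_ord_recl subr0 /=.
rewrite ecf_nonpos // big1 ?addr0 // => i _; rewrite ecf_nonpos //; last first.
  by rewrite /bump /=; lia.
by case: eqP => [|_]; rewrite ?mulr0 // /bump /=; lia.
Qed.

End LaurentCoefficient.

(** * The factors of P(z), one for each variable *)

Section Lines.
Variable R : comNzRingType.

(* The series sum_n f(n) v^n. *)
Definition line : nat + nat -> (nat -> R) -> ps R := locked_with ps_key
  (fun v f m => if (finsupp m `<=` [fset v])%fset then f (m v) else 0).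

Lemma line_coef v f m :
  line v f m = if (finsupp m `<=` [fset v])%fset then f (m v) else 0.
Proof. by rewrite /line unlock. Qed.

Definition U : nat + nat -> mon := locked_with ps_key (fun v => [fsfun w in [fset v]%fset => 1%N]).

Lemma UE v w : U v w = (w == v) :> nat.
Proof. by rewrite /U unlock fsfun_fun inE; case: eqP. Qed.

Lemma suppP (m : mon) v :
  reflect (forall w, w != v -> m w = 0%N) (finsupp m `<=` [fset v])%fset.
Proof.
apply: (iffP idP) => [/fsubsetP h w wv|h]; last apply/fsubsetP => w.
  by rewrite fsfun_dflt //; apply: contra wv => /h; rewrite inE.
by rewrite mem_finsupp inE; apply: contraNT => /h ->.
Qed.

Lemma lineD v f g : line v f + line v g = line v (fun n => f n + g n).
Proof. by apply/funext => m; rewrite paddE !line_coef; case: ifP => //; rewrite addr0. Qed.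

Lemma lineN v f : - line v f = line v (fun n => - f n).
Proof. by apply/funext => m; rewrite poppE !line_coef; case: ifP => //; rewrite oppr0. Qed.

Lemma lineC v r f : psC r * line v f = line v (fun n => r * f n).
Proof. by apply/funext => m; rewrite psC_mulE !line_coef; case: ifP => //; rewrite mulr0. Qed.

Lemma line1 v : line v (fun n => (n == 0%N)%:R) = 1.
Proof.
apply/funext => m; rewrite poneE line_coef; case: suppP => h.
  congr (nat_of_bool _)%:R; apply/eqP/eqP => [m0|->]; last by rewrite mon0E.
  by apply: monP => w; rewrite mon0E; have [->|/h] := eqVneq w v.
by case: eqP => // m0; case: h => w _; rewrite m0 mon0E.
Qed.

Lemma line_shift v f :
  mono R (U v) * line v f = line v (fun n => if n is n'.+1 then f n' else 0).
Proof.
apply/funext => m; have [[n ->]|h] := pselect (exists n, m = madd (U v) n).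
  rewrite mono_mulE !line_coef maddE UE eqxx add1n.
  congr (if _ then _ else _); apply/suppP/suppP => h w wv.
    by rewrite maddE UE (negPf wv) h.
  by have := h w wv; rewrite maddE UE (negPf wv).
rewrite mono_mulN => [|n e]; last by case: h; exists n.
rewrite line_coef; case: suppP => // hm; case e : (m v) => [//|k]; case: h.
exists [fsfun w in [fset v]%fset => k]; apply: monP => w.
rewrite maddE UE fsfun_fun inE; case: eqP => [->|/eqP wv]; first by rewrite e add1n.
by rewrite hm.
Qed.

Lemma mono_line v : mono R (U v) = line v (fun n => (n == 1%N)%:R).
Proof.
by rewrite -[LHS]mulr1 -(line1 v) line_shift; congr line; apply/funext => -[|[|n]].
Qed.

(** Since [F] is free of [v], the only factorization of [m] that matters separates the power of [v]
    from the rest. *)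
Lemma line_mulE v f (F : ps R) m :
  (forall n : mon, n v != 0%N -> F n = 0) ->
  (line v f * F) m = f (m v) * F [fsfun w in (finsupp m `\ v)%fset => m w].
Proof.
move=> F0; set mr := [fsfun w in _ => _].
have mrE w : mr w = if w == v then 0%N else m w.
  rewrite fsfun_fun !inE; case: eqP => //= wv.
  by case: ifPn => // h; rewrite fsfun_dflt.
pose mv : mon := [fsfun w in [fset v]%fset => m w].
have mvE w : mv w = if w == v then m w else 0%N.
  by rewrite fsfun_fun inE.
have em : madd mv mr = m.
  by apply: monP => w; rewrite maddE mvE mrE; case: eqP => // _; rewrite addn0.
rewrite pmulE (bigD1_seq (mv, mr)) ?decs_uniq ?mem_decs ?em //=.
rewrite big_seq_cond big1 ?addr0 => [|[a b] /=].
  have -> : line v f mv = f (m v); last by [].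
  rewrite line_coef mvE eqxx ifT //; apply/suppP => w wv.
  by rewrite mvE (negPf wv).
rewrite mem_decs /= => /andP[/eqP e ne].
have [bv|bv] := eqVneq (b v) 0%N; last by rewrite F0 ?mulr0.
rewrite line_coef; case: suppP => [av|_]; last by rewrite mul0r.
case/eqP: ne; congr pair; apply: monP => w.
  rewrite mvE -e maddE; case: eqP => [->|/eqP /av //]; by rewrite bv addn0.
by rewrite mrE -e maddE; case: eqP => [-> //|/eqP /av ->].
Qed.

End Lines.

Definition wx (n : nat) : {poly int} := if n is k.+1 then 'X * (1 + 'X) ^+ k else 1.
Definition wy (n : nat) : {poly int} := match n with 0 => 1 | 1 => 'X | _ => 0 end.
Definition wv (v : nat + nat) : nat -> {poly int} :=
  match v with inl _ => wx | inr _ => wy end.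

Lemma wv0 v : wv v 0 = 1. Proof. by case: v. Qed.

(* P(z) = prod_i (1 + y_i z) / (1 - z x_i / (1 - x_i)): each coefficient is a  *)
(* polynomial in z, because the factor of x_i is                               *)
(* 1 + sum_n z (1 + z)^(n-1) x_i^n. *)
Definition Pinf : ps {poly int} := fun m => \prod_(v <- finsupp m) wv v (m v).

Lemma Pinf_wide (s : seq (nat + nat)) (m : mon) : uniq s ->
  (forall v, m v != 0%N -> v \in s) -> Pinf m = \prod_(v <- s) wv v (m v).
Proof.
move=> us h; rewrite /Pinf [RHS](bigID (fun v => v \in finsupp m)) /= [X in _ = _ * X]big1 ?mulr1.
  rewrite -[RHS]big_filter; apply: perm_big; apply: uniq_perm; rewrite ?filter_uniq ?fset_uniq //.
  by move=> v; rewrite mem_filter; case vm : (v \in finsupp m) => //=;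
    rewrite h // -mem_finsupp.
by move=> v vm; rewrite fsfun_dflt // wv0.
Qed.

Definition phi (v : nat + nat) : ps {poly int} := line v (wv v).

Definition Pfin (s : seq (nat + nat)) : ps {poly int} := \prod_(v <- s) phi v.

Lemma PfinE s m : uniq s ->
  Pfin s m = if all (mem s) (finsupp m) then Pinf m else 0.
Proof.
elim: s m => [|v s IH] m.
  move=> _; rewrite /Pfin big_nil poneE; case: eqP => [->|m0].
    by rewrite /Pinf finsupp0 big_nil.
  case: allP => // h; case: m0; apply: monP => w; rewrite mon0E.
  by rewrite fsfun_dflt //; apply/negP => /h.
rewrite /= => /andP[vs us]; rewrite /Pfin big_cons line_mulE; last first.
  move=> n nv; rewrite -/(Pfin s) IH //; case: allP => // h.
  by have /= := h v; rewrite mem_finsupp nv (negPf vs) => /(_ isT).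
rewrite -/(Pfin s) IH //; set mr := [fsfun w in _ => _].
have mrE w : mr w = if w == v then 0%N else m w.
  rewrite fsfun_fun !inE; case: eqP => //= wv.
  by case: ifPn => // h; rewrite fsfun_dflt.
have -> : all (mem s) (finsupp mr) = all (mem (v :: s)) (finsupp m).
  apply/allP/allP => h w; rewrite mem_finsupp => mw.
    rewrite /= inE; case: eqP => //= wv; apply: h.
    by rewrite mem_finsupp mrE (introF eqP wv).
  have := h w; rewrite mem_finsupp; move: mw; rewrite mrE; case: (eqVneq w v) => // wv mw.
  by rewrite mw /= inE (negPf wv) => /(_ isT).
case: allP => [h|_]; last by rewrite mulr0.
have hs w : m w != 0%N -> w \in v :: s by rewrite -mem_finsupp => /h.
rewrite (@Pinf_wide (v :: s) m) //= ?vs // (@Pinf_wide s) //; last first.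
  by move=> w; rewrite mrE; case: (eqVneq w v) => // wv /hs; rewrite inE (negPf wv).
rewrite big_cons; congr (_ * _); rewrite big_seq [RHS]big_seq; apply: eq_bigr => w ws.
by rewrite mrE; case: eqP => // wv; move: vs; rewrite -wv ws.
Qed.

(** Replaces the infinite product by a finite one, whose factors can be cancelled one by one. *)
Lemma Pfin_agree s (m : mon) : uniq s -> (forall v, m v != 0%N -> v \in s) ->
  agree m (Pfin s) Pinf.
Proof.
move=> us h [a b] /= e; rewrite PfinE // ifT //; apply/allP => v.
rewrite mem_finsupp => av; apply: h; rewrite -e maddE; lia.
Qed.

Definition emb (A : ps int) : ps {poly int} := fun m => (A m)%:P.

Definition lcp (a k : int) (F : ps {poly int}) : ps int := fun m => lc a k (F m).

Section Lcp.
Implicit Types (F G : ps {poly int}) (A : ps int) (a k : int).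

Lemma lcpD a k F G : lcp a k (F + G) = lcp a k F + lcp a k G.
Proof. by apply/funext => m; rewrite paddE /lcp paddE raddfD. Qed.

Lemma lcpB a k F G : lcp a k (F - G) = lcp a k F - lcp a k G.
Proof. by apply/funext => m; rewrite !(paddE, poppE) /lcp !(paddE, poppE) raddfB. Qed.

Lemma lcp_emb a k A F : lcp a k (emb A * F) = A * lcp a k F.
Proof.
apply/funext => m; rewrite /lcp !pmulE raddf_sum /=.
by apply: eq_bigr => p _; rewrite lcC.
Qed.

Lemma lcpX a k F : lcp a k (psC 'X * F) = lcp a (k - 1) F.
Proof. by apply/funext => m; rewrite /lcp psC_mulE lcX. Qed.

Lemma lcp_rec a k F : lcp (a - 1) k F = lcp a k F + lcp a (k - 1) F.
Proof. by apply/funext => m; rewrite paddE /lcp lc_rec. Qed.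

Lemma lcp_agree m a k F G : agree m F G -> agree m (lcp a k F) (lcp a k G).
Proof. by move=> h p e; rewrite /lcp h. Qed.

End Lcp.

(** The series $X_i=x_i/(1-x_i)$. *)
Definition X (i : nat) : ps int := line (inl i) (fun n => (n != 0%N)%:R).
Definition x (i : nat) : ps int := mono int (U (inl i)).
Definition y (i : nat) : ps int := mono int (U (inr i)).

Lemma X_x i : (1 - x i) * (1 + X i) = 1.
Proof.
suff e : (1 - x i) * X i = x i by rewrite mulrDr mulr1 e subrK.
rewrite mulrBl mul1r /X /x line_shift lineN lineD mono_line; congr line.
by apply/funext => -[|[|n]] //=; rewrite ?subr0 ?subrr.
Qed.

Lemma emb_line v (f : nat -> int) : emb (line v f) = line v (fun n => (f n)%:P).
Proof. by apply/funext => m; rewrite /emb !line_coef; case: ifP. Qed.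

Lemma geometric_inverse (R : comNzRingType) (a b z f : R) :
  (1 - b) * a = b -> f - b * ((1 + z) * f) = 1 - b -> (1 + a) * (1 - b) = 1 ->
  (1 - a * z) * f = 1.
Proof.
move=> eX ephi inv.
have K : (1 - b) * ((1 - a * z) * f) = 1 - b.
  rewrite -[RHS]ephi.
  transitivity (f - b * f - (1 - b) * a * z * f); first by ring.
  by rewrite eX; ring.
by rewrite -[LHS]mul1r -[X in X * _ = _]inv -mulrA K inv.
Qed.

(** The coefficients [wx] satisfy $(1-x(1+z))\varphi=1-x$, and $1-x$ is invertible. *)
Lemma phi_x i : (1 - emb (X i) * psC 'X) * phi (inl i) = 1.
Proof.
set z := psC 'X; set X' := emb _; pose x' : ps {poly int} := mono {poly int} (U (inl i)).
have eX : (1 - x') * X' = x'.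
  rewrite mulrBl mul1r /X' /X emb_line /x' line_shift lineN lineD mono_line; congr line.
  by apply/funext => -[|[|n]] //=; rewrite ?subr0 ?subrr ?rmorph1.
have ephi : phi (inl i) - x' * (psC (1 + 'X) * phi (inl i)) = 1 - x'.
  rewrite -[1 in RHS](line1 _ (inl i)) /phi lineC /x' line_shift [X in _ = _ - X]mono_line.
  rewrite !lineN !lineD; congr line; apply/funext => -[|[|n]] /=.
  - by rewrite oppr0.
  - by rewrite expr0 !mulr1 opprD addrC subrK sub0r.
  - by rewrite mulrCA exprS subrr subr0.
have inv : (1 + X') * (1 - x') = 1 by rewrite mulrDl mul1r mulrC eX subrK.
rewrite rmorphD rmorph1 -/z in ephi.
exact: geometric_inverse eX ephi inv.
Qed.

Lemma phi_y l : phi (inr l) = 1 + emb (y l) * psC 'X.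
Proof.
rewrite /y mono_line emb_line -[1](line1 _ (inr l)) mulrC lineC lineD /phi; congr line.
by apply/funext => -[|[|n]] /=; rewrite ?rmorph0 ?rmorph1 ?mulr0 ?mulr1 ?addr0 ?add0r.
Qed.

Lemma rdet_last (K : comNzRingType) n (R : nat -> nat -> K) :
  (forall j, (j < n)%N -> R n j = 0) -> R n n = 1 -> rdet n.+1 R = rdet n R.
Proof.
move=> h0 h1; rewrite /rdet (expand_det_row _ ord_max) (bigD1 ord_max) //= mxE h1 mul1r.
rewrite big1 ?addr0 => [|j jm]; last first.
  by rewrite mxE h0 ?mul0r //; have := ltn_ord j; move: jm; rewrite -val_eqE /=; lia.
rewrite /cofactor addnn -signr_odd odd_double mul1r; congr (\det _).
by apply/matrixP => i j; rewrite !mxE /= /bump ![(n <= nat_of_ord _)%N]leqNgt !ltn_ord.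
Qed.

Lemma rdet_trim (K : comNzRingType) n N (R : nat -> nat -> K) : (n <= N)%N ->
  (forall i j, (n <= i)%N -> (j <= i)%N -> R i j = (i == j)%:R) -> rdet N R = rdet n R.
Proof.
move=> nN h; elim: N nN => [|N IH]; first by rewrite leqn0 => /eqP ->.
rewrite leq_eqVlt => /orP[/eqP <- //|nN].
rewrite rdet_last ?IH // => [j jN|]; rewrite h ?eqxx // ?(ltnW jN) //.
by rewrite gtn_eqF.
Qed.

(** * Determinants in the coefficients of P(z), with finitely many variables *)

Section PowerSeriesFormula.

Lemma lcp_one_gt (a k : int) : - a < k -> lcp a k 1 = 0.
Proof.
move=> h; apply/funext => m; rewrite /lcp poneE pzeroE; case: eqP => _; last exact: raddf0.
by rewrite lc_gt // size_poly1; lia.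
Qed.

Lemma lcp_one (k : int) : lcp 0 k 1 = (k == 0)%:R.
Proof.
apply/funext => m; have -> : ((k == 0)%:R : ps int) m = if k == 0 then (m == mon0)%:R else 0.
  by case: (k == 0); rewrite ?mulr1n ?mulr0n ?poneE ?pzeroE.
rewrite /lcp poneE; case: (m == mon0); last by rewrite raddf0; case: ifP.
rewrite /lc size_poly1 big_ord1 coef1 mul1r subr0 /=.
by case: eqP.
Qed.

Lemma lcp0_neg (k : int) F : k < 0 -> lcp 0 k F = 0.
Proof.
move=> h; apply/funext => m; rewrite /lcp pzeroE /lc big1 // => i _.
by rewrite /=; case: eqP => [|_]; rewrite ?mulr0 //; lia.
Qed.

Lemma lcp_phi_x (a k : int) i Q :
  lcp a k (phi (inl i) * Q) = lcp a k Q + X i * lcp a (k - 1) (phi (inl i) * Q).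
Proof.
rewrite -lcpX -lcp_emb -lcpD; congr (lcp _ _ _).
rewrite -[Q in Q + _]mul1r -(phi_x i).
by move: (emb (X i)) (psC 'X) (phi (inl i)) => u v w; ring.
Qed.

Lemma lcp_phi_y (a k : int) l Q :
  lcp a k (phi (inr l) * Q) = lcp a k Q + y l * lcp a (k - 1) Q.
Proof.
by rewrite phi_y mulrDl mul1r lcpD -mulrA lcp_emb lcpX.
Qed.

Lemma lcp_y_gt (a k : int) (s : seq nat) : (size s)%:Z - a < k ->
  lcp a k (\prod_(l <- s) phi (inr l)) = 0.
Proof.
elim: s k => [|l s IH] k h; first by rewrite big_nil lcp_one_gt //; move: h => /=; lia.
by rewrite big_cons lcp_phi_y !IH ?mulr0 ?addr0 //; move: h => /=; lia.
Qed.

(** By [lcp_rec] and [lcp_phi_x], the value for [a] is that for [a.+1] times $1+X_i=1/(1-x_i)$. *)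
Lemma lcp_phi_top (a : nat) i : lcp a (- a%:Z) (phi (inl i)) = (1 - x i) ^+ a.
Proof.
elim: a => [|a IH].
  by rewrite expr0 oppr0 -[phi _]mulr1 lcp_phi_x lcp_one lcp0_neg ?mulr0 ?addr0.
have := lcp_rec a.+1 (- a%:Z) (phi (inl i)).
have -> : a.+1%:Z - 1 = a by lia.
have -> : - a%:Z - 1 = - a.+1%:Z by lia.
rewrite IH -[in X in _ = X + _](mulr1 (phi _)) lcp_phi_x lcp_one_gt; last by lia.
have -> : - a%:Z - 1 = - a.+1%:Z by lia.
rewrite add0r mulr1 exprS => ->.
have := X_x i; move: (x i) (X i) (lcp _ _ _) => u v w e.
transitivity ((1 - u) * (1 + v) * w); first by rewrite e mul1r.
by ring.
Qed.

(** In this degree the $y$-factors behave as if taken at the pole $z=1/X_i$: multiplication by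
    $1+y_lz$, with the degree raised by one, amounts to multiplication by $X_i+y_l$. *)
Lemma lcp_phi_xy (a : nat) i (s : seq nat) (k : int) : k = (size s)%:Z - a%:Z ->
  lcp a k (phi (inl i) * \prod_(l <- s) phi (inr l)) =
  (1 - x i) ^+ a * \prod_(l <- s) (X i + y l).
Proof.
elim: s k => [|l s IH] k ->; first by rewrite !big_nil !mulr1 sub0r lcp_phi_top.
rewrite big_cons mulrCA lcp_phi_y lcp_phi_x lcp_y_gt; last by move=> /=; lia.
rewrite !IH; [|rewrite /=; lia..].
rewrite big_cons add0r -mulrDl [RHS]mulrCA; congr (_ * _).
Qed.

Lemma lcp_foldr_bdiff (a j k : int) (xs : seq (ps int)) (Q : ps {poly int}) :
  foldr (@bdiff (ps int)) (fun k => lcp a (k - j) Q) xs k =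
  lcp a (k - j) (\prod_(t <- xs) (1 - emb t * psC 'X) * Q).
Proof.
elim: xs k => [|t xs IH] k /=; first by rewrite big_nil mul1r.
rewrite /bdiff !IH big_cons -mulrA mulrBl mul1r lcpB -mulrA lcp_emb lcpX.
by congr (_ - _ * lcp _ _ _); ring.
Qed.

Definition vars_xy (N M : nat) : seq (nat + nat) :=
  [seq inl i | i <- iota 0 N] ++ [seq inr l | l <- iota 0 M].

Lemma vars_xy_uniq N M : uniq (vars_xy N M).
Proof.
rewrite cat_uniq !map_inj_uniq ?iota_uniq; try by move=> ? ? [].
by rewrite andbT /=; apply/hasPn => v /mapP[l _ ->]; apply/negP => /mapP[].
Qed.

Lemma mem_vars_xy N M v : (v \in vars_xy N M) =
  match v with inl i => (i < N)%N | inr l => (l < M)%N end.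
Proof.
rewrite mem_cat; case: v => v.
  rewrite mem_map ?mem_iota //; last by move=> ? ? [].
  by rewrite [X in _ || X](_ : _ = false) ?orbF //; apply/negP => /mapP[].
rewrite [X in _ || X]mem_map ?mem_iota //; last by move=> ? ? [].
by rewrite [X in X || _](_ : _ = false) //; apply/negP => /mapP[].
Qed.

Lemma cancel_others N (i : 'I_N) :
  \prod_(t <- others (fun i : 'I_N => X i) i) (1 - emb t * psC 'X)
    * \prod_(l <- iota 0 N) phi (inl l) = phi (inl (nat_of_ord i)).
Proof.
have -> : \prod_(l <- iota 0 N) phi (inl l) = \prod_(l < N) phi (inl (nat_of_ord l)).
  by rewrite -(big_mkord xpredT (fun l => phi (inl l))) /index_iota subn0.
rewrite (bigD1 i) //= mulrCA.
rewrite /others big_map big_filter big_enum_cond /= -big_split /=.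
by rewrite big1 ?mulr1 // => l _; rewrite phi_x.
Qed.

Lemma Pfin_vars N M : Pfin (vars_xy N M) =
  \prod_(i <- iota 0 N) phi (inl i) * \prod_(l <- iota 0 M) phi (inr l).
Proof. by rewrite /Pfin big_cat !big_map. Qed.

(** Row [j] sees only $N$ of the $x$'s and $\lambda_j+N-1-j$ of the $y$'s. With these flags the
    determinant equals the Grothendieck polynomial itself, before any limit. *)
Definition flagged N (la : intpart) (j r : nat) : ps int :=
  lcp (nth 0%N la j) (r%:Z - j%:Z) (Pfin (vars_xy N (shifted N la j))).

Lemma det_flagged N (la : intpart) : (size la <= N)%N ->
  rdet N (flagged N la) * \det (Emx (fun i : 'I_N => X i)) =
  \det (\matrix_(j < N, i < N) ((1 - x i) ^+ nth 0%N la j *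
     \prod_(l <- iota 0 (shifted N la j)) (X i + y l))).
Proof.
move=> lN; pose C (j : nat) (k : int) :=
  lcp (nth 0%N la j) (k - j%:Z) (Pfin (vars_xy N (shifted N la j))).
rewrite (@det_Emx _ N _ C); congr (\det _); apply/matrixP => j i; rewrite !mxE.
rewrite lcp_foldr_bdiff Pfin_vars mulrA cancel_others.
by rewrite lcp_phi_xy // size_iota /shifted; have := ltn_ord j; lia.
Qed.

End PowerSeriesFormula.

Definition unit_const (Q : ps {poly int}) : Prop := forall m, (Q m)`_0 = (m == mon0)%:R.

Lemma lcp_nonpos (a k : int) Q : unit_const Q -> a <= 0 -> k <= 0 ->
  lcp a k Q = (k == 0)%:R.
Proof.
move=> h a0 k0; apply/funext => m.
have -> : ((k == 0)%:R : ps int) m = if k == 0 then (m == mon0)%:R else 0.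
  by case: (k == 0); rewrite ?mulr1n ?mulr0n ?poneE ?pzeroE.
by rewrite /lcp lc_nonpos // h; case: (k == 0); rewrite ?mulr1 ?mulr0.
Qed.

Lemma Pinf_unit_const : unit_const Pinf.
Proof.
move=> m; rewrite /Pinf; case: eqP => [->|m0].
  by rewrite finsupp0 big_nil coef1.
have [v vm] : exists v, m v != 0%N.
  apply: contrapT => h; apply: m0; apply: monP => v; rewrite mon0E.
  by apply/eqP; apply/negPn/negP => mv; apply: h; exists v.
rewrite (big_rem v) ?mem_finsupp //= coef0M.
suff -> : (wv v (m v))`_0 = 0 by rewrite mul0r.
case: v vm => v /=; case: (m _) => [|[|n]] //= _; rewrite ?coefX ?coef0 //.
  by rewrite expr0 mulr1 coefX.
by rewrite coef0M coefX mul0r.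
Qed.

Lemma Pfin_unit_const s : uniq s -> unit_const (Pfin s).
Proof.
move=> us m; rewrite PfinE //; case: allP => h; first exact: Pinf_unit_const.
rewrite coef0; case: eqP => // m0; case: h => v; rewrite m0 finsupp0.
by rewrite in_fset0.
Qed.

(** Below the length of $\lambda$ the rows are unitriangular, by [lcp_nonpos]. *)
Lemma flagged_trim N (la : intpart) : (size la <= N)%N ->
  rdet N (flagged N la) = rdet (size la) (flagged N la).
Proof.
move=> lN; apply: rdet_trim => // j r lj rj; rewrite /flagged nth_default // lcp_nonpos //.
- by congr (nat_of_bool _)%:R; apply/eqP/eqP; lia.
- by apply: Pfin_unit_const; exact: vars_xy_uniq.
- by lia.
Qed.

(** * Determinantal formula for the stable Grothendieck series *)

Section PolyToSeries.
Variables (n : nat) (pv : 'I_n -> nat + nat).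
Hypothesis pvI : injective pv.

Definition io_gen (f : {mpoly int[n]}) : ps int :=
  mmap (@psC int) (fun k => mono int (U (pv k))) f.

Lemma io_gen_is_zmod_morphism : zmod_morphism io_gen.
Proof. by move=> f g; rewrite /io_gen raddfB. Qed.

Lemma io_gen_is_monoid_morphism : monoid_morphism io_gen.
Proof.
split=> [|f g]; rewrite /io_gen.
  exact: (rmorph1 (mmap (@psC int) _)).
exact: (rmorphM (mmap (@psC int) _)).
Qed.

HB.instance Definition _ := GRing.isZmodMorphism.Build {mpoly int[n]} (ps int) io_gen
  io_gen_is_zmod_morphism.
HB.instance Definition _ := GRing.isMonoidMorphism.Build {mpoly int[n]} (ps int) io_gen
  io_gen_is_monoid_morphism.

Lemma io_gen_var k : io_gen 'X_k = mono int (U (pv k)).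
Proof. by rewrite /io_gen mmapX mmap1U. Qed.

Lemma prod_mono (mm : 'X_{1..n}) (r : seq 'I_n) :
  exists2 a : mon, \prod_(k <- r) mono int (U (pv k)) ^+ mm k = mono int a &
    forall v, a v = (\sum_(k <- r) mm k * (pv k == v))%N.
Proof.
elim: r => [|k r [a e h]].
  by exists mon0 => [|v]; rewrite big_nil ?mono0 // mon0E.
have [b eb hb] : exists2 b : mon, mono int (U (pv k)) ^+ mm k = mono int b &
    forall v, b v = (mm k * (pv k == v))%N.
  elim: (mm k) => [|d [b eb hb]].
    by exists mon0 => [|v]; rewrite ?expr0 ?mono0 // mon0E.
  exists (madd (U (pv k)) b) => [|v]; first by rewrite exprS eb monoM.
  by rewrite maddE UE hb eq_sym mulSn.
exists (madd b a) => [|v]; first by rewrite big_cons e eb monoM.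
by rewrite big_cons maddE hb h.
Qed.

Lemma io_gen_coef (f : {mpoly int[n]}) (m : mon) :
  (forall v, m v != 0%N -> exists k, v = pv k) ->
  (io_gen f) m = f@_[multinom m (pv k) | k < n].
Proof.
move=> hm; rewrite /io_gen /mmap psumE; set tm := [multinom _ | k < n].
have E mm : (psC f@_mm * mmap1 (fun k => mono int (U (pv k))) mm : ps int) m =
    f@_mm * (mm == tm)%:R.
  rewrite psC_mulE; congr (_ * _); rewrite /mmap1.
  have [a -> ha] := prod_mono mm (index_enum 'I_n).
  have av k : a (pv k) = mm k.
    rewrite ha (bigD1 k) //= eqxx muln1 big1 ?addn0 // => l lk.
    by rewrite (inj_eq pvI) (negPf lk) muln0.
  have tv k : tm k = m (pv k) by rewrite mnmE.
  rewrite mono_coef; congr (nat_of_bool _)%:R; apply/eqP/eqP => [e|e].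
    by apply/mnmP => k; rewrite tv -av e.
  apply: monP => v; have [[k ->]|nk] := pselect (exists k, v = pv k).
    by rewrite av e tv.
  rewrite ha big1 => [|k _].
    by apply/eqP; apply: contrapT => /negP /hm.
  by case: eqP => [e'|]; rewrite ?muln0 //; case: nk; exists k.
under eq_bigr do rewrite E.
have [h|h] := boolP (tm \in msupp f).
  rewrite (bigD1_seq _ h) ?msupp_uniq //= eqxx mulr1 big1 ?addr0 // => mm /negPf ->.
  by rewrite mulr0.
rewrite big_seq big1 => [|mm mms]; first by rewrite memN_msupp_eq0.
by case: eqP => [e|]; rewrite ?mulr0 //; rewrite e (negPf h) in mms.
Qed.

End PolyToSeries.

Section DoublePolyToSeries.
Variable M : nat.

Definition pvar (k : 'I_(M + M)) : nat + nat :=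
  match fintype.split k with inl i => inl (val i) | inr i => inr (val i) end.

Lemma pvar_inj : injective pvar.
Proof.
move=> i j; rewrite /pvar; case: split_ordP => a ->; case: split_ordP => b -> //.
  by move=> [/val_inj ->].
by move=> [/val_inj ->].
Qed.

Definition io (f : {mpoly int[M + M]}) : ps int := io_gen pvar f.

HB.instance Definition _ := GRing.RMorphism.copy io (io_gen pvar).

Lemma ioM f g : io (f * g) = io f * io g. Proof. exact: rmorphM. Qed.
Lemma ioD f g : io (f + g) = io f + io g. Proof. exact: rmorphD. Qed.
Lemma ioB f g : io (f - g) = io f - io g. Proof. exact: rmorphB. Qed.
Lemma io1 : io 1 = 1. Proof. exact: rmorph1. Qed.
Lemma io_exp f k : io (f ^+ k) = io f ^+ k. Proof. exact: rmorphXn. Qed.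
Lemma io_prod (I : Type) (r : seq I) (P : pred I) (F : I -> {mpoly int[M + M]}) :
  io (\prod_(i <- r | P i) F i) = \prod_(i <- r | P i) io (F i).
Proof. exact: rmorph_prod. Qed.

Lemma io_xv i : io (xv i) = x i.
Proof. by rewrite /io /xv io_gen_var /pvar (unsplitK (inl _)). Qed.

Lemma io_yv i : io (yv i) = y i.
Proof. by rewrite /io /yv io_gen_var /pvar (unsplitK (inr _)). Qed.

Lemma io_coef (f : {mpoly int[M + M]}) (m : mon) :
  (forall v, m v != 0%N -> v \in vars_xy M M) -> (io f) m = f@_(mon_trunc M m).
Proof.
move=> hm; rewrite /io io_gen_coef //; first last.
- move=> v /hm; rewrite mem_vars_xy; case: v => v vM.
    by exists (lshift M (Ordinal vM)); rewrite /pvar (unsplitK (inl _)).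
  by exists (rshift M (Ordinal vM)); rewrite /pvar (unsplitK (inr _)).
- exact: pvar_inj.
by congr (_@__); apply/mnmP => k; rewrite !mnmE /pvar; case: (fintype.split k).
Qed.

End DoublePolyToSeries.

Lemma x_X i : x i = (1 - x i) * X i.
Proof.
have e := X_x i; rewrite mulrDr mulr1 in e.
by apply: (addrI (1 - x i)); rewrite subrK e.
Qed.

(** From $x_iA=x_jA$, the coefficient of a monomial equals one in which the exponent of $x_j$ is
    smaller by one and that of $x_i$ larger; at exponent 0 of $x_j$ it vanishes. *)
Lemma x_sub_reg (i j : nat) (A : ps int) : i != j -> (x i - x j) * A = 0 -> A = 0.
Proof.
move=> ij; rewrite mulrBl => /eqP; rewrite subr_eq0 => /eqP e.
have coef m : A m = (x j * A) (madd (U (inl i)) m).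
  by rewrite -e /x (mono_mulE (U (inl i)) A m).
have Uj : U (inl i) (inl j) = 0%N.
  by rewrite UE (inj_eq (@inl_inj _ _)) eq_sym (negPf ij).
suff H n : forall m : mon, m (inl j) = n -> A m = 0.
  by apply/funext => m; rewrite pzeroE (H (m (inl j))).
elim: n => [|n IH] m mj.
  rewrite coef; apply: mono_mulN => n en.
  have := congr1 (fun a : mon => a (inl j)) en.
  by rewrite !maddE Uj UE eqxx mj.
have [m' em] : exists m', m = madd (U (inl j)) m'.
  exists [fsfun v in finsupp m => if v == inl j then n else m v].
  apply: monP => v; rewrite maddE UE fsfun_fun mem_finsupp.
  case: (eqVneq v (inl j)) => [->|vj]; first by rewrite mj.
  by case: (eqVneq (m v) 0%N).
have mj' : m' (inl j) = n.
  have := congr1 (fun a : mon => a (inl j)) em.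
  by rewrite /= mj maddE UE eqxx add1n => /eq_add_S ->.
have -> : A m = A (madd (U (inl i)) m').
  by rewrite coef em maddA (maddC (U (inl i))) -maddA /x (mono_mulE (U (inl j))).
by apply: IH; rewrite maddE Uj.
Qed.

Lemma sub1_sub1 (R : comNzRingType) (u v : R) : (1 - v) - (1 - u) = u - v.
Proof. by ring. Qed.

Lemma vandermonde_reg N (A : ps int) :
  \det (\matrix_(j < N, i < N) (1 - x i) ^+ j) * A = 0 -> A = 0.
Proof.
have -> : \matrix_(j < N, i < N) (1 - x i) ^+ j =
    Vandermonde N (\row_(i < N) (1 - x i)).
  by apply/matrixP => j i; rewrite !mxE.
rewrite det_Vandermonde.
suff H (r : seq ('I_N * 'I_N)) : (forall p, p \in r -> (p.1 < p.2)%N) ->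
    \prod_(p <- r) ((1 - x p.2) - (1 - x p.1)) * A = 0 -> A = 0.
  under eq_bigr => i _ do under eq_bigr => j _ do rewrite !mxE.
  rewrite pair_big_dep /= -big_filter => h; apply: H h => p.
  by rewrite mem_filter => /andP[].
elim: r => [|p r IH] h; first by rewrite big_nil mul1r.
rewrite big_cons -mulrA => e; apply: IH => [q qr|]; first by apply: h; rewrite inE qr orbT.
have := h p (mem_head _ _) => pp.
apply: (@x_sub_reg p.1 p.2); first by rewrite neq_ltn pp.
by rewrite (sub1_sub1 (x p.1) (x p.2)) in e.
Qed.

(** Since $x=(1-x)X$, one has $x+y-xy=(1-x)(X+y)$. In row [j] the powers of $1-x_i$ then add up to
    $\lambda_j+N-1$ on both sides. *)
Lemma io_det_numer N M (h : (N <= M)%N) (la : intpart) : (size la <= N)%N ->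
  (forall j, (j < N)%N -> (shifted N la j <= M)%N) ->
  io (\det (numer h (shifted N la))) =
  rdet (size la) (flagged N la) *
   (\det (Emx (fun i : 'I_N => X i)) * \prod_(i < N) (1 - x i) ^+ N.-1).
Proof.
move=> lN hM.
rewrite -flagged_trim // mulrA det_flagged // -det_map_mx.
have -> : \prod_(i < N) (1 - x i) ^+ N.-1 =
    \det (diag_mx (\row_(i < N) (1 - x i) ^+ N.-1)).
  by rewrite det_diag; apply: eq_bigr => i _; rewrite mxE.
rewrite -det_mulmx; congr (\det _); apply/matrixP => j i.
rewrite mul_mx_diag /numer !mxE -[X in X = _]/(io _) ioM io_exp ioB io1 io_xv io_prod.
rewrite (big_ord_narrow (hM j (ltn_ord j))) /=.
have -> : \prod_(l <- iota 0 (shifted N la j)) (X i + y l) =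
    \prod_(l < shifted N la j) (X i + y l).
  by rewrite -(big_mkord xpredT (fun l => X i + y l)) /index_iota subn0.
under eq_bigr => l _.
  have -> : io (xy (wid h i) (widen_ord (hM j (ltn_ord j)) l)) =
      (1 - x i) * (X i + y l).
    rewrite /xy ioB ioD ioM io_xv !io_yv /= mulrDr -x_X.
    by move: (x i) (y l) => u v; ring.
  over.
rewrite big_split /= prodr_const card_ord mulrA -exprD [RHS]mulrAC -exprD.
by congr (_ ^+ _ * _); rewrite /shifted; have := ltn_ord j; lia.
Qed.

(** Both sides agree after multiplication by the Vandermonde determinant in the $1-x_i$, which is
    not a zero divisor. *)
Lemma io_groth (la : intpart) k (w : 'S_(size la + head 0%N la)) : is_grassmannian w ->
  io (dgroth (shift_perm k w)) = rdet (size la) (flagged (k + size la) la).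
Proof.
move=> gw; set N := (k + size la)%N; set M := (k + (size la + head 0 la))%N.
have h : (N <= M)%N by rewrite /N /M; lia.
have hM mu j : (mu <= head 0 la)%N -> (j < N)%N -> (mu + (N.-1 - j) <= M)%N.
  by rewrite /N /M; lia.
have V := groth_grassmannian gw h.
(* The identity permutation, with the empty partition, gives the Vandermonde determinant as exactly
   the factor that accompanies the flagged determinant in [io_det_numer]. *)
have V0 : dgroth (1%g : 'S_M) * \det (\matrix_(j < N, i < N) (1 - xv (wid h i)) ^+ j) =
    \det (numer h (shifted N (ones 0))).
  apply: grassmannian_dgroth.
  - by move=> i j _ ij _; rewrite !perm1.
  - by move=> i j _ ij _; rewrite !perm1.
  by move=> a l aN e; rewrite perm1 e /shifted nth_nil /=; lia.
have := congr1 (@io M) V; have := congr1 (@io M) V0.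
have lN : (size la <= N)%N by rewrite /N; lia.
have h1 j : (j < N)%N -> (shifted N la j <= M)%N.
  by move=> jN; apply: hM => //; exact: part_le_head.
have h0 j : (j < N)%N -> (shifted N (ones 0) j <= M)%N.
  by move=> jN; apply: hM => //; rewrite nth_nil.
rewrite groth_one mul1r ioM (io_det_numer h (la := ones 0) _ h0) //.
rewrite (io_det_numer h lN h1).
rewrite [rdet (size (ones 0)) _]det_mx00 mul1r => <- e.
apply/eqP; rewrite -subr_eq0; apply/eqP; apply: (@vandermonde_reg N).
have -> : \det (\matrix_(j < N, i < N) (1 - x i) ^+ j) =
    io (\det (\matrix_(j < N, i < N) (1 - xv (wid h i)) ^+ j)).
  rewrite -det_map_mx; congr (\det _); apply/matrixP => j i.
  by rewrite !mxE -[X in _ = X]/(io _) io_exp ioB io1 io_xv.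
by rewrite mulrBr mulrC e [X in _ - X]mulrC subrr.
Qed.

(* [z^k] of (1 + z)^(-a) P(z), expanded at z = oo; G_I turns out to be the     *)
(* determinant [Fser] of the coefficients [z^(j-i)] (1 + z)^(-I_i) P(z). *)
Definition cc (a k : int) : ps int := lcp a k Pinf.

Definition crow (i : nat) (a : int) (j : nat) : ps int := cc a (j%:Z - i%:Z).

Definition Fser (s : seq int) : ps int := sdet crow (size s) s.

Lemma mon_bounded (m : mon) : exists B, forall N M v,
  (B <= N)%N -> (B <= M)%N -> m v != 0%N -> v \in vars_xy N M.
Proof.
pose b (v : nat + nat) := match v with inl i => i.+1 | inr i => i.+1 end.
exists (\max_(v <- finsupp m) b v) => N M v BN BM mv.
have bv : (b v <= \max_(v <- finsupp m) b v)%N.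
  by rewrite (big_rem v) ?mem_finsupp //= leq_maxl.
rewrite mem_vars_xy; move: (\max_(v <- _) _) BN BM bv => B BN BM.
by case: v {mv} => i /= bv; lia.
Qed.

(** For [k] large, the flags of all rows contain every variable of the monomial [m], so [Pfin] may
    be replaced by [Pinf]. *)
Lemma GpartE la : Gpart la = Fser (seq_of_part la).
Proof.
apply/funext => m; rewrite /Gpart.
have gw : is_grassmannian (la := la) (xget 1%g [set w | is_grassmannian (la := la) w]).
  have [w hw] := grassmannian_exists la.
  exact: (@xgetI _ 1%g [set w | is_grassmannian (la := la) w] w hw).
move: (xget _ _) gw => w gw.
have [B hB] := mon_bounded m.
have lim k : (B <= k)%N -> (dgroth (shift_perm k w))
    @_(mon_trunc (k + (size la + head 0%N la)) m) = Fser (seq_of_part la) m.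
  move=> Bk; rewrite -io_coef; last by move=> v mv; apply: hB => //; lia.
  rewrite io_groth // /Fser size_map; apply: agreeE; apply: agree_det => i j.
  rewrite !mxE /flagged /crow nth_seq_of_part; apply: lcp_agree.
  apply: Pfin_agree; first exact: vars_xy_uniq.
  by move=> v mv; apply: hB => //; rewrite /shifted; have := ltn_ord i; lia.
rewrite /stable_groth; apply: xget_unique => [|c [k0 hc]].
  by exists B.
by rewrite -(hc (maxn k0 B)) ?leq_maxl // lim // leq_maxr.
Qed.

(** * Straightening relations for the series determinants *)

Section GenericF.
Variables (K : comNzRingType) (c : int -> int -> K).
Hypothesis c_rec : forall a k, c (a - 1) k = c a k + c a (k - 1).
Hypothesis c_nonpos : forall a k, a <= 0 -> k <= 0 -> c a k = (k == 0)%:R.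

Definition Frow (i : nat) (a : int) (j : nat) : K := c a (j%:Z - i%:Z).
Definition Fgen (s : seq int) : K := sdet Frow (size s) s.

Lemma FrowP i (p : int) j : Frow i (p - 1) j = Frow i p j + 1 * Frow i.+1 p j.
Proof. by rewrite /Frow c_rec mul1r; congr (_ + c _ _); lia. Qed.

Lemma Fgen_rcons (s : seq int) (p : int) : p <= 0 -> Fgen (rcons s p) = Fgen s.
Proof.
move=> p0; rewrite /Fgen size_rcons /sdet rdet_last => [|j js|].
- by apply: eq_rdet => i j il _; rewrite nth_rcons il.
- by rewrite nth_rcons ltnn eqxx /Frow c_nonpos //; [case: eqP => //; lia | lia].
- by rewrite nth_rcons ltnn eqxx /Frow c_nonpos // subrr.
Qed.

(** The entries are abstract because this is applied to [cc] and, with one more $y$-variable, to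
    [cX]. *)
Lemma straightens_Fgen (f : K -> int) :
  (forall u v, f (u - v) = f u - f v) -> straightens_all (fun s => f (Fgen s)).
Proof.
move=> fB n; have f0 : f 0 = 0 by rewrite -(subrr 0) fB subrr.
have fN u : f (- u) = - f u by rewrite -[- u]sub0r fB f0 sub0r.
have fD u v : f (u + v) = f u + f v by rewrite -[v in LHS]opprK fB fN opprK.
split=> [s1 s2 p q _ _|s p p0 _]; last by rewrite Fgen_rcons.
rewrite -fB -fD; congr f; rewrite /Fgen.
rewrite (sdet_swap FrowP); last by rewrite size_cat /=; lia.
by rewrite !size_cat.
Qed.

End GenericF.

(** * Laplace expansion and complementary minors *)

Section Laplace.
Variable K : comNzRingType.
Implicit Types (b : nat -> nat -> K) (r : nat -> K).

Definition minor_row (l : nat) b (q : nat) : K := rdet l (fun i k => b i (bump q k)).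

Lemma laplace_first l b r :
  rdet l.+1 (fun i j => if i is i'.+1 then b i' j else r j) =
  \sum_(q < l.+1) (-1) ^+ q * r q * minor_row l b q.
Proof.
rewrite /rdet (expand_det_row _ ord0); apply: eq_bigr => q _.
rewrite mxE /cofactor /= add0n mulrA [r q * _]mulrC; congr (_ * \det _).
by apply/matrixP => i k; rewrite !mxE.
Qed.

(** Border the rows of [b] by a first row $((-Y)^j)_j$. Adding to each column $Y$ times its left
    neighbour turns the border into $(1,0,\dots,0)$ and the minor below it into the left side;
    expanding the bordered determinant before and after gives the identity. *)
Lemma rdet_shift l b (Y : K) :
  rdet l (fun i j => b i j.+1 + Y * b i j) = \sum_(q < l.+1) Y ^+ q * minor_row l b q.
Proof.
pose A : 'M[K]_l.+1 := \matrix_(i < l.+1, j < l.+1)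
  (if (i : nat) is i'.+1 then b i' j else (- Y) ^+ j).
pose T : 'M[K]_l.+1 := \matrix_(i < l.+1, j < l.+1)
  ((i == j)%:R + Y * ((i.+1 == j)%N)%:R).
have detA : \det A = \sum_(q < l.+1) Y ^+ q * minor_row l b q.
  rewrite -/(rdet l.+1 (fun i j => if i is i'.+1 then b i' j else (- Y) ^+ j)).
  rewrite laplace_first; apply: eq_bigr => q _; congr (_ * _).
  by rewrite -exprMn mulN1r opprK.
have detT : \det T = 1.
  rewrite -det_tr det_trig.
    rewrite big1 // => i _; rewrite !mxE eqxx.
    by rewrite [(i.+1 == i :> nat)]gtn_eqF // mulr0 addr0.
  apply/is_trig_mxP => i j ij; rewrite !mxE.
  rewrite (_ : (j == i) = false); last by apply/negbTE; rewrite -val_eqE /=; lia.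
  by rewrite (_ : (j.+1 == i :> nat) = false) ?mulr0 ?addr0 //; lia.
have AT (i k : 'I_l.+1) : (A *m T) i k =
    A i k + Y * (if (k : nat) is k'.+1 then A i (inord k') else 0).
  rewrite mxE; under eq_bigr do rewrite [T _ _]mxE mulrDr.
  rewrite big_split /=; congr (_ + _).
    rewrite (bigD1 k) //= eqxx mulr1 big1 ?addr0 // => j /negPf ->.
    by rewrite mulr0.
  case: k => [[|k] kl] /=.
    by rewrite mulr0 big1 // => j _; rewrite !mulr0.
  have kl' : (k < l.+1)%N by apply: ltnW.
  rewrite (bigD1 (inord k)) //= inordK // eqxx mulr1 mulrC big1 ?addr0 // => j jk.
  rewrite eqSS (_ : (j == k :> nat) = false) ?mulr0 //.
  by apply/negbTE; apply: contra jk => /eqP jk; apply/eqP/val_inj; rewrite /= inordK.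
rewrite -detA -[RHS]mulr1 -detT -det_mulmx.
pose r (k : nat) : K := (k == 0)%:R.
have -> : A *m T = \matrix_(i < l.+1, j < l.+1)
    (if (i : nat) is i'.+1 then b i' j + Y * (if (j : nat) is j'.+1 then b i' j' else 0)
     else r j).
  apply/matrixP => i k; rewrite AT !mxE; case: i => [[|i] il] /=; last first.
    by case: k => [[|k] kl] //=; rewrite mxE /= inordK // ltnW.
  case: k => [[|k] kl] /=; first by rewrite expr0 mulr0 addr0.
  by rewrite mxE /= inordK ?(ltnW kl) // exprS mulNr addNr.
pose b' i j := b i j + Y * (if j is j'.+1 then b i j' else 0).
rewrite -/(rdet l.+1 (fun i j => if i is i'.+1 then b' i' j else r j)).
rewrite laplace_first big_ord_recl /= expr0 !mul1r big1 ?addr0 // => i _.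
by rewrite /r /= mulr0 mul0r.
Qed.

End Laplace.

Definition cols (s : seq int) (i j : nat) : ps int := cc (nth 0 s i) (j%:Z - i.+1%:Z).

(* G_{I // (1^q)}, which also is the complementary minor of the q-th entry in  *)
(* the first row of the determinant of G_{a,I}. *)
Definition minor (s : seq int) (q : nat) : ps int := minor_row (size s) (cols s) q.

Lemma cc_rec (a k : int) : cc (a - 1) k = cc a k + cc a (k - 1).
Proof. exact: lcp_rec. Qed.

Lemma cc_nonpos (a k : int) : a <= 0 -> k <= 0 -> cc a k = (k == 0)%:R.
Proof. by move=> a0 k0; apply: lcp_nonpos => //; exact: Pinf_unit_const. Qed.

Lemma Fser_cons (a : int) s :
  Fser (a :: s) = \sum_(q < (size s).+1) (-1) ^+ q * cc a q%:Z * minor s q.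
Proof.
rewrite -(laplace_first (size s) (cols s) (fun q => cc a q%:Z)).
by apply: eq_rdet => -[|i] j _ _; rewrite /crow /cols //= subr0.
Qed.

Lemma minor0 s : minor s 0 = Fser s.
Proof.
by apply: eq_rdet => i j _ _; rewrite /cols /crow; congr cc; rewrite /bump /=; lia.
Qed.

(* Adding one y-variable with value ['X] turns [cc a k] into                   *)
(* [cc a k + 'X * cc a (k - 1)]. *)
Definition cX (a k : int) : {poly (ps int)} := (cc a k)%:P + 'X * (cc a (k - 1))%:P.

Lemma cX_rec (a k : int) : cX (a - 1) k = cX a k + cX a (k - 1).
Proof. by rewrite /cX !cc_rec !rmorphD /= mulrDr addrACA. Qed.

Lemma cX_nonpos (a k : int) : a <= 0 -> k <= 0 -> cX a k = (k == 0)%:R.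
Proof.
move=> a0 k0; rewrite /cX !cc_nonpos //; last by lia.
have -> : (k - 1 == 0) = false by lia.
by rewrite mulr0n rmorph0 mulr0 addr0 rmorph_nat.
Qed.

Lemma Fgen_cX s : Fgen cX s = \sum_(q < (size s).+1) 'X ^+ q * (minor s q)%:P.
Proof.
transitivity (rdet (size s) (fun i j => (cols s i j.+1)%:P + 'X * (cols s i j)%:P)).
  apply: eq_rdet => i j _ _; rewrite /Frow /cX /cols.
  by congr ((cc _ _)%:P + _ * (cc _ _)%:P); lia.
rewrite (rdet_shift _ (fun i j => (cols s i j)%:P)); apply: eq_bigr => q _; congr (_ * _).
rewrite /minor /minor_row /rdet -det_map_mx; congr (\det _).
by apply/matrixP => i j; rewrite !mxE.
Qed.

Lemma coef_Fgen_cX s q : (Fgen cX s)`_q = if (q <= size s)%N then minor s q else 0.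
Proof.
rewrite Fgen_cX coef_sum; case: ifPn => qs.
  rewrite (bigD1 (Ordinal (qs : (q < (size s).+1)%N))) //= coefXnM ltnn subnn coefC eqxx.
  rewrite big1 ?addr0 // => i iq; rewrite coefXnM coefC; case: ltnP => // qi.
  by case: eqP => // e; case/eqP: iq; apply: val_inj => /=; lia.
rewrite big1 // => i _; rewrite coefXnM coefC; case: ltnP => // _.
by case: eqP => // e; have := ltn_ord i; lia.
Qed.

(** For [q] beyond the size of [s] there is no column to delete, and the coefficient of $y_0^q$ is
    0. *)
Definition skew_col (s : seq int) (q : nat) : ps int :=
  if (q <= size s)%N then minor s q else 0.

(** The minor is a coefficient of the determinant [Fgen cX s], to which the relations apply. *)
Lemma straightens_skew_col q m : straightens_all (fun s => skew_col s q m).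
Proof.
have -> : (fun s => skew_col s q m) = (fun s => (Fgen cX s)`_q m).
  by apply/funext => s; rewrite coef_Fgen_cX.
apply: (straightens_Fgen cX_rec cX_nonpos (f := fun f => f`_q m)) => u v.
by rewrite coefB paddE poppE.
Qed.

Lemma straightens_Fser m : straightens_all (fun s => Fser s m).
Proof.
apply: (straightens_Fgen cc_rec cc_nonpos (f := fun F : ps int => F m)) => u v.
by rewrite paddE poppE.
Qed.

Lemma GseqE s : Gseq s = Fser s.
Proof.
apply/funext => m; rewrite (delta_sum s (straightens_Fser m)) /Gseq /ssum.
by apply: eq_fsbigr => la _; rewrite /sscale GpartE.
Qed.

Lemma GintE k : Gint k = cc k 0.
Proof. by rewrite /Gint GseqE /Fser /sdet /rdet det_mx11 mxE /crow /= subrr. Qed.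

(** Repeated use of [lc_rec], from [a + 1] down to [a]; the coefficients add by Pascal's rule, and
    the bound on [T] makes the remainder vanish by [lc_gt]. *)
Lemma lc_binomial (q T : nat) (a : int) (p : {poly int}) :
  (size p)%:Z <= a + q.+1%:Z + T%:Z ->
  lc a q.+1%:Z p = \sum_(t < T) ('C(q + t, t))%:Z * lc (a + q.+1%:Z + t%:Z) 0 p.
Proof.
elim: q T a => [|q IHq].
  elim=> [|T IHT] a h; first by rewrite big_ord0 lc_gt //; lia.
  have := lc_rec (a + 1) 1 p; rewrite addrK subrr => ->.
  rewrite big_ord_recl bin0 mul1r addr0 addrC; congr (_ + _).
  rewrite IHT; last by lia.
  by apply: eq_bigr => t _; rewrite !add0n !binn !mul1r; congr (lc _ _ _); rewrite /= /bump /=; lia.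
elim=> [|T IHT] a h; first by rewrite big_ord0 lc_gt //; lia.
have := lc_rec (a + 1) q.+2 p; rewrite addrK => ->.
have -> : q.+2%:Z - 1 = q.+1%:Z by lia.
rewrite IHT; last by lia.
rewrite (IHq T.+1); last by lia.
rewrite [X in _ + X = _]big_ord_recl [RHS]big_ord_recl !bin0 addrCA; congr (_ * lc _ _ _ + _).
  by lia.
rewrite -big_split; apply: eq_bigr => t _ /=.
have -> : a + 1 + q.+2%:Z + t%:Z = a + q.+2%:Z + (bump 0 t)%:Z by rewrite /bump /=; lia.
have -> : a + 1 + q.+1%:Z + (bump 0 t)%:Z = a + q.+2%:Z + (bump 0 t)%:Z by lia.
rewrite -mulrDl; congr (_ * _); rewrite -PoszD; congr Posz.
by rewrite /bump /= !add1n addSnnS [(q.+1 + t.+1)%N]addSn binS addnC.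
Qed.

(** * The coproduct *)

Section Interleaving.
Variable b : bool.

(* The variables x_b, x_{b+2}, ... carry the first monomial and the others the *)
(* second one. *)
Definition even_var (c : bool) (v : nat + nat) : nat + nat :=
  match v with inl i => inl (c + i.*2)%N | inr i => inr (c + i.*2)%N end.

Definition half_var (v : nat + nat) : nat + nat :=
  match v with inl i => inl i./2 | inr i => inr i./2 end.

Definition odd_var (v : nat + nat) : bool :=
  match v with inl i => odd i | inr i => odd i end.

Lemma half_even_var c v : half_var (even_var c v) = v.
Proof. by case: v => i /=; rewrite half_bit_double. Qed.

Lemma odd_even_var c v : odd_var (even_var c v) = c.
Proof. by case: v => i /=; rewrite oddD odd_double addbF oddb. Qed.

Lemma even_half_var v : even_var (odd_var v) (half_var v) = v.
Proof. by case: v => i /=; rewrite odd_double_half. Qed.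

Definition ilv (m m' : mon) : mon :=
  [fsfun v in ([fset even_var b w | w in finsupp m]
       `|` [fset even_var (~~ b) w | w in finsupp m'])%fset =>
     if odd_var v == b then m (half_var v) else m' (half_var v)].

Lemma ilvE m m' v : ilv m m' v = if odd_var v == b then m (half_var v) else m' (half_var v).
Proof.
rewrite fsfun_fun; case: ifPn => //; rewrite in_fsetU negb_or => /andP[h1 h2].
case: eqP => e; apply/esym/fsfun_dflt.
  by apply: contra h1 => h; apply/imfsetP; exists (half_var v); rewrite // -e even_half_var.
apply: contra h2 => h; apply/imfsetP; exists (half_var v) => //=.
rewrite -{1}(even_half_var v); congr even_var.
by case: (odd_var v) (b) e => [] [].
Qed.

Lemma ilv_first m m' v : ilv m m' (even_var b v) = m v.
Proof. by rewrite ilvE odd_even_var eqxx half_even_var. Qed.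

Lemma ilv_second m m' v : ilv m m' (even_var (~~ b) v) = m' v.
Proof. by rewrite ilvE odd_even_var half_even_var; case: (b). Qed.

Lemma ilv_add m m' n n' : madd (ilv m m') (ilv n n') = ilv (madd m n) (madd m' n').
Proof. by apply: monP => v; rewrite maddE !ilvE !maddE; case: eqP. Qed.

Lemma ilv_inj m m' n n' : ilv m m' = ilv n n' -> m = n /\ m' = n'.
Proof.
move=> e; split; apply: monP => v.
  by rewrite -(ilv_first m m') e ilv_first.
by rewrite -(ilv_second m m') e ilv_second.
Qed.

Definition split_mon (c : bool) (M : mon) : mon :=
  [fsfun v in [fset half_var w | w in finsupp M]%fset => M (even_var c v)].

Lemma split_monE c M v : split_mon c M v = M (even_var c v).
Proof.
rewrite fsfun_fun; case: ifPn => // h; apply/esym/fsfun_dflt.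
by apply: contra h => h; apply/imfsetP; exists (even_var c v); rewrite ?half_even_var.
Qed.

Lemma ilv_split M : ilv (split_mon b M) (split_mon (~~ b) M) = M.
Proof.
apply: monP => v; rewrite ilvE !split_monE -{4}(even_half_var v).
by case: eqP => [<- //|]; case: (odd_var v) (b) => [] [].
Qed.

Lemma ilv_eq0 m m' : (ilv m m' == mon0) = (m == mon0) && (m' == mon0).
Proof.
have e : ilv mon0 mon0 = mon0 by apply: monP => v; rewrite ilvE !mon0E if_same.
by apply/eqP/andP => [|[/eqP -> /eqP ->] //]; rewrite -{1}e => /ilv_inj[-> ->].
Qed.

(** A series in both sets of variables, read as a series in the first set with coefficients in the
    second. *)
Definition theta (F : ps int) : ps (ps int) := fun m m' => F (ilv m m').

Lemma theta_is_zmod_morphism : zmod_morphism theta.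
Proof.
move=> F G; apply/funext => m; apply/funext => m'.
by rewrite /theta !(paddE, poppE).
Qed.

Lemma theta_is_monoid_morphism : monoid_morphism theta.
Proof.
split=> [|F G]; apply/funext => m; apply/funext => m'.
  rewrite /theta !poneE ilv_eq0; case: (m == mon0); rewrite ?mulr1n ?mulr0n.
    by rewrite poneE.
  by rewrite pzeroE.
rewrite /theta !pmulE psumE; under [RHS]eq_bigr do rewrite pmulE.
transitivity (\sum_(p <- [seq (ilv q.1 q'.1, ilv q.2 q'.2) | q <- decs m, q' <- decs m'])
    F p.1 * G p.2); last by rewrite big_allpairs_dep.
apply/perm_big/uniq_perm; rewrite ?decs_uniq //.
  apply: allpairs_uniq; rewrite ?decs_uniq // => -[[a1 a2] [c1 c2]] [[d1 d2] [e1 e2]] _ _ /=.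
  by case=> /ilv_inj[-> ->] /ilv_inj[-> ->].
move=> [u v]; rewrite mem_decs /=; apply/eqP/allpairsP => [e|[[[a1 a2] [c1 c2]] /=]].
  exists ((split_mon b u, split_mon b v), (split_mon (~~ b) u, split_mon (~~ b) v)).
  rewrite !mem_decs /= !ilv_split; split=> //.
    by apply/eqP/monP => w; rewrite maddE !split_monE -maddE e ilv_first.
  by apply/eqP/monP => w; rewrite maddE !split_monE -maddE e ilv_second.
by rewrite !mem_decs /= => -[/eqP <- /eqP <- [-> ->]]; rewrite ilv_add.
Qed.

HB.instance Definition _ := GRing.isZmodMorphism.Build (ps int) (ps (ps int)) theta
  theta_is_zmod_morphism.
HB.instance Definition _ := GRing.isMonoidMorphism.Build (ps int) (ps (ps int)) theta
  theta_is_monoid_morphism.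

Lemma Pinf_ilv m m' : Pinf (ilv m m') = Pinf m * Pinf m'.
Proof.
have wve c v : wv (even_var c v) = wv v by case: v.
have evI c : injective (even_var c) by move=> u v /(congr1 half_var); rewrite !half_even_var.
pose s := [seq even_var b v | v <- finsupp m] ++ [seq even_var (~~ b) v | v <- finsupp m'].
rewrite (@Pinf_wide s); first last.
- move=> v; rewrite ilvE mem_cat => h; apply/orP; move: h; case: (odd_var v =P b) => [e|nb] h.
    left; apply/mapP; exists (half_var v); first by rewrite mem_finsupp.
    by rewrite -e even_half_var.
  have e : odd_var v = ~~ b by case: (odd_var v) (b) nb => [] [].
  right; apply/mapP; exists (half_var v); first by rewrite mem_finsupp.
  by rewrite -e even_half_var.
- rewrite cat_uniq !map_inj_uniq ?fset_uniq //= andbT; apply/hasPn => w.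
  case/mapP => v _ ->; apply/negP => /mapP[v' _] /(congr1 odd_var).
  by rewrite !odd_even_var; case: (b).
rewrite big_cat !big_map /=; congr (_ * _); apply: eq_bigr => v _.
  by rewrite wve ilv_first.
by rewrite wve ilv_second.
Qed.

Lemma theta_cc (a k : int) m m' : theta (cc a k) m m' = lc a k (Pinf m * Pinf m').
Proof. by rewrite /theta /cc /lcp Pinf_ilv. Qed.

Lemma theta_Fser s m :
  theta (Fser s) m =
  (\det (\matrix_(i < size s, j < size s) theta (crow i (nth 0 s i) j))) m.
Proof.
have <- : map_mx theta (\matrix_(i < size s, j < size s) crow i (nth 0 s i) j) =
    \matrix_(i < size s, j < size s) theta (crow i (nth 0 s i) j).
  by apply/matrixP => i j; rewrite !mxE.
by rewrite det_map_mx.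
Qed.

End Interleaving.

Lemma ilv_swap m m' : ilv true m m' = ilv false m' m.
Proof. by apply: monP => v; rewrite !ilvE; case: (odd_var v). Qed.

Lemma is_interleavingE M m m' : is_interleaving M m m' <-> M = ilv false m m'.
Proof.
split=> [h|-> i]; last first.
  by rewrite !ilvE /= !odd_double /= !uphalf_double !doubleK.
apply: monP => v; rewrite -{1}(even_half_var v) ilvE.
case: v => i /=; have [h1 h2 h3 h4] := h i./2.
  by case: (odd i) => /=; rewrite ?add0n ?add1n ?h1 ?h2.
by case: (odd i) => /=; rewrite ?add0n ?add1n ?h3 ?h4.
Qed.

(** * The coefficient of a power of $y_0$ *)

Definition ypow (q : nat) : mon := iter q (madd (U (inr 0%N))) mon0.

Lemma ypowE q v : ypow q v = (if v == inr 0%N then q else 0)%N.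
Proof.
elim: q => [|q IH]; first by rewrite mon0E if_same.
by rewrite /ypow iterS maddE UE -/(ypow q) IH; case: eqP.
Qed.

Lemma mono_ypow (R : comNzRingType) q : mono R (U (inr 0%N)) ^+ q = mono R (ypow q).
Proof. by elim: q => [|q IH]; rewrite ?expr0 ?mono0 // exprS IH monoM. Qed.

Lemma ypow_divisor q (a c : mon) : madd a c = ypow q -> exists n, a = ypow n.
Proof.
move=> e; exists (a (inr 0%N)); apply: monP => v; rewrite ypowE; case: eqP => [-> //|/eqP v0].
have := congr1 (fun u : mon => u v) e; rewrite maddE ypowE (negPf v0).
by move=> /eqP; rewrite addn_eq0 => /andP[/eqP].
Qed.

Lemma Pinf_ypow q : Pinf (ypow q) = wy q.
Proof.
rewrite (@Pinf_wide [:: inr 0%N]) ?big_seq1 ?ypowE //= => v.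
by rewrite ypowE inE; case: (v == inr 0%N).
Qed.

(** On divisors of $y_0^q$, the series $P$ of the first set of variables is $1+y_0z$. Each entry
    becomes [b i j.+1 + Y * b i j], and [rdet_shift] yields the minors. *)
Lemma Fser_ypow s q m' : Fser s (ilv false (ypow q) m') = skew_col s q m'.
Proof.
pose Y : ps (ps int) := mono _ (U (inr 0%N)).
pose b i j : ps (ps int) := psC (cols s i j).
have coefY n (B : ps int) : (Y ^+ n * psC B) (ypow q) = if n == q then B else 0.
  rewrite mono_ypow; case: eqP => [->|nq].
    by have := mono_mulE (ypow q) (psC B) mon0; rewrite madd0 psC_coef eqxx.
  rewrite mulrC psC_mulE mono_coef; case: eqP => [e|]; last by rewrite mulr0.
  case: nq; have := congr1 (fun u : mon => u (inr 0%N)) e.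
  by rewrite !ypowE eqxx.
rewrite -[LHS]/(theta false (Fser s) (ypow q) m') theta_Fser.
transitivity ((rdet (size s) (fun i j => b i j.+1 + Y * b i j)) (ypow q) m').
  apply: (congr1 (fun F : ps int => F m')); apply: (@agreeE _ (ypow q) (\det _)).
  apply: agree_det => i j [u v] /ypow_divisor[n ->].
  rewrite !mxE /b; apply/funext => m1; rewrite theta_cc Pinf_ypow !paddE psC_coef.
  have e1 : j%:Z - i%:Z = j.+1%:Z - i.+1%:Z by lia.
  have e2 : j%:Z - i%:Z - 1 = j%:Z - i.+1%:Z by lia.
  case: n => [|[|n]].
  - rewrite eqxx mul1r mono_mulN ?pzeroE ?addr0 //; last first.
      move=> w ew; have := congr1 (fun u : mon => u (inr 0%N)) ew.
      by rewrite maddE UE eqxx mon0E.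
    by rewrite /cols -e1.
  - have -> : (ypow 1 == mon0) = false.
      by apply/eqP => /(congr1 (fun u : mon => u (inr 0%N))); rewrite ypowE eqxx mon0E.
    have -> : ypow 1 = madd (U (inr 0%N)) mon0 by [].
    by rewrite mono_mulE psC_coef eqxx pzeroE add0r lcX /cols -e2.
  - have ne k : (ypow k.+1 == mon0) = false.
      by apply/eqP => /(congr1 (fun u : mon => u (inr 0%N))); rewrite ypowE eqxx mon0E.
    have -> : ypow n.+2 = madd (U (inr 0%N)) (ypow n.+1) by [].
    rewrite mono_mulE psC_coef ne -[madd _ _]/(ypow n.+2) ne !pzeroE addr0.
    by rewrite mul0r raddf0.
rewrite rdet_shift psumE.
have mE k : minor_row (size s) b k = psC (minor s k).
  rewrite /minor /minor_row /rdet -det_map_mx; congr (\det _).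
  by apply/matrixP => i j; rewrite !mxE.
under eq_bigr do rewrite mE coefY.
rewrite /skew_col; case: ifPn => qs.
  rewrite (bigD1 (Ordinal (qs : (q < (size s).+1)%N))) //= eqxx big1 ?addr0 // => i iq.
  by rewrite ifF //; apply: contraNF iq => /eqP e; apply/eqP/val_inj.
rewrite big1 // => i _; rewrite ifF //; apply/negbTE; have := ltn_ord i; lia.
Qed.

(** * Slices of the determinants at a fixed monomial *)

Lemma det_sum_rows (K : comNzRingType) l B (a : 'I_l -> 'I_B -> K)
    (c : 'I_l -> 'I_l -> 'I_B -> K) :
  \det (\matrix_(i, j) \sum_(t < B) a i t * c i j t) =
  \sum_(f : {ffun 'I_l -> 'I_B})
     (\prod_i a i (f i)) * \det (\matrix_(i, j) c i j (f i)).
Proof.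
rewrite /determinant; under eq_bigr => s _.
  under eq_bigr do rewrite mxE.
  rewrite bigA_distr_bigA mulr_sumr /=; over.
rewrite exchange_big; apply: eq_bigr => f _; rewrite mulr_sumr; apply: eq_bigr => s _.
rewrite big_split /= mulrCA; congr (_ * (_ * _)).
by apply: eq_bigr => i _; rewrite mxE.
Qed.

(* Coefficients of a polynomial in powers of u = 1 + z. *)
Definition ucoef (p : {poly int}) (t : nat) : int := (p \Po ('X - 1))`_t.

Lemma ucoefE (p : {poly int}) B : (size p <= B)%N ->
  p = \sum_(t < B) ucoef p t *: (1 + 'X) ^+ t.
Proof.
move=> pB; pose p' := p \Po ('X - 1).
have e : p = p' \Po (1 + 'X).
  rewrite /p' -comp_polyA comp_polyB comp_polyX -polyC1 comp_polyC polyC1.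
  by rewrite addrAC subrr add0r comp_polyXr.
have sp : (size p' <= B)%N.
  by rewrite /p' size_comp_poly2 // -polyC1 size_XsubC.
rewrite {1}e comp_polyE (big_ord_widen _ (fun i => p'`_i *: (1 + 'X) ^+ i) sp) big_mkcond.
by apply: eq_bigr => t _; case: ltnP => // h; rewrite /ucoef nth_default // scale0r.
Qed.

Lemma lc_uexp (a k : int) t q : lc a k ((1 + 'X) ^+ t * q) = lc (a - t%:Z) k q.
Proof.
elim: t a => [|t IH] a; first by rewrite expr0 mul1r subr0.
by rewrite exprS -mulrA lc_u IH; congr lc; lia.
Qed.

Lemma lc_ucoef (a k : int) (p q : {poly int}) B : (size p <= B)%N ->
  lc a k (p * q) = \sum_(t < B) ucoef p t * lc (a - t%:Z) k q.
Proof.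
move=> pB; rewrite {1}(ucoefE pB) mulr_suml raddf_sum /=.
by apply: eq_bigr => t _; rewrite -mul_polyC -mulrA lcC lc_uexp.
Qed.

Lemma intr_mul_coef (z : int) (G : ps int) m : (z%:~R * G) m = z * G m.
Proof. by rewrite -(rmorph_int (@psC int)) psC_mulE intz. Qed.

Definition int_valued (F : ps (ps int)) : Prop := exists g : ps int, forall n, F n = (g n)%:~R.

Lemma int_valued_prod (I : Type) (r : seq I) (F : I -> ps (ps int)) :
  (forall i, int_valued (F i)) -> int_valued (\prod_(i <- r) F i).
Proof.
move=> h; elim/big_ind: _ => // [|F1 F2 [g1 e1] [g2 e2]].
  by exists 1 => n; rewrite !poneE; case: eqP.
exists (g1 * g2) => n; rewrite !pmulE rmorph_sum /=; apply: eq_bigr => p _.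
by rewrite e1 e2 rmorphM.
Qed.

Definition lowered (s : seq int) (f : nat -> nat) : seq int :=
  mkseq (fun i => nth 0 s i - (f i)%:Z) (size s).

Lemma slice b s m : exists2 L : seq (int * seq int),
  (forall p, p \in L -> exists f, p.2 = lowered s f) &
  theta b (Fser s) m = \sum_(p <- L) p.1%:~R * Fser p.2.
Proof.
pose l := size s; pose B := \max_(p <- decs m) size (Pinf p.1).
pose Pi t : ps (ps int) := fun n => (ucoef (Pinf n) t)%:~R.
rewrite theta_Fser.
pose c (i j : 'I_l) (t : 'I_B) := cc (nth 0 s i - t%:Z) (j%:Z - i%:Z).
have e1 : (\det (\matrix_(i < l, j < l) theta b (crow i (nth 0 s i) j))) m =
    (\det (\matrix_(i < l, j < l) \sum_(t < B) Pi t * psC (c i j t))) m.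
  apply: (@agreeE _ m (\det _)); apply: agree_det => i j [u v] uv.
  have sB : (size (Pinf u) <= B)%N.
    by rewrite /B (big_rem (u, v)) ?leq_maxl // mem_decs uv.
  rewrite !mxE psumE; apply/funext => m'; rewrite theta_cc (lc_ucoef _ _ _ sB) psumE.
  by apply: eq_bigr => t _; rewrite [Pi t * _]mulrC psC_mulE [c i j t * _]mulrC intr_mul_coef.
rewrite {}e1 (det_sum_rows (fun _ t => Pi t) (fun i j t => psC (c i j t))) psumE.
have ex (f : {ffun 'I_l -> 'I_B}) : exists g : nat -> nat, forall i : 'I_l, g i = f i.
  exists (fun i => if insub i is Some i' then val (f i') else 0%N) => i.
  by rewrite valK.
have exz (f : {ffun 'I_l -> 'I_B}) : exists z : int * seq int,
    (exists g, z.2 = lowered s g) /\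
    ((\prod_i Pi (f i)) * \det (\matrix_(i, j) psC (c i j (f i)))) m =
      z.1%:~R * Fser z.2.
  have [g hg] := ex f.
  have [w hw] : int_valued (\prod_i Pi (f i)).
    by apply: int_valued_prod => i; exists (fun n => ucoef (Pinf n) (f i)).
  exists (w m, lowered s g); split; first by exists g.
  have -> : \det (\matrix_(i, j) psC (c i j (f i))) = psC (Fser (lowered s g)).
    rewrite /Fser /sdet /rdet size_mkseq -/l -det_map_mx; congr (\det _).
    apply/matrixP => i j; rewrite !mxE /crow nth_mkseq // /c hg.
    by [].
  by rewrite mulrC psC_mulE hw mulrC.
have [z hz] := choice exz.
exists [seq z f | f <- enum {: {ffun 'I_l -> 'I_B}}].
  by move=> p /mapP[f _ ->]; exact: (hz f).1.
rewrite big_map big_enum /=; apply: eq_bigr => f _; exact: (hz f).2.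
Qed.

Lemma lowered_le (M : int) (s : seq int) f :
  all (fun u : int => u <= M) s -> all (fun u : int => u <= M) (lowered s f).
Proof.
move=> sM; apply/allP => u /mapP[i]; rewrite mem_iota add0n => il ->.
by apply: Order.POrderTheory.le_trans (allP sM _ (mem_nth 0 il)); rewrite /= gerBl.
Qed.

Fixpoint seqs_upto (l M : nat) : seq (seq nat) :=
  if l is l'.+1 then [::] :: [seq k :: s | k <- iota 0 M.+1, s <- seqs_upto l' M]
  else [:: [::]].

Lemma seqs_uptoS l M : seqs_upto l.+1 M =
  [::] :: [seq k :: s | k <- iota 0 M.+1, s <- seqs_upto l M].
Proof. by []. Qed.

Lemma mem_seqs_upto l M s : (size s <= l)%N -> all (fun k => (k <= M)%N) s ->
  s \in seqs_upto l M.
Proof.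
elim: l s => [|l IH] [|k s] // sl /andP[kM sM].
rewrite seqs_uptoS inE; apply/orP; right; apply/allpairsP.
by exists (k, s); rewrite IH // mem_iota add0n ltnS.
Qed.

Definition box (l M : nat) : seq intpart :=
  undup [seq la <- pmap insub (seqs_upto l M) | (size (la : intpart) <= l)%N].

Lemma mem_box l M (la : intpart) : (size la <= l)%N -> all (fun k => (k <= M)%N) la ->
  la \in box l M.
Proof.
move=> sl sM; rewrite mem_undup mem_filter sl mem_pmap_sub.
exact: mem_seqs_upto.
Qed.

Lemma box_size l M (la : intpart) : la \in box l M -> (size la <= l)%N.
Proof. by rewrite mem_undup mem_filter => /andP[]. Qed.

Lemma fsum_support (T : choiceType) (B : seq T) (F : T -> int) : uniq B ->
  (forall i, F i <> 0 -> i \in B) -> \sum_(i \in [set: T]) F i = \sum_(i <- B) F i.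
Proof.
move=> uB h; rewrite (fsbigE B) //=.
  by apply: eq_bigl => i; rewrite in_setT.
by move=> i _ iB; apply: contrapT => /h; rewrite (negPf iB).
Qed.

Lemma Fser_box (l M : nat) s : (size s <= l)%N -> all (fun u => u <= M%:Z) s ->
  exists a : intpart -> int, forall m,
    Fser s m = \sum_(la <- box l M) a la * Gpart la m.
Proof.
move=> sl sM; exists (delta s) => m; rewrite (delta_sum s (straightens_Fser m)).
rewrite (@fsum_support _ (box l M)) ?undup_uniq //.
  by apply: eq_bigr => la _; rewrite GpartE.
move=> la h; have [L [hL _] e] := delta_list sM.
have [c /hL[c1 c2] ec] : exists2 c, c \in L & c.2 = la.
  by apply: list_coef_supp => z; apply: h; rewrite e z mul0r.
by apply: mem_box; rewrite -ec //; apply: leq_trans c1 sl.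
Qed.

Lemma slice_box b (M : nat) s m : all (fun u => u <= M%:Z) s ->
  exists a : intpart -> int, forall m',
    Fser s (ilv b m m') = \sum_(la <- box (size s) M) a la * Gpart la m'.
Proof.
move=> sM; have [L hL e] := slice b s m.
have H p : p \in L -> exists a : intpart -> int, forall m',
    Fser p.2 m' = \sum_(la <- box (size s) M) a la * Gpart la m'.
  move=> /hL[f ->]; apply: Fser_box; first by rewrite size_mkseq.
  exact: lowered_le.
suff [a ha] : exists a : intpart -> int, forall m',
    (\sum_(p <- L) p.1%:~R * Fser p.2) m' = \sum_(la <- box (size s) M) a la * Gpart la m'.
  by exists a => m'; rewrite -ha -e.
elim: L H {hL e} => [|p L IH] H.
  by exists (fun=> 0) => m'; rewrite big_nil pzeroE big1 // => la _; rewrite mul0r.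
have [|a1 h1] := IH; first by move=> q qL; apply: H; rewrite inE qL orbT.
have [a2 h2] := H p (mem_head _ _).
exists (fun la => p.1 * a2 la + a1 la) => m'.
rewrite big_cons paddE h1 intr_mul_coef h2 mulr_sumr -big_split /=.
by apply: eq_bigr => la _; rewrite mulrDl mulrA.
Qed.

(** * Dual functionals and existence of the coproduct constants *)

Section DualBasis.
Variable T : eqType.
Implicit Types (B : seq T) (G : T -> mon -> int).

Definition ev (L : seq (int * mon)) (F : mon -> int) : int := \sum_(p <- L) p.1 * F p.2.

Lemma ev_sum L (I : Type) (r : seq I) (a : I -> int) (F : I -> mon -> int) :
  ev L (fun m => \sum_(i <- r) a i * F i m) = \sum_(i <- r) a i * ev L (F i).
Proof.
rewrite /ev; under eq_bigr do rewrite mulr_sumr.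
rewrite exchange_big /=; apply: eq_bigr => i _; rewrite mulr_sumr.
by apply: eq_bigr => p _; rewrite mulrCA.
Qed.

(** Elimination in order of increasing rank: the functional of the least element is already dual to
    all of [B], and the other functionals are corrected by multiples of it. *)
Lemma dual_basis (rank : T -> nat) B G (t : T -> seq (int * mon)) :
  uniq B -> (forall k l, k \in B -> l \in B -> (rank k <= rank l)%N ->
    ev (t k) (G l) = (k == l)%:R) ->
  exists th : T -> seq (int * mon),
    forall k l, k \in B -> l \in B -> ev (th k) (G l) = (k == l)%:R.
Proof.
move=> uB h.
pose B' := sort (fun a b => (rank a <= rank b)%N) B.
have mB : B =i B' by move=> k; rewrite mem_sort.
have uB' : uniq B' by rewrite sort_uniq.
have sB' : sorted (fun a b => (rank a <= rank b)%N) B'.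
  by apply: sort_sorted => a b; apply: leq_total.
suff [th hth] : exists th : T -> seq (int * mon),
    forall k l, k \in B' -> l \in B' -> ev (th k) (G l) = (k == l)%:R.
  by exists th => k l kB lB; apply: hth; rewrite -mB.
have {}h k l : k \in B' -> l \in B' -> (rank k <= rank l)%N ->
    ev (t k) (G l) = (k == l)%:R by rewrite -!mB; exact: h.
elim: B' uB' sB' h {mB} => [|k0 B1 IH]; first by exists t.
move=> /= /andP[k0B uB1] sB1 h.
have k0min l : l \in B1 -> (rank k0 <= rank l)%N.
  have tr : transitive (fun a b => (rank a <= rank b)%N) by move=> a b c; apply: leq_trans.
  by move=> lB; apply: (allP (order_path_min tr sB1)).
have t0 l : l \in k0 :: B1 -> ev (t k0) (G l) = (k0 == l)%:R.
  move=> lB; apply: h => //; first exact: mem_head.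
  by move: lB; rewrite inE => /orP[/eqP -> //|/k0min].
have [k l kB lB rkl|th hth] := IH uB1 (path_sorted sB1).
  by apply: h; rewrite ?inE ?kB ?lB ?orbT.
exists (fun k => if k == k0 then t k0 else
   th k ++ [seq (- ev (th k) (G k0) * p.1, p.2) | p <- t k0]) => k l.
rewrite inE => kB lB; case: (eqVneq k k0) kB => [-> _|kk0 /= kB]; first exact: t0.
rewrite /ev big_cat big_map /=.
have -> : \sum_(p <- t k0) - (\sum_(p <- th k) p.1 * G k0 p.2) * p.1 * G l p.2 =
    - ev (th k) (G k0) * ev (t k0) (G l).
  by rewrite [in RHS]/ev mulr_sumr; apply: eq_bigr => p _; rewrite mulrA.
rewrite -/(ev (th k) (G l)) t0 //.
move: lB; rewrite inE => /orP[/eqP ->|lB].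
  by rewrite eqxx mulr1 subrr (negPf kk0).
rewrite hth // (_ : (k0 == l) = false) ?mulr0 ?addr0 //.
by apply: contraNF k0B => /eqP ->.
Qed.

(** The coordinates of a slice are recovered by the dual functionals [th]; applying these in both
    arguments of [H] gives [d]. *)
Lemma tensor_basis B G (H : mon -> mon -> int) (th : T -> seq (int * mon)) : uniq B ->
  (forall k l, k \in B -> l \in B -> ev (th k) (G l) = (k == l)%:R) ->
  (forall m, exists a, forall m', H m m' = \sum_(k <- B) a k * G k m') ->
  (forall m', exists a, forall m, H m m' = \sum_(k <- B) a k * G k m) ->
  exists d, forall m m',
    H m m' = \sum_(k <- B) \sum_(l <- B) d k l * (G k m * G l m').
Proof.
move=> uB hth h1 h2.
have dual a k : k \in B -> ev (th k) (fun m => \sum_(l <- B) a l * G l m) = a k.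
  move=> kB; rewrite ev_sum (bigD1_seq k) //= hth // eqxx mulr1 big_seq_cond big1 ?addr0 //.
  by move=> l /andP[lB lk]; rewrite hth // eq_sym (negPf lk) mulr0.
have e1 m m' : H m m' = \sum_(l <- B) ev (th l) (H m) * G l m'.
  have [a ha] := h1 m; have eH := funext ha; rewrite ha big_seq [RHS]big_seq.
  by apply: eq_bigr => l lB; rewrite eH dual.
have e2 m m' : H m m' = \sum_(k <- B) ev (th k) (H^~ m') * G k m.
  have [a ha] := h2 m'; have eH := funext ha; rewrite ha big_seq [RHS]big_seq.
  by apply: eq_bigr => l lB; rewrite eH dual.
exists (fun k l => ev (th k) (fun n => ev (th l) (H n))) => m m'.
rewrite e2; apply: eq_bigr => k _.
have eH : H^~ m' = fun n => \sum_(l <- B) G l m' * ev (th l) (H n).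
  by apply/funext => n; rewrite e1; apply: eq_bigr => l _; rewrite mulrC.
rewrite eH (ev_sum _ _ (fun l => G l m') (fun l n => ev (th l) (H n))) mulr_suml.
by apply: eq_bigr => l _; rewrite [G l m' * ev _ _]mulrC -mulrA [G l m' * _]mulrC.
Qed.

End DualBasis.

Lemma det_scale_cols (K : comNzRingType) n (A : 'M[K]_n) (d : 'I_n -> K) :
  \det (\matrix_(i, j) (A i j * d j)) = \det A * \prod_j d j.
Proof.
have -> : \prod_j d j = \det (diag_mx (\row_j d j)).
  by rewrite det_diag; apply: eq_bigr => i _; rewrite mxE.
rewrite -det_mulmx; congr (\det _); apply/matrixP => i j.
by rewrite mul_mx_diag !mxE.
Qed.

Lemma det_scale_rows (K : comNzRingType) n (A : 'M[K]_n) (d : 'I_n -> K) :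
  \det (\matrix_(i, j) (d i * A i j)) = (\prod_j d j) * \det A.
Proof.
have -> : \prod_j d j = \det (diag_mx (\row_j d j)).
  by rewrite det_diag; apply: eq_bigr => i _; rewrite mxE.
rewrite -det_mulmx; congr (\det _); apply/matrixP => i j.
by rewrite mul_diag_mx !mxE.
Qed.

Section LeadingCoefficient.
Variable N : nat.

Definition xvar (k : 'I_N) : nat + nat := inl (k : nat).

Lemma xvar_inj : injective xvar.
Proof. by move=> i j [/val_inj]. Qed.

(** The monomial $x^{\kappa+\rho}$. *)
Definition xmon (ka : intpart) : mon :=
  [fsfun v in [fset inl i | i in iota 0 N]%fset =>
     match v with inl i => shifted N ka i | inr _ => 0%N end].

Lemma xmon_var ka (k : 'I_N) : xmon ka (xvar k) = shifted N ka k.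
Proof.
rewrite fsfun_fun ifT //; apply/imfsetP; exists (k : nat) => //=.
by rewrite mem_iota /= add0n.
Qed.

Lemma xmon_supp ka v : xmon ka v != 0%N -> exists k, v = xvar k.
Proof.
rewrite fsfun_fun; case: ifPn => // /imfsetP[i /=]; rewrite mem_iota add0n => /andP[_ iN] -> _.
by exists (Ordinal iN).
Qed.

Definition lead_factor : ps int :=
  \det (Emx (fun i : 'I_N => X i)) * \prod_(i < N) (1 - x i) ^+ N.-1.

(** The coefficient of $x^{\kappa+\rho}$ in [lead_factor * F], as a finite combination of
    coefficients of [F]. *)
Definition lead (ka : intpart) : seq (int * mon) :=
  [seq (lead_factor p.1, p.2) | p <- decs (xmon ka)].

Lemma ev_lead ka (F : ps int) : ev (lead ka) F = (lead_factor * F) (xmon ka).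
Proof. by rewrite /ev big_map pmulE. Qed.

Lemma agree_y0 ka l : agree (xmon ka) (y l) 0.
Proof.
move=> [a c] /= e; rewrite pzeroE /y mono_coef; case: eqP => // ea.
have : xmon ka (inr l) != 0%N by rewrite -e maddE ea UE eqxx.
by move=> /xmon_supp[].
Qed.

Lemma agree_sum_y ka i (s : seq nat) :
  agree (xmon ka) (\prod_(l <- s) (X i + y l)) (X i ^+ size s).
Proof.
elim: s => [|l s IH]; first by rewrite big_nil expr0.
rewrite big_cons exprS; apply: agreeM => //.
by have := agreeD (@agree_refl _ (xmon ka) (X i)) (@agree_y0 ka l); rewrite addr0.
Qed.

(** The monomial contains no $y$. At $y=0$ the product of [lead_factor] and $G_\lambda$ is, up to
    the sign $(-1)^j$ of each row, the alternant of $\lambda+\rho$, so [altdet_shifted_coef]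
    applies. *)
Lemma ev_lead_Gpart (ka la : intpart) : (size ka <= N)%N -> (size la <= N)%N ->
  (part_weight ka <= part_weight la)%N -> ev (lead ka) (Gpart la) = (ka == la)%:R.
Proof.
move=> kN lN kl; rewrite ev_lead.
pose A : 'M[{mpoly int[N]}]_N :=
  \matrix_(j < N, i < N) ('X_i ^+ shifted N la j * ('X_i - 1) ^+ j).
have e : agree (xmon ka) (lead_factor * Gpart la)
    (io_gen xvar (\det (\matrix_(j, i) ((-1) ^+ j * A j i)))).
  have h1 : agree (xmon ka) (Gpart la) (rdet N (flagged N la)).
    rewrite GpartE flagged_trim // /Fser size_map; apply: agree_det => j r.
    rewrite !mxE /flagged /crow nth_seq_of_part; apply: lcp_agree => p ep.
    apply/esym; move: p ep; apply: Pfin_agree; first exact: vars_xy_uniq.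
    by move=> v /xmon_supp[k ->]; rewrite mem_vars_xy /=.
  have h2 : agree (xmon ka) (lead_factor * Gpart la)
      (\prod_(i < N) (1 - x i) ^+ N.-1 *
       (rdet N (flagged N la) * \det (Emx (fun i : 'I_N => X i)))).
    rewrite /lead_factor [Z in agree _ _ Z]mulrCA mulrC.
    by apply: agreeM => //; rewrite mulrC.
  move=> p ep; rewrite h2 // det_flagged // mulrC -det_scale_cols.
  move: p ep; rewrite -det_map_mx; apply: agree_det => j i.
  rewrite !mxE.
  rewrite -[Z in agree _ _ Z]/(io_gen xvar _) !(rmorphM, rmorphXn, rmorphB, rmorph1) /=.
  rewrite io_gen_var -/(x i) rmorphN1.
  have -> : (-1) ^+ j * (x i ^+ shifted N la j * (x i - 1) ^+ j) =
      (1 - x i) ^+ nth 0%N la j * X i ^+ shifted N la j * (1 - x i) ^+ N.-1.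
    rewrite mulrCA -exprMn mulN1r opprB {1}x_X exprMn.
    rewrite -mulrA [X i ^+ _ * _]mulrC !mulrA -!exprD mulrAC -exprD.
    by congr (_ ^+ _ * _); rewrite /shifted; have := ltn_ord j; lia.
  apply: agreeM => //; apply: agreeM => //.
  by rewrite -[Z in agree _ _ (_ ^+ Z)](size_iota 0); exact: agree_sum_y.
rewrite (agreeE e) io_gen_coef; [|exact: xvar_inj|exact: xmon_supp].
rewrite det_scale_rows.
have -> : \prod_(j < N) (-1) ^+ j = ((\prod_(j < N) (-1) ^+ j : int)%:MP : {mpoly int[N]}).
  by rewrite rmorph_prod; apply: eq_bigr => j _; rewrite rmorphXn rmorphN1.
rewrite mcoeffCM.
have -> : [multinom xmon ka (xvar k) | k < N] = [multinom shifted N ka k | k < N].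
  by apply/mnmP => k; rewrite !mnmE xmon_var.
rewrite altdet_shifted_coef // eq_sym; case: eqP => _; last by rewrite mulr0.
by rewrite -big_split big1 // => j _; rewrite /= -exprMn mulN1r opprK expr1n.
Qed.

End LeadingCoefficient.

Lemma part_bounded (la : intpart) :
  all (fun u : int => u <= (head 0%N la)%:Z) (seq_of_part la).
Proof.
rewrite all_map; apply/allP => k /(nthP 0%N)[i il <-] /=.
by have := part_le_head la i; lia.
Qed.

(** In either argument, the slices of $G_\nu(x,x';y,y')$ lie in the span of one box, on which the
    functionals [lead] are triangular with respect to the weight. *)
Lemma coproduct_exists nu : exists d, is_coproduct nu d.
Proof.
pose l := size nu; pose B := box l (head 0%N nu).
have uB : uniq B by exact: undup_uniq.
have [th hth] := @dual_basis intpart part_weight B (fun la => Gpart la) (lead l) uB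
  (fun k la kB lB => ev_lead_Gpart (box_size kB) (box_size lB)).
pose H m m' := Fser (seq_of_part nu) (ilv false m m').
have [d hd] : exists d, forall m m', H m m' =
    \sum_(k <- B) \sum_(la <- B) d k la * (Gpart k m * Gpart la m').
  apply: (tensor_basis uB hth) => [m|m'].
    have [a ha] := slice_box false m (part_bounded nu).
    by exists a => m'; rewrite /H ha size_map.
  have [a ha] := slice_box true m' (part_bounded nu).
  by exists a => m; rewrite /H -ilv_swap ha size_map.
pose d' k la := if (k \in B) && (la \in B) then d k la else 0.
exists d' => M m m' /is_interleavingE -> /=.
pose BB := [seq (k, la) | k <- B, la <- B].
have supp p : d' p.1 p.2 * (Gpart p.1 m * Gpart p.2 m') <> 0 -> p \in BB.
  rewrite /d'; case: ifPn => [/andP[kB lB] _|]; last by rewrite mul0r.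
  by apply/allpairsP; exists p; case: p kB lB.
split.
  by apply: (@sub_finite_set _ _ [set` BB]); [move=> p /supp | exact: finite_seq].
rewrite (@fsum_support _ BB) //; last first.
  by apply: allpairs_uniq => // -[? ?] [? ?] _ _ /= [-> ->].
rewrite GpartE -[LHS]/(H m m') hd big_allpairs big_seq [RHS]big_seq.
apply: eq_bigr => k kB; rewrite big_seq [RHS]big_seq; apply: eq_bigr => la lB.
by rewrite /d' kB lB.
Qed.

Lemma coproductP nu : is_coproduct nu (coproduct nu).
Proof.
have [d hd] := coproduct_exists nu.
exact: (@xgetI _ (fun _ _ => 0) [set d | is_coproduct nu d] d hd).
Qed.

(** The coefficient is a determinant of numbers [ecf]. For $(1^q)$ it is triangular with unit
    diagonal; otherwise, by degree, the first row vanishes (if a part exceeds 1) or the last column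
    does (if all parts are 1 and there are more than [q]). *)
Lemma Gpart_ypow la q : Gpart la (ypow q) = (la == ones q)%:R.
Proof.
have eq0 : ilv false (ypow q) mon0 = ypow q.
  apply: monP => v; rewrite ilvE !ypowE mon0E.
  by case: v => -[|[|i]] //=; rewrite ?if_same //; case: ifP.
rewrite GpartE -eq0 Fser_ypow /skew_col size_map; case: ifPn => ql; last first.
  rewrite pzeroE; case: eqP => // e; move: ql; rewrite e size_nseq leqnn //.
have ev0 (a k : int) : cc a k mon0 = ecf a k.
  rewrite /cc /lcp /Pinf finsupp0 big_nil /lc size_poly1 big_ord1 coef1 mul1r.
  by rewrite subr0.
have -> : minor (seq_of_part la) q mon0 =
    rdet (size la) (fun i k => ecf (nth 0%N la i) ((bump q k)%:Z - i.+1%:Z)).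
  rewrite -[LHS]/(ps_eval0 _) /minor /minor_row /rdet size_map -det_map_mx.
  congr (\det _); apply/matrixP => i j.
  by rewrite !mxE /= /ps_eval0 /cols ev0 nth_seq_of_part.
case: eqP => [e|ne].
  have sl : size la = q by rewrite e size_nseq.
  have nth1 i : (i < size la)%N -> nth 0%N la i = 1%N.
    by rewrite e size_nseq nth_nseq => ->.
  rewrite /rdet det_trig; last first.
    apply/is_trig_mxP => i j ij; rewrite !mxE nth1 // ecf_gt //.
    by have := ltn_ord j; rewrite /bump; lia.
  rewrite big1 // => i _; rewrite !mxE nth1 //.
  have -> : bump q i = i by rewrite /bump; have := ltn_ord i; lia.
  have -> : i%:Z - i.+1%:Z = - 1%:Z by lia.
  exact: ecf_top.
have [h2|h1] := boolP (has (fun k => (1 < k)%N) la).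
  have l0 : (0 < size la)%N by case: (size la) (has_nthP 0%N h2) => // -[].
  have big0 : (1 < nth 0%N la 0)%N.
    by have [i il hi] := has_nthP 0%N h2; have := parts_dec la (leq0n i); lia.
  rewrite /rdet (expand_det_row _ (Ordinal l0)) big1 // => j _.
  by rewrite mxE ecf_gt ?mul0r // /bump /=; lia.
have nth1 i : (i < size la)%N -> nth 0%N la i = 1%N.
  by move=> il; have := parts_pos il; have := hasPn h1 _ (mem_nth 0%N il); rewrite /=; lia.
have la1 : la = ones (size la).
  apply: (@intpart_eq (size la)); rewrite ?size_nseq // => i il.
  by rewrite nth_nseq il nth1.
have ql' : (q < size la)%N.
  by rewrite ltn_neqAle ql andbT; apply: contra_not_neq ne => ->.
have l1 : ((size la).-1 < size la)%N by lia.
rewrite /rdet (expand_det_col _ (Ordinal l1)) big1 // => i _.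
rewrite mxE nth1 ?ltn_ord // ecf_gt ?mul0r //=.
by have := ltn_ord i; rewrite /bump; lia.
Qed.

(** * Skewing by a column, and the identity *)

(** For a partition $\nu$, the coefficient of $y_0^q$ in the coproduct selects $\lambda=(1^q)$ by
    [Gpart_ypow] and equals the minor by [Fser_ypow]; [delta_sum] extends this to sequences. *)
Lemma Gskew_ones s q : Gskew s (ones q) = skew_col s q.
Proof.
apply/funext => m'; rewrite (delta_sum s (@straightens_skew_col q m')).
pose P := [set nu | delta s nu <> 0].
have fP : finite_set P by exact: delta_finite.
pose g nu mu := coproduct nu (ones q) mu * Gpart mu m'.
have col nu : finite_set [set mu | g nu mu <> 0] /\
    \sum_(mu \in [set: intpart]) g nu mu = skew_col (seq_of_part nu) q m'.
  have /= [fin e] := @coproductP nu _ (ypow q) m' (proj2 (is_interleavingE _ _ _) erefl).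
  split.
    apply: (@sub_finite_set _ _ (snd @` [set p | coproduct nu p.1 p.2 *
        (Gpart p.1 (ypow q) * Gpart p.2 m') <> 0])); last exact: finite_image.
    move=> mu gmu; exists (ones q, mu) => //=.
    by rewrite Gpart_ypow eqxx mul1r.
  rewrite -Fser_ypow -GpartE e.
  rewrite -(@fsbig_widen _ _ _ _ ((fun mu => (ones q, mu)) @` setT) setT) //; last first.
    move=> [la mu] /= [_ h]; rewrite Gpart_ypow; case: eqP => [el|_].
      by case: h; exists mu => //; rewrite el.
    by rewrite mul0r mulr0.
  rewrite fsbig_image; last by move=> a b _ _ [].
  by apply: eq_fsbigr => mu _; rewrite /= Gpart_ypow eqxx mul1r.
rewrite /Gskew /ssum.
(* A sum with infinite support would be 0 by convention, so the double sum is confined to finite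
   sets before it is rearranged. *)
pose Q := \bigcup_(nu in P) [set mu | g nu mu <> 0].
have fQ : finite_set Q by apply: bigcup_finite => // nu _; exact: (col nu).1.
transitivity (\sum_(nu \in P) \sum_(mu \in Q) delta s nu * g nu mu).
  transitivity (\sum_(p \in [set: intpart * intpart]) delta s p.1 * g p.1 p.2).
    by apply: eq_fsbigr => p _; rewrite /sscale /g mulrA.
  rewrite pair_fsbig //; symmetry; apply: fsbig_widen => // -[nu mu] /= [_ h].
  have [z|nz] := pselect (delta s nu = 0); first by rewrite z mul0r.
  have [z|nz'] := pselect (g nu mu = 0); first by rewrite z mulr0.
  by case: h; split=> //; exists nu.
rewrite [RHS](_ : _ = \sum_(nu \in P) delta s nu * skew_col (seq_of_part nu) q m').
  apply: eq_fsbigr => nu /set_mem nuP; rewrite -mulr_fsumr -(col nu).2; congr (_ * _).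
  apply: fsbig_widen => // mu /= [_ h]; apply: contrapT => nz; apply: h.
  by exists nu.
symmetry; apply: fsbig_widen => // nu /= [_ h].
have [z|nz] := pselect (delta s nu = 0); first by rewrite z mul0r.
by case: h.
Qed.

Theorem theorem6p1 (a : int) (I : seq int) :
  let term (p : nat * nat) : series :=
    let q := p.1 in let t := p.2 in
    sscale ((-1) ^+ q * ('C(q - 1 + t, t))%:Z)
           (smul (Gint (a + q%:Z + t%:Z)) (Gskew I (ones q))) in
  let range : set (nat * nat) := [set p | (1 <= p.1)%N] in
  summable range term /\
  Gseq (a :: I) = sadd (smul (Gint a) (Gseq I)) (ssum range term).
Proof.
move=> term range.
pose coef (q t : nat) : int := (-1) ^+ q * ('C(q - 1 + t, t))%:Z.
have termE q t m : term (q, t) m =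
    coef q t * \sum_(p <- decs m) cc (a + q%:Z + t%:Z) 0 p.1 * skew_col I q p.2.
  by rewrite /term /sscale smulE GintE Gskew_ones pmulE.
pose D m := \max_(p <- decs m) size (Pinf p.1).
have sD m (p : mon * mon) : p \in decs m -> (size (Pinf p.1) <= D m)%N.
  by move=> pm; rewrite /D (big_rem p) ?leq_maxl.
(* For $t\ge T(m)$ the series $G_{a+q+t}$ has no term dividing [m], by degree in $z$; the absolute
   value compensates a negative [a]. *)
pose T m := (D m + `|a|)%N.
pose S m := [seq (q, t) | q <- iota 1 (size I), t <- iota 0 (T m)].
have supp m i : range i /\ term i m <> 0 -> i \in S m.
  case: i => q t [/= q1]; rewrite termE => h; apply/allpairsP; exists (q, t) => /=.
  rewrite !mem_iota /= add0n add1n ltnS q1; split=> //.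
    rewrite leqNgt; apply/negP => Iq; apply: h.
    by rewrite big1 ?mulr0 // => p _; rewrite /skew_col leqNgt Iq /= pzeroE mulr0.
  rewrite ltnNge; apply/negP => Tt; apply: h.
  rewrite big_seq big1 ?mulr0 // => p pm; rewrite /cc /lcp lc_gt ?mul0r //.
  by have := sD _ _ pm; rewrite /T in Tt; lia.
split=> [m|].
  by apply: (@sub_finite_set _ _ [set` S m]); [move=> i /supp | exact: finite_seq].
apply/funext => m; rewrite /sadd /ssum smulE GintE !GseqE Fser_cons psumE.
(* The column $q=0$ contributes the product $G_a\cdot G_I$. *)
rewrite big_ord_recl expr0 mul1r minor0; congr (_ + _).
rewrite (fsbigE (S m)) //=; first last.
- move=> i ri iS; apply: contrapT => h; case/negP: iS; exact: supp.
- by move=> i /= /allpairsP[[q t] /= [+ _ ->]]; rewrite mem_iota /range /= => /andP[].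
- by apply: allpairs_uniq; rewrite ?iota_uniq // => -[? ?] [? ?] _ _ /= [-> ->].
have -> : \sum_(i <- S m | i \in range) term i m = \sum_(i <- S m) term i m.
  rewrite big_seq_cond [RHS]big_seq; apply: eq_bigl => i.
  rewrite andb_idr // => /allpairsP[[q t] /= [+ _ ->]].
  by rewrite mem_iota => /andP[q1 _]; apply/mem_set.
rewrite big_allpairs -[iota 1 _]/(iota (1 + 0) _) iotaDl big_map.
have iotaE n : iota 0 n = index_iota 0 n by rewrite /index_iota subn0.
rewrite iotaE big_mkord.
apply: eq_bigr => i _; rewrite add1n /bump leq0n add1n.
rewrite iotaE big_mkord.
under [RHS]eq_bigr do rewrite termE /coef subn1 /=.
rewrite -mulrA (_ : _ m = (-1) ^+ i.+1 * (cc a i.+1 * minor I i.+1) m); last first.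
  rewrite -signr_odd -[in RHS]signr_odd.
  by case: (odd _); rewrite ?expr1 ?mulN1r ?poppE ?expr0 ?mul1r.
rewrite pmulE (eq_bigr (fun t : 'I_(T m) => \sum_(p <- decs m) (-1) ^+ i.+1 *
    (('C(i + t, t))%:Z * cc (a + i.+1%:Z + t%:Z) 0 p.1 * minor I i.+1 p.2))); last first.
  by move=> t _; rewrite mulr_sumr; apply: eq_bigr => p _; rewrite /skew_col ltn_ord !mulrA.
rewrite exchange_big mulr_sumr big_seq [RHS]big_seq; apply: eq_bigr => p pm.
rewrite -mulr_sumr -mulr_suml; congr (_ * (_ * _)).
by rewrite /cc /lcp; apply: lc_binomial; have := sD _ _ pm; rewrite /T; lia.
Qed.
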